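(* Let $k$ be an algebraically closed field of characteristic zero, let $\Delta$ be the monochromatic triangle with Boalch algebra $\mathcal{B}(\Delta)$, and let $d=(d_1,d_2,d_3)\in\mathbb{Z}_{\geq0}^3$. The Hamiltonian double quasi-Poisson algebra $\big(\mathcal{B}(\Delta),\{\!\{-,-\}\!\},\Phi\big)$ with $\Phi=\gamma_1+\gamma_2+\gamma_3$ (with the double bracket given in the context) induces a Hamiltonian quasi-Poisson $\mathrm{GL}_d$-structure on $\mathrm{Rep}(\mathcal{B}(\Delta),d)$.
   Context: The algebra. $\mathcal{B}(\Delta)$ is the associative unital $k$-algebra generated by $e_1,e_2,e_3$, $v_{ij}$ and $w_{ij}$ ($i\ne j$ in $\{1,2,3\}$), and $\gamma_i^{\pm1}$ ($i=1,2,3$), subject to $1=e_1+e_2+e_3$, $e_ie_j=\delta_{ij}e_i$, $v_{ij}=e_iv_{ij}e_j$, $w_{ij}=e_iw_{ij}e_j$, $\gamma_i^{\pm1}=e_i\gamma_i^{\pm1}e_i$, $\gamma_i\gamma_i^{-1}=e_i=\gamma_i^{-1}\gamma_i$, and $$(1+v_{21}+v_{31}+v_{32})(1+v_{12}+v_{13}+v_{23})=(1+w_{12}+w_{13}+w_{23})(\gamma_1+\gamma_2+\gamma_3)(1+w_{21}+w_{31}+w_{32}).$$ It is a localization of the path algebra of the quiver with vertices $1,2,3$ and arrows $v_{ij}:j\to i$ (paths read right to left). Put $B=ke_1\oplus ke_2\oplus ke_3$. Double bracket. A $B$-linear double bracket on a $B$-algebra $A$ is a $k$-bilinear map $\{\!\{-,-\}\!\}:A\times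 A\to A\otimes A$ vanishing if an argument is in $B$, with $\{\!\{a,b\}\!\}=-\tau_{(12)}\{\!\{b,a\}\!\}$ ($\tau_{(12)}$ the flip) and $\{\!\{a,bc\}\!\}=\{\!\{a,b\}\!\}c+b\{\!\{a,c\}\!\}$, where $x(a'\otimes a'')y=xa'\otimes a''y$. The one used on $\mathcal{B}(\Delta)$ is determined by these rules and $\{\!\{v_{ij},v_{ij}\}\!\}=0$, $\{\!\{v_{12},v_{13}\}\!\}=\tfrac12 v_{12}\otimes v_{13}$, $\{\!\{v_{12},v_{32}\}\!\}=\tfrac12 v_{32}\otimes v_{12}$, $\{\!\{v_{21},v_{31}\}\!\}=-\tfrac12 v_{31}\otimes v_{21}$, $\{\!\{v_{21},v_{23}\}\!\}=-\tfrac12 v_{21}\otimes v_{23}$, $\{\!\{v_{13},v_{23}\}\!\}=\tfrac12 v_{23}\otimes v_{13}$, $\{\!\{v_{13},v_{32}\}\!\}=-\tfrac12 e_3\otimes v_{13}v_{32}$, $\{\!\{v_{31},v_{23}\}\!\}=\tfrac12 v_{23}v_{31}\otimes e_3$, $\{\!\{v_{31},v_{32}\}\!\}=-\tfrac12 v_{31}\otimes v_{32}$, $\{\!\{v_{12},v_{21}\}\!\}=-e_2\otimes e_1-\tfrac12(e_2\otimes v_{12}v_{21}+v_{21}v_{12}\otimes e_1)$, $\{\!\{v_{12},v_{31}\}\!\}=-\tfrac12 v_{31}v_{12}\otimes e_1-v_{32}\otimes e_1$, $\{\!\{v_{12},v_{23}\}\!\}=-\tfrac12 e_2\otimes v_{12}v_{23}+e_2\otimes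 v_{13}$, $\{\!\{v_{21},v_{13}\}\!\}=\tfrac12 e_1\otimes v_{21}v_{13}+e_1\otimes v_{23}$, $\{\!\{v_{21},v_{32}\}\!\}=\tfrac12 v_{32}v_{21}\otimes e_2-v_{31}\otimes e_2$, $\{\!\{v_{13},v_{31}\}\!\}=-e_3\otimes e_1-v_{32}v_{23}\otimes e_1-\tfrac12(e_3\otimes v_{13}v_{31}+v_{31}v_{13}\otimes e_1)$, $\{\!\{v_{23},v_{32}\}\!\}=-e_3\otimes e_2-\tfrac12(e_3\otimes v_{23}v_{32}+v_{32}v_{23}\otimes e_2)$. A Hamiltonian double quasi-Poisson algebra is an algebra with a double bracket satisfying Van den Bergh's quasi-Poisson property and with a multiplicative moment map $\Phi=\sum_s\Phi_s$, i.e. $\Phi$ is invertible, $\Phi_s\in e_sAe_s$, and $\{\!\{\Phi_s,a\}\!\}=\frac12(ae_s\otimes\Phi_s-e_s\otimes\Phi_sa+a\Phi_s\otimes e_s-\Phi_s\otimes e_sa)$ for all $a$ and $s$. Representation scheme. Let $N=d_1+d_2+d_3$ and embed $B$ diagonally in $M_N(k)$ so that $e_s$ is the identity of the $s$-th $d_s\times d_s$ diagonal block. For a finitely generated $B$-algebra $A$, $A_d$ is the commutative algebra generated by symbols $a_{ij}$ ($a\in A$, $1\le i,j\le N$), with relations making $a\mapsto(a_{ij})$ $k$-linear and multiplicative into $N\times N$ matrices and sending each $e_s$ to its block identity matrix; it represents $C\mapsto\mathrm{Hom}_B(A,M_N(C))$, and $\mathrm{Rep}(A,d)=\mathrm{Spec}(A_d)$.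 The group $\mathrm{GL}_d=\prod_s\mathrm{GL}_{d_s}(k)$ acts by $g.a_{ij}=\sum_{k,\ell}g_{ik}a_{k\ell}(g^{-1})_{\ell j}$. Hamiltonian quasi-Poisson structure (in the sense of Alekseev, Kosmann-Schwarzbach and Meinrenken, algebraic version): a $\mathrm{GL}_d$-invariant antisymmetric biderivation (quasi-Poisson bracket) on functions whose corresponding bivector $P$ has Schouten square $[P,P]$ equal to the trivector generated, via the infinitesimal action, by the Cartan trivector of $\mathfrak{gl}_d=\prod_s\mathfrak{gl}_{d_s}$ with respect to the trace pairing, together with an equivariant map to $\mathrm{GL}_d$ that is a group-valued moment map. ''Induces'' means: the bracket is given on generators by $\{a_{ij},b_{uv}\}=\{\!\{a,b\}\!\}'_{uj}\{\!\{a,b\}\!\}''_{iv}$ for $a,b\in\mathcal{B}(\Delta)$ (Sweedler notation $\{\!\{a,b\}\!\}=\{\!\{a,b\}\!\}'\otimes\{\!\{a,b\}\!\}''$), and the group-valued moment map is given by the matrix-valued function $(\Phi_{ij})$. *)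

(* Defs.v *)
From HB Require Import structures.
From mathcomp Require Import all_boot all_order all_algebra.
From mathcomp Require Import boolp.

Set Implicit Arguments.
Unset Strict Implicit.
Unset Printing Implicit Defensive.

Import GRing.Theory.
Local Open Scope ring_scope.
Local Open Scope quotient_scope.

(* The classical axioms of boolp are used to form quotients by undecidable    *)
(* congruences.                                                               *)

(* The k-algebra with generators X and relations R is the quotient palg R of  *)
(* the terms by pres_eq R, the least congruence containing R and satisfying   *)
(* the axioms of associative unital k-algebras.                               *)
Inductive pterm (k : fieldType) (X : Type) : Type :=
| Gen of X
| Const of k
| Add of pterm k X & pterm k X
| Mul of pterm k X & pterm k X.

Arguments Gen {k X} _.
Arguments Const {k X} _.

HB.instance Definition _ (k : fieldType) (X : Type) := gen_eqMixin (pterm k X).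
HB.instance Definition _ (k : fieldType) (X : Type) :=
  gen_choiceMixin (pterm k X).

Declare Scope pres_scope.
Delimit Scope pres_scope with pres.
Bind Scope pres_scope with pterm.
Notation "0" := (Const 0%R) : pres_scope.
Notation "1" := (Const 1%R) : pres_scope.
Notation "s + t" := (Add s t) : pres_scope.
Notation "s * t" := (Mul s t) : pres_scope.
Notation "\sum_ ( i < n ) t" :=
  (\big[@Add _ _/Const 0%R]_(i < n) t%pres) : pres_scope.

Section Presentation.
Variables (k : fieldType) (X : Type).
Implicit Types (s t u : pterm k X) (R : pterm k X -> pterm k X -> Prop).

Inductive pres_eq R : pterm k X -> pterm k X -> Prop :=
| pres_rel s t : R s t -> pres_eq R s t
| pres_refl s : pres_eq R s s
| pres_sym s t : pres_eq R s t -> pres_eq R t s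
| pres_trans s t u : pres_eq R s t -> pres_eq R t u -> pres_eq R s u
| pres_add s s' t t' :
    pres_eq R s s' -> pres_eq R t t' -> pres_eq R (s + t)%pres (s' + t')%pres
| pres_mul s s' t t' :
    pres_eq R s s' -> pres_eq R t t' -> pres_eq R (s * t)%pres (s' * t')%pres
| pres_addA s t u : pres_eq R (s + (t + u))%pres ((s + t) + u)%pres
| pres_addC s t : pres_eq R (s + t)%pres (t + s)%pres
| pres_add0 s : pres_eq R (0 + s)%pres s
| pres_addN s : pres_eq R (Const (- 1)%R * s + s)%pres 0%pres
| pres_mulA s t u : pres_eq R (s * (t * u))%pres ((s * t) * u)%pres
| pres_mul1l s : pres_eq R (1 * s)%pres s
| pres_mul1r s : pres_eq R (s * 1)%pres s
| pres_mulDl s t u : pres_eq R ((s + t) * u)%pres (s * u + t * u)%pres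
| pres_mulDr s t u : pres_eq R (s * (t + u))%pres (s * t + s * u)%pres
| pres_constD (a b : k) :
    pres_eq R (Const (a + b)%R) (Const a + Const b)%pres
| pres_constM (a b : k) :
    pres_eq R (Const (a * b)%R) (Const a * Const b)%pres
| pres_constC (a : k) s : pres_eq R (Const a * s)%pres (s * Const a)%pres.

Variable R : pterm k X -> pterm k X -> Prop.

Definition pres_eqb s t : bool := `[< pres_eq R s t >].

Lemma pres_eqb_equiv : equiv_class_of pres_eqb.
Proof.
split=> [s|s t|t s u].
- exact/asboolP/pres_refl.
- by apply/asboolP/asboolP; apply: pres_sym.
- by move=> /asboolP st /asboolP tu; apply/asboolP/(pres_trans st).
Qed.

Canonical pres_equiv := EquivRelPack pres_eqb_equiv.

Definition palg : Type := {eq_quot pres_equiv}.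

HB.instance Definition _ := Choice.on palg.
HB.instance Definition _ : EqQuotient _ pres_equiv palg := EqQuotient.on palg.

Definition pclass t : palg := \pi_palg t.

Lemma pclassP s t : pclass s = pclass t <-> pres_eq R s t.
Proof.
split=> [/eqmodP /asboolP //|st].
by apply/eqmodP/asboolP.
Qed.

Lemma repr_pclass t : pres_eq R (repr (pclass t)) t.
Proof. by apply/pclassP; rewrite /pclass reprK. Qed.

Lemma pclass_ind (P : palg -> Prop) :
  (forall t, P (pclass t)) -> forall x, P x.
Proof. by move=> h x; rewrite -[x]reprK; apply: h. Qed.

Definition padd (x y : palg) := pclass (repr x + repr y)%pres.
Definition pmul (x y : palg) := pclass (repr x * repr y)%pres.
Definition popp (x : palg) := pclass (Const (- 1)%R * repr x)%pres.
Definition pscale (c : k) (x : palg) := pclass (Const c * repr x)%pres.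

Lemma paddE s t : padd (pclass s) (pclass t) = pclass (s + t)%pres.
Proof. by apply/pclassP/pres_add; apply: repr_pclass. Qed.

Lemma pmulE s t : pmul (pclass s) (pclass t) = pclass (s * t)%pres.
Proof. by apply/pclassP/pres_mul; apply: repr_pclass. Qed.

Lemma poppE s : popp (pclass s) = pclass (Const (- 1)%R * s)%pres.
Proof. by apply/pclassP/pres_mul; [apply: pres_refl | apply: repr_pclass]. Qed.

Lemma pscaleE c s : pscale c (pclass s) = pclass (Const c * s)%pres.
Proof. by apply/pclassP/pres_mul; [apply: pres_refl | apply: repr_pclass]. Qed.

Fact paddA : associative padd.
Proof.
elim/pclass_ind=> s; elim/pclass_ind=> t; elim/pclass_ind=> u.
by rewrite !paddE; apply/pclassP/pres_addA.
Qed.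

Fact paddC : commutative padd.
Proof.
elim/pclass_ind=> s; elim/pclass_ind=> t.
by rewrite !paddE; apply/pclassP/pres_addC.
Qed.

Fact padd0 : left_id (pclass 0%pres) padd.
Proof. by elim/pclass_ind=> s; rewrite !paddE; apply/pclassP/pres_add0. Qed.

Fact paddN : left_inverse (pclass 0%pres) popp padd.
Proof.
by elim/pclass_ind=> s; rewrite poppE paddE; apply/pclassP/pres_addN.
Qed.

Fact pmulA : associative pmul.
Proof.
elim/pclass_ind=> s; elim/pclass_ind=> t; elim/pclass_ind=> u.
by rewrite !pmulE; apply/pclassP/pres_mulA.
Qed.

Fact pmul1l : left_id (pclass 1%pres) pmul.
Proof. by elim/pclass_ind=> s; rewrite pmulE; apply/pclassP/pres_mul1l. Qed.

Fact pmul1r : right_id (pclass 1%pres) pmul.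
Proof. by elim/pclass_ind=> s; rewrite pmulE; apply/pclassP/pres_mul1r. Qed.

Fact pmulDl : left_distributive pmul padd.
Proof.
elim/pclass_ind=> s; elim/pclass_ind=> t; elim/pclass_ind=> u.
by rewrite !(paddE, pmulE); apply/pclassP/pres_mulDl.
Qed.

Fact pmulDr : right_distributive pmul padd.
Proof.
elim/pclass_ind=> s; elim/pclass_ind=> t; elim/pclass_ind=> u.
by rewrite !(paddE, pmulE); apply/pclassP/pres_mulDr.
Qed.

HB.instance Definition _ := GRing.isPzRing.Build palg
  paddA paddC padd0 paddN pmulA pmul1l pmul1r pmulDl pmulDr.

Lemma pclassD s t : pclass (s + t)%pres = pclass s + pclass t.
Proof. exact/esym/paddE. Qed.

Lemma pclassM s t : pclass (s * t)%pres = pclass s * pclass t.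
Proof. exact/esym/pmulE. Qed.

Fact pscaleA a b x : pscale a (pscale b x) = pscale (a * b) x.
Proof.
elim/pclass_ind: x => s; rewrite !pscaleE !pclassM mulrA -pclassM.
by congr (_ * _); apply/pclassP/pres_sym/pres_constM.
Qed.

Fact pscale1 : left_id 1 pscale.
Proof. by elim/pclass_ind=> s; rewrite pscaleE; apply/pclassP/pres_mul1l. Qed.

Fact pscaleDr : right_distributive pscale +%R.
Proof.
move=> c; elim/pclass_ind=> s; elim/pclass_ind=> t.
by rewrite -pclassD !pscaleE !pclassM pclassD mulrDr.
Qed.

Fact pscaleDl x : {morph pscale^~ x : a b / a + b}.
Proof.
move=> a b; elim/pclass_ind: x => s; rewrite !pscaleE !pclassM -mulrDl.
by congr (_ * _); rewrite -pclassD; apply/pclassP/pres_constD.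
Qed.

HB.instance Definition _ := GRing.Zmodule_isLmodule.Build k palg
  pscaleA pscale1 pscaleDr pscaleDl.

Lemma pscalerAl (c : k) (x y : palg) : c *: (x * y) = (c *: x) * y.
Proof.
elim/pclass_ind: x => s; elim/pclass_ind: y => t.
rewrite -pclassM ![_ *: _]pscaleE -pclassM.
by apply/pclassP/pres_mulA.
Qed.

Lemma pscalerAr (c : k) (x y : palg) : c *: (x * y) = x * (c *: y).
Proof.
elim/pclass_ind: x => s; elim/pclass_ind: y => t.
rewrite -pclassM ![_ *: _]pscaleE !pclassM !mulrA; congr (_ * _).
by rewrite -!pclassM; apply/pclassP/pres_constC.
Qed.

Lemma pclass_const (c : k) : pclass (Const c) = c *: (1 : palg).
Proof.
rewrite [RHS]pscaleE; apply/pclassP/pres_sym/pres_mul1r.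
Qed.

Definition pgen (x : X) : palg := pclass (Gen x).

(* a matrix over k, seen as a matrix over palg                                *)
Definition scmx (m n : nat) (g : 'M[k]_(m, n)) : 'M[palg]_(m, n) :=
  map_mx (fun c => c *: (1 : palg)) g.

Lemma scmxM m n p (g : 'M[k]_(m, n)) (h : 'M[k]_(n, p)) :
  scmx (g *m h) = scmx g *m scmx h.
Proof.
apply/matrixP=> i j; rewrite !mxE scaler_suml; apply: eq_bigr => l _.
by rewrite !mxE -pscalerAl mul1r scalerA.
Qed.

Lemma scmx1 n : scmx (1%:M : 'M[k]_n) = 1%:M.
Proof.
by apply/matrixP=> i j; rewrite !mxE; case: eqP; rewrite ?scale1r ?scale0r.
Qed.

Section Eval.
Variables (C : pzRingType) (cst : k -> C) (val : X -> C).

Fixpoint eval t : C :=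
  match t with
  | Gen x => val x
  | Const c => cst c
  | Add s t => eval s + eval t
  | Mul s t => eval s * eval t
  end.

(* The algebra morphism sending the generator x to val x.  It is given by a   *)
(* total function; it is that morphism as soon as val satisfies the relations *)
(* R, see plift_pclass.                                                       *)
Definition plift (x : palg) : C := eval (repr x).

Hypothesis cst_add : {morph cst : a b / a + b}.
Hypothesis cst_mul : {morph cst : a b / a * b}.
Hypothesis cst_one : cst 1 = 1.
Hypothesis cst_central : forall c y, cst c * y = y * cst c.
Hypothesis val_rel : forall s t, R s t -> eval s = eval t.

Lemma eval_pres s t : pres_eq R s t -> eval s = eval t.
Proof.
have cst0 : cst 0 = 0.
  by apply: (@addrI _ (cst 0)); rewrite -cst_add !addr0.
elim=> {s t} //=.
- by move=> s t u _ -> _ ->.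
- by move=> s s' t t' _ -> _ ->.
- by move=> s s' t t' _ -> _ ->.
- by move=> s t u; rewrite addrA.
- by move=> s t; rewrite addrC.
- by move=> s; rewrite cst0 add0r.
- move=> s; rewrite -{2}[eval s]mul1r -cst_one -mulrDl -cst_add.
  by rewrite [- 1 + 1]addNr cst0 mul0r.
- by move=> s t u; rewrite mulrA.
- by move=> s; rewrite cst_one mul1r.
- by move=> s; rewrite cst_one mulr1.
- by move=> s t u; rewrite mulrDl.
- by move=> s t u; rewrite mulrDr.
Qed.

Lemma plift_pclass t : plift (pclass t) = eval t.
Proof. exact/eval_pres/repr_pclass. Qed.

Lemma plift_monoid_morphism : monoid_morphism plift.
Proof.
split=> [|x y]; first by rewrite [1]/(pclass 1%pres) plift_pclass.
elim/pclass_ind: x => s; elim/pclass_ind: y => t.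
by rewrite -pclassM !plift_pclass.
Qed.

Lemma pliftD : {morph plift : x y / x + y}.
Proof.
elim/pclass_ind=> s; elim/pclass_ind=> t.
by rewrite -pclassD !plift_pclass.
Qed.

Lemma pliftZ c x : plift (c *: x) = cst c * plift x.
Proof. by elim/pclass_ind: x => s; rewrite [_ *: _]pscaleE !plift_pclass. Qed.

End Eval.

Lemma pclass_sum n (F : 'I_n -> pterm k X) :
  pclass (\sum_(i < n) F i)%pres = \sum_(i < n) pclass (F i).
Proof.
by apply: (big_morph pclass pclassD); rewrite pclass_const scale0r.
Qed.

Section Derivation.
Variable delta : X -> palg.

Fixpoint dterm t : palg :=
  match t with
  | Gen x => delta x
  | Const _ => 0
  | Add s t => dterm s + dterm t
  | Mul s t => dterm s * pclass t + pclass s * dterm t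
  end.

(* The k-linear derivation sending the generator x to delta x.  As for plift, *)
(* it is that derivation as soon as delta is compatible with the relations R, *)
(* see pder_pclass.                                                           *)
Definition pder (x : palg) : palg := dterm (repr x).

Lemma dterm_sum n (F : 'I_n -> pterm k X) :
  dterm (\sum_(i < n) F i)%pres = \sum_(i < n) dterm (F i).
Proof. exact: (big_morph dterm). Qed.

Hypothesis delta_rel : forall s t, R s t -> dterm s = dterm t.

Lemma dterm_pres s t : pres_eq R s t -> dterm s = dterm t.
Proof.
elim=> {s t} //=.
- by move=> s t u _ -> _ ->.
- by move=> s s' t t' _ -> _ ->.
- by move=> s s' t t' /pclassP-> -> /pclassP-> ->.
- by move=> s t u; rewrite addrA.
- by move=> s t; rewrite addrC.
- by move=> s; rewrite add0r.
- move=> s; rewrite mul0r add0r -[X in _ + X]mul1r.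
  rewrite -mulrDl; have -> : 1 = pclass 1%pres by [].
  have -> : pclass (Const (- 1)) + pclass 1%pres = 0.
    rewrite -pclassD; apply/pclassP; apply: pres_trans (pres_addN R 1%pres).
    exact/pres_add/pres_refl/pres_sym/pres_mul1r.
  by rewrite mul0r.
- by move=> s t u; rewrite !pclassM mulrDl mulrDr !mulrA addrA.
- by move=> s; rewrite mul0r add0r; apply: mul1r.
- by move=> s; rewrite mulr0 addr0; apply: mulr1.
- by move=> s t u; rewrite pclassD !mulrDl addrACA.
- by move=> s t u; rewrite pclassD !mulrDr addrACA.
- by move=> a b; rewrite addr0.
- by move=> a b; rewrite mul0r mulr0 addr0.
- move=> a s; rewrite mul0r mulr0 add0r addr0.
  by rewrite pclass_const -pscalerAl -pscalerAr mul1r mulr1.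
Qed.

Lemma pder_pclass t : pder (pclass t) = dterm t.
Proof. exact/dterm_pres/repr_pclass. Qed.

Lemma pder_linear : linear pder.
Proof.
move=> c; elim/pclass_ind=> s; elim/pclass_ind=> t.
rewrite ![_ *: pclass _]pscaleE -pclassD !pder_pclass /= mul0r add0r.
by rewrite pclass_const -pscalerAl mul1r.
Qed.

Lemma pderM x y : pder (x * y) = pder x * y + x * pder y.
Proof.
elim/pclass_ind: x => s; elim/pclass_ind: y => t.
by rewrite -pclassM !pder_pclass.
Qed.

End Derivation.

End Presentation.

Section EvalAlg.
Variables (k : fieldType) (X Y : Type).
Variables (R : pterm k X -> pterm k X -> Prop).
Variables (R' : pterm k Y -> pterm k Y -> Prop) (val : Y -> palg R).
Local Notation cst := (fun c : k => c *: (1 : palg R)).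

Lemma eval_sum n (F : 'I_n -> pterm k Y) :
  eval cst val (\sum_(i < n) F i)%pres = \sum_(i < n) eval cst val (F i).
Proof. by apply: (big_morph (eval cst val)) => //=; rewrite scale0r. Qed.

Hypothesis val_rel :
  forall s t, R' s t -> eval cst val s = eval cst val t.

Lemma eval_alg_pres s t : pres_eq R' s t -> eval cst val s = eval cst val t.
Proof.
move=> st; apply: eval_pres st => // [a b|a b||c y].
- by rewrite scalerDl.
- by rewrite -pscalerAl mul1r scalerA.
- by rewrite scale1r.
- by rewrite -pscalerAl -pscalerAr mul1r mulr1.
Qed.

End EvalAlg.

Definition bilinear_map (k : fieldType) (V W U : lmodType k)
    (f : V -> W -> U) : Prop :=
  (forall v, linear (f v)) /\ (forall w, linear (fun v => f v w)).

Section Tensor.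
Variables (k : fieldType) (V W : lmodType k).
Implicit Types s t : seq (V * W).

(* s stands for the sum of the v (x) w for (v, w) in s; two such sums are     *)
(* equal in the tensor product iff no bilinear map distinguishes them.        *)
Definition tens_eq s t : Prop :=
  forall (U : lmodType k) (f : V -> W -> U), bilinear_map f ->
    \sum_(p <- s) f p.1 p.2 = \sum_(p <- t) f p.1 p.2.

Definition tens_eqb s t : bool := `[< tens_eq s t >].

Lemma tens_eqb_equiv : equiv_class_of tens_eqb.
Proof.
split=> [s|s t|t s u].
- by apply/asboolP.
- by apply/asboolP/asboolP=> st U f bf; rewrite st.
- by move=> /asboolP st /asboolP tu; apply/asboolP=> U f bf; rewrite st ?tu.
Qed.

Canonical tens_equiv := EquivRelPack tens_eqb_equiv.

Definition tensor : Type := {eq_quot tens_equiv}.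

HB.instance Definition _ := Choice.on tensor.
HB.instance Definition _ : EqQuotient _ tens_equiv tensor :=
  EqQuotient.on tensor.

Definition tclass s : tensor := \pi_tensor s.

Lemma tclassP s t : tclass s = tclass t <-> tens_eq s t.
Proof.
split=> [/eqmodP /asboolP //|st].
by apply/eqmodP/asboolP.
Qed.

(* Sweedler notation: sweedler x is a list of pairs (x', x'') such that x is  *)
(* the sum of the x' (x) x'' (lemma sweedlerK).  For f bilinear, the sum of   *)
(* f x' x'' over this list does not depend on its choice, and is the value at *)
(* x of the linear map on the tensor product induced by f (sum_tclass).       *)
Definition sweedler (x : tensor) : seq (V * W) := repr x.

Lemma tclass_sweedler s : tens_eq (sweedler (tclass s)) s.
Proof. by apply/tclassP; rewrite /tclass reprK. Qed.

Lemma sum_tclass (U : lmodType k) (f : V -> W -> U) s : bilinear_map f ->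
  \sum_(p <- sweedler (tclass s)) f p.1 p.2 = \sum_(p <- s) f p.1 p.2.
Proof. exact: tclass_sweedler. Qed.

Lemma tclass_ind (P : tensor -> Prop) :
  (forall s, P (tclass s)) -> forall x, P x.
Proof. by move=> h x; rewrite -[x]reprK; apply: h. Qed.

Definition tadd (x y : tensor) := tclass (sweedler x ++ sweedler y).
Definition tscale (c : k) (x : tensor) :=
  tclass [seq (c *: p.1, p.2) | p <- sweedler x].

Lemma bilinear_sumZ (U : lmodType k) (f : V -> W -> U) c s : bilinear_map f ->
  \sum_(p <- [seq (c *: p.1, p.2) | p <- s]) f p.1 p.2 =
    c *: \sum_(p <- s) f p.1 p.2.
Proof.
move=> [_ fl]; rewrite big_map scaler_sumr; apply: eq_bigr => p _ /=.
have h x : f (c *: x) p.2 = c *: f x p.2.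
  have := fl p.2 c x 0; have := fl p.2 1 0 0; rewrite !scale1r !addr0.
  by move=> /eqP; rewrite -subr_eq0 opprD addNKr oppr_eq0 => /eqP->; rewrite addr0.
exact: h.
Qed.

Lemma taddE s t : tadd (tclass s) (tclass t) = tclass (s ++ t).
Proof. by apply/tclassP=> U f bf; rewrite !big_cat /= !sum_tclass. Qed.

Lemma tscaleE c s :
  tscale c (tclass s) = tclass [seq (c *: p.1, p.2) | p <- s].
Proof. by apply/tclassP=> U f bf; rewrite !bilinear_sumZ ?sum_tclass. Qed.

Fact taddA : associative tadd.
Proof.
by elim/tclass_ind=> s; elim/tclass_ind=> t; elim/tclass_ind=> u;
   rewrite !taddE catA.
Qed.

Fact taddC : commutative tadd.
Proof.
elim/tclass_ind=> s; elim/tclass_ind=> t; rewrite !taddE.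
by apply/tclassP=> U f _; rewrite [LHS]big_cat [RHS]big_cat; exact: addrC.
Qed.

Fact tadd0 : left_id (tclass [::]) tadd.
Proof. by elim/tclass_ind=> s; rewrite taddE. Qed.

Fact taddN : left_inverse (tclass [::]) (tscale (- 1)) tadd.
Proof.
elim/tclass_ind=> s; rewrite tscaleE taddE.
by apply/tclassP=> U f bf; rewrite big_cat /= bilinear_sumZ // scaleN1r addNr
  big_nil.
Qed.

HB.instance Definition _ := GRing.isZmodule.Build tensor taddA taddC tadd0 taddN.

Fact tscaleA a b x : tscale a (tscale b x) = tscale (a * b) x.
Proof.
elim/tclass_ind: x => s; rewrite !tscaleE.
by apply/tclassP=> U f bf; rewrite !bilinear_sumZ // scalerA.
Qed.

Fact tscale1 : left_id 1 tscale.
Proof.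
elim/tclass_ind=> s; rewrite tscaleE.
by apply/tclassP=> U f bf; rewrite !bilinear_sumZ // scale1r.
Qed.

Fact tscaleDr : right_distributive tscale +%R.
Proof.
move=> c; elim/tclass_ind=> s; elim/tclass_ind=> t.
rewrite [tclass s + _]taddE !tscaleE [RHS]taddE.
by apply/tclassP=> U f bf; rewrite big_cat /= !bilinear_sumZ // big_cat scalerDr.
Qed.

Fact tscaleDl x : {morph tscale^~ x : a b / a + b}.
Proof.
move=> a b; elim/tclass_ind: x => s; rewrite !tscaleE [RHS]taddE.
by apply/tclassP=> U f bf; rewrite big_cat /= !bilinear_sumZ // scalerDl.
Qed.

HB.instance Definition _ := GRing.Zmodule_isLmodule.Build k tensor
  tscaleA tscale1 tscaleDr tscaleDl.

Definition tens (v : V) (w : W) : tensor := tclass [:: (v, w)].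

Lemma sum_tens (U : lmodType k) (f : V -> W -> U) v w : bilinear_map f ->
  \sum_(p <- sweedler (tens v w)) f p.1 p.2 = f v w.
Proof. by move=> bf; rewrite sum_tclass // big_seq1. Qed.

Lemma tclassE s : tclass s = \sum_(p <- s) tens p.1 p.2.
Proof.
elim: s => [|[v w] s IHs]; first by rewrite big_nil.
by rewrite big_cons -IHs /= [RHS]taddE.
Qed.

Lemma sweedlerK x : x = \sum_(p <- sweedler x) tens p.1 p.2.
Proof. by rewrite -tclassE /tclass reprK. Qed.

End Tensor.

Notation "v ⊗ w" := (tens v w) (at level 38, right associativity) : ring_scope.

Section DoubleBracket.
Variables (k : fieldType) (A : algType k) (e : 'I_3 -> A).

Definition double_bracket_type := A -> A -> tensor A A.

Implicit Types (br : double_bracket_type) (a b c : A).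

Definition in_base a : Prop := exists c : 'I_3 -> k, a = \sum_s c s *: e s.

(* the outer bimodule structure x (a' (x) a'') y = x a' (x) a'' y             *)
Definition outer (x : A) (t : tensor A A) (y : A) : tensor A A :=
  \sum_(p <- sweedler t) (x * p.1) ⊗ (p.2 * y).

Definition flip (t : tensor A A) : tensor A A :=
  \sum_(p <- sweedler t) p.2 ⊗ p.1.

Record is_double_bracket br : Prop := IsDoubleBracket {
  dbr_bilinear : bilinear_map br;
  dbr_base : forall a b, in_base a \/ in_base b -> br a b = 0;
  dbr_antisym : forall a b, br a b = - flip (br b a);
  dbr_leibniz : forall a b c,
    br a (b * c) = outer 1 (br a b) c + outer b (br a c) 1 }.

(* {{a, b, c}} = {{a, {{b, c}}}}_L + tau_(123) {{b, {{c, a}}}}_L              *)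
(*                                 + tau_(132) {{c, {{a, b}}}}_L              *)
(* where {{a, b' (x) b''}}_L = {{a, b'}} (x) b'', and where tau_(123) and     *)
(* tau_(132) send x (x) y (x) z to z (x) x (x) y and y (x) z (x) x.           *)
Definition triple_bracket br a b c : tensor A (tensor A A) :=
  \sum_(p <- sweedler (br b c)) \sum_(q <- sweedler (br a p.1))
     q.1 ⊗ (q.2 ⊗ p.2)
  + \sum_(p <- sweedler (br c a)) \sum_(q <- sweedler (br b p.1))
     p.2 ⊗ (q.1 ⊗ q.2)
  + \sum_(p <- sweedler (br a b)) \sum_(q <- sweedler (br c p.1))
     q.2 ⊗ (p.2 ⊗ q.1).

(* Van den Bergh's condition: the triple bracket equals 1/12 of the sum over  *)
(* s of the triple brackets defined by E_s^3, where E_s is the gauge element  *)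
(* E_s(a) = a e_s (x) e_s - e_s (x) e_s a; written out on a, b, c.            *)
Definition is_quasi_poisson_double br : Prop :=
  forall a b c,
  triple_bracket br a b c =
  (4%:R : k)^-1 *: \sum_s
   ( (c * e s * a) ⊗ ((e s * b) ⊗ e s)
   - (c * e s * a) ⊗ (e s ⊗ (b * e s))
   - (c * e s) ⊗ ((a * e s * b) ⊗ e s)
   + (c * e s) ⊗ ((a * e s) ⊗ (b * e s))
   - (e s * a) ⊗ ((e s * b) ⊗ (e s * c))
   + (e s * a) ⊗ (e s ⊗ (b * e s * c))
   + e s ⊗ ((a * e s * b) ⊗ (e s * c))
   - e s ⊗ ((a * e s) ⊗ (b * e s * c)) ).

Record is_double_moment_map br (Phi : A) : Prop := IsDoubleMomentMap {
  dmm_invertible : exists Psi, Phi * Psi = 1 /\ Psi * Phi = 1;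
  dmm_diagonal : Phi = \sum_s e s * Phi * e s;
  dmm_bracket : forall s a, let Phis := e s * Phi * e s in
    br Phis a = (2%:R : k)^-1 *:
      ((a * e s) ⊗ Phis - e s ⊗ (Phis * a)
       + (a * Phis) ⊗ e s - Phis ⊗ (e s * a)) }.

Record is_hamiltonian_double br (Phi : A) : Prop := IsHamiltonianDouble {
  hd_bracket : is_double_bracket br;
  hd_quasi_poisson : is_quasi_poisson_double br;
  hd_moment_map : is_double_moment_map br Phi }.

End DoubleBracket.

Section Dimension.
Variable d : 'I_3 -> nat.

Definition tdim : nat := \sum_s d s.

Definition blk (i : 'I_tdim) : 'I_3 := tagnat.sig1 i.

(* GL_d and gl_d are realised as block diagonal matrices of size tdim         *)
Definition block_diag (K : pzRingType) (g : 'M[K]_tdim) : Prop :=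
  forall i j, blk i != blk j -> g i j = 0.

Definition in_GL (k : fieldType) (g : 'M[k]_tdim) : Prop :=
  g \in unitmx /\ block_diag g.

(* The elementary matrices E_p = E_{p.1, p.2} with p.1 and p.2 in the same    *)
(* block form a basis of gl_d; the dual basis for the trace pairing is E*_p.  *)
Definition gl_index (p : 'I_tdim * 'I_tdim) : bool := blk p.1 == blk p.2.

Definition gl_basis (k : fieldType) (p : 'I_tdim * 'I_tdim) : 'M[k]_tdim :=
  delta_mx p.1 p.2.

Definition gl_dual (k : fieldType) (p : 'I_tdim * 'I_tdim) : 'M[k]_tdim :=
  delta_mx p.2 p.1.

Definition blk_idem (k : fieldType) (s : 'I_3) : 'M[k]_tdim :=
  \matrix_(i, j) ((i == j) && (blk i == s))%:R.

Lemma blk_idemC (k : fieldType) s (g : 'M[k]_tdim) :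
  block_diag g -> blk_idem k s *m g = g *m blk_idem k s.
Proof.
move=> gd; apply/matrixP=> i j; rewrite !mxE (bigD1 i) //= [RHS](bigD1 j) //=.
rewrite !big1 => [|l /negPf li|l /negPf li].
- rewrite !mxE !eqxx !addr0 /=.
  by have [->|/gd->] := eqVneq (blk i) (blk j); rewrite ?mulr0 ?mul0r // mulrC.
- by rewrite !mxE li mulr0.
- by rewrite !mxE eq_sym li mul0r.
Qed.

Lemma block_diag_mul (K : pzRingType) (g h : 'M[K]_tdim) :
  block_diag g -> block_diag h -> block_diag (g *m h).
Proof.
move=> gd hd i j ij; rewrite mxE big1 // => l _.
have [il|/gd->] := eqVneq (blk i) (blk l); last by rewrite mul0r.
by rewrite hd ?mulr0 // -il.
Qed.

Lemma block_diag_inv (k : fieldType) (g : 'M[k]_tdim) :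
  in_GL g -> block_diag (invmx g).
Proof.
move=> [gu gd] i j ij.
have /matrixP/(_ i j) :
    blk_idem k (blk i) *m invmx g = invmx g *m blk_idem k (blk i).
  rewrite -[LHS]mul1mx -(mulVmx gu) -!mulmxA; congr (_ *m _).
  by rewrite !mulmxA -blk_idemC // -mulmxA mulmxV // mulmx1.
rewrite !mxE (bigD1 i) //= big1 => [|l /negPf li]; last first.
  by rewrite !mxE eq_sym li mul0r.
rewrite !mxE !eqxx mul1r addr0 => ->; rewrite big1 // => l _.
rewrite !mxE; case: eqP => [->|]; last by rewrite mulr0.
by rewrite eq_sym (negPf ij) mulr0.
Qed.

Lemma gl_basis_block_diag (k : fieldType) p :
  gl_index p -> block_diag (gl_basis k p).
Proof.
move=> /eqP pp i j ij; rewrite mxE.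
by case: eqP => //= ip; case: eqP => //= jp; rewrite ip jp pp eqxx in ij.
Qed.

Lemma gl_dual_block_diag (k : fieldType) p :
  gl_index p -> block_diag (gl_dual k p).
Proof.
move=> /eqP pp i j ij; rewrite mxE.
by case: eqP => //= ip; case: eqP => //= jp; rewrite ip jp pp eqxx in ij.
Qed.

Definition lie (R : pzRingType) (x y : 'M[R]_tdim) : 'M[R]_tdim :=
  x *m y - y *m x.

End Dimension.

Section RepresentationScheme.
Variables (k : fieldType) (A : algType k) (e : 'I_3 -> A) (d : 'I_3 -> nat).
Local Notation N := (tdim d).

Definition rep_gen (a : A) (i j : 'I_N) : pterm k (A * 'I_N * 'I_N) :=
  Gen (a, i, j).
Local Notation x := rep_gen.

Inductive rep_rel :
  pterm k (A * 'I_N * 'I_N) -> pterm k (A * 'I_N * 'I_N) -> Prop :=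
| rep_add a b i j : rep_rel (x (a + b) i j) (x a i j + x b i j)
| rep_scale c a i j : rep_rel (x (c *: a) i j) (Const c * x a i j)
| rep_mul a b i j :
    rep_rel (x (a * b) i j) (\sum_(l < N) (x a i l * x b l j))
| rep_idem s i j :
    rep_rel (x (e s) i j) (if (i == j) && (blk i == s) then 1 else 0)%pres
| rep_comm t u : rep_rel (t * u) (u * t).

Definition repalg : Type := palg rep_rel.

HB.instance Definition _ := GRing.PzRing.on repalg.
HB.instance Definition _ := GRing.Lmodule.on repalg.

Fact repalg_mulC : commutative (@GRing.mul repalg).
Proof.
elim/pclass_ind=> s; elim/pclass_ind=> t.
by rewrite -[LHS]pclassM -[RHS]pclassM; apply/pclassP/pres_rel/rep_comm.
Qed.

HB.instance Definition _ :=
  GRing.PzRing_hasCommutativeMul.Build repalg repalg_mulC.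

Definition coordmx (a : A) : 'M[repalg]_N :=
  \matrix_(i, j) (pgen rep_rel (a, i, j) : repalg).

Lemma coordmxD a b : coordmx (a + b) = coordmx a + coordmx b.
Proof.
apply/matrixP=> i j; rewrite !mxE -[RHS]pclassD.
exact/pclassP/pres_rel/rep_add.
Qed.

Local Notation sc := (scmx rep_rel).

Lemma coordmxZ c a : coordmx (c *: a) = sc c%:M *m coordmx a.
Proof.
apply/matrixP=> i j; rewrite !mxE (bigD1 i) //= big1 => [|l /negPf li].
  rewrite !mxE eqxx addr0 -pclass_const -[RHS]pclassM.
  exact/pclassP/pres_rel/rep_scale.
by rewrite !mxE eq_sym li scale0r mul0r.
Qed.

Lemma coordmxM a b : coordmx (a * b) = coordmx a *m coordmx b.
Proof.
apply/matrixP=> i j; rewrite !mxE.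
under eq_bigr => l _ do rewrite !mxE -[_ * _]pclassM.
rewrite -[RHS]pclass_sum; exact/pclassP/pres_rel/rep_mul.
Qed.

Lemma coordmx_idem s : coordmx (e s) = sc (blk_idem d k s).
Proof.
apply/matrixP=> i j; rewrite !mxE.
transitivity (pclass rep_rel (if (i == j) && (blk i == s) then 1 else 0)%pres).
  exact/pclassP/pres_rel/rep_idem.
by case: (_ && _); rewrite pclass_const.
Qed.

(* The action of g on functions, a_ij |-> sum_(l, m) g_il a_lm (g^-1)_mj.     *)
Definition act_val (g : 'M[k]_N) (y : A * 'I_N * 'I_N) : repalg :=
  let: (a, i, j) := y in (sc g *m coordmx a *m sc (invmx g)) i j.

Definition act (g : 'M[k]_N) : repalg -> repalg :=
  plift (fun c : k => c *: (1 : repalg)) (act_val g).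

(* The infinitesimal action of xi in gl_d, i.e. the vector field generated by *)
(* the flow exp (- t xi) (the convention of Alekseev, Kosmann-Schwarzbach and *)
(* Meinrenken, for which xi |-> infact xi is a Lie algebra morphism): as g    *)
(* acts on points by conjugation, it sends the matrix (a_ij) to               *)
(* - [xi, (a_ij)].                                                            *)
Definition infact_val (xi : 'M[k]_N) (y : A * 'I_N * 'I_N) : repalg :=
  let: (a, i, j) := y in - lie (sc xi : 'M[repalg]_N) (coordmx a) i j.

Definition infact (xi : 'M[k]_N) : repalg -> repalg := pder (infact_val xi).

Section WellDefined.
Variables (g xi : 'M[k]_N).
Hypotheses (g_GL : in_GL g) (xi_gl : block_diag xi).
Local Notation cst := (fun c : k => c *: (1 : repalg)).

Lemma act_val_rel s t :
  rep_rel s t -> eval cst (act_val g) s = eval cst (act_val g) t.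
Proof.
have [gu gd] := g_GL; case=> /=.
- by move=> a b i j; rewrite coordmxD mulmxDr mulmxDl mxE.
- move=> c a i j; rewrite coordmxZ mulmxA -scmxM scalar_mxC scmxM -!mulmxA.
  rewrite mxE (bigD1 i) //= big1 => [|l /negPf li]; last first.
    by rewrite !mxE eq_sym li scale0r mul0r.
  by rewrite addr0 [X in X * _]mxE mxE eqxx.
- move=> a b i j; rewrite eval_sum /= coordmxM.
  have -> : sc g *m (coordmx a *m coordmx b) *m sc (invmx g) =
    (sc g *m coordmx a *m sc (invmx g)) *m (sc g *m coordmx b *m sc (invmx g)).
    rewrite -!mulmxA; congr (_ *m (_ *m _)); rewrite !mulmxA.
    by rewrite -[sc (invmx g) *m sc g]scmxM mulVmx // scmx1 mul1mx.
  by rewrite mxE.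
- move=> s' i j; rewrite coordmx_idem -!scmxM -blk_idemC // -mulmxA mulmxV //.
  by rewrite mulmx1 !mxE; case: (_ && _).
- by move=> u v; rewrite mulrC.
Qed.

Lemma act_pclass t : act g (pclass rep_rel t) = eval cst (act_val g) t.
Proof. exact/(eval_alg_pres act_val_rel)/repr_pclass. Qed.

Lemma act_coordmx a :
  map_mx (act g) (coordmx a) = sc g *m coordmx a *m sc (invmx g).
Proof. by apply/matrixP=> i j; rewrite [LHS]mxE [in LHS]mxE act_pclass. Qed.

Lemma act_linear : linear (act g).
Proof.
move=> c; elim/pclass_ind=> s; elim/pclass_ind=> t.
rewrite ![_ *: pclass _ _]pscaleE -[LHS]/(act g (_ + _)) -pclassD !act_pclass /=.
by rewrite -pscalerAl mul1r.
Qed.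

Lemma act_monoid_morphism : monoid_morphism (act g).
Proof.
split=> [|x y].
  by rewrite -[1]/(pclass rep_rel 1%pres) act_pclass /= scale1r.
by elim/pclass_ind: x => s; elim/pclass_ind: y => t; rewrite -pclassM !act_pclass.
Qed.

Lemma infact_val_rel s t :
  rep_rel s t -> dterm (infact_val xi) s = dterm (infact_val xi) t.
Proof.
case=> /=.
- move=> a b i j; rewrite coordmxD /lie mulmxDr mulmxDl opprD addrACA.
  by rewrite mxE opprD.
- move=> c a i j.
  have lieZ : lie (sc xi) (coordmx (c *: a)) =
              sc c%:M *m lie (sc xi) (coordmx a) :> 'M[repalg]_N.
    rewrite /lie coordmxZ !mulmxBr !mulmxA -!scmxM.
    by rewrite -scalar_mxC.
  rewrite lieZ mul0r add0r mulrN; congr (- _).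
  rewrite mxE (bigD1 i) //= big1 => [|l /negPf li]; last first.
    by rewrite !mxE eq_sym li scale0r mul0r.
  by rewrite addr0 [X in X * _]mxE mxE eqxx pclass_const.
- move=> a b i j; rewrite dterm_sum /=.
  have lieM : lie (sc xi) (coordmx (a * b)) =
     lie (sc xi) (coordmx a) *m coordmx b + coordmx a *m lie (sc xi) (coordmx b)
     :> 'M[repalg]_N.
    by rewrite /lie coordmxM mulmxBl mulmxBr !mulmxA addrA subrK.
  rewrite big_split /= lieM mxE opprD.
  by congr (_ + _); rewrite mxE -sumrN; apply: eq_bigr => l _;
    rewrite ?mulNr ?mulrN [coordmx _ _ _]mxE.
- move=> s' i j; rewrite coordmx_idem /lie -!scmxM blk_idemC // subrr mxE oppr0.
  by case: (_ && _).
- by move=> u v; rewrite addrC; congr (_ + _); apply: repalg_mulC.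
Qed.

Lemma infact_pclass t :
  infact xi (pclass rep_rel t) = dterm (infact_val xi) t.
Proof. exact: pder_pclass infact_val_rel _. Qed.

Lemma infact_coordmx a :
  map_mx (infact xi) (coordmx a) = - lie (sc xi : 'M[repalg]_N) (coordmx a).
Proof.
by apply/matrixP=> i j; rewrite mxE [coordmx a i j]mxE infact_pclass [RHS]mxE.
Qed.

Lemma infact_linear : linear (infact xi).
Proof. exact: pder_linear infact_val_rel. Qed.

Lemma infactM x y : infact xi (x * y) = infact xi x * y + x * infact xi y.
Proof. exact: pderM infact_val_rel _ _. Qed.


End WellDefined.

Definition rep_bracket_type := repalg -> repalg -> repalg.

Implicit Types (P : rep_bracket_type) (f h l : repalg).

(* [P, P](df, dh, dl) for the bivector P(df, dh) = P f h; with the Schouten   *)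
(* bracket extending the Lie bracket of vector fields, it is twice the        *)
(* Jacobiator of P.                                                           *)
Definition schouten_square P f h l : repalg :=
  2%:R *: (P f (P h l) + P h (P l f) + P l (P f h)).

(* (u /\ v /\ w)(df, dh, dl) for vector fields u, v, w                        *)
Definition wedge3 (u v w : repalg -> repalg) f h l : repalg :=
  u f * (v h * w l - v l * w h)
  - u h * (v f * w l - v l * w f)
  + u l * (v f * w h - v h * w f).

(* The trivector generated by the Cartan trivector                            *)
(*   1/12 sum_(a, b, c) tr ([E*_a, E*_b] E*_c) E_a /\ E_b /\ E_c of gl_d.     *)
Definition cartan_trivector f h l : repalg :=
  12%:R^-1 *: \sum_(a | gl_index a) \sum_(b | gl_index b)
    \sum_(c | gl_index c)
      \tr (lie (gl_dual k a) (gl_dual k b) *m gl_dual k c) *: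
        wedge3 (infact (gl_basis k a)) (infact (gl_basis k b))
               (infact (gl_basis k c)) f h l.

Record is_quasi_poisson P : Prop := IsQuasiPoisson {
  qp_bilinear : bilinear_map P;
  qp_antisym : forall f h, P f h = - P h f;
  qp_leibniz : forall f h l, P f (h * l) = P f h * l + h * P f l;
  qp_invariant : forall g f h, in_GL g -> P (act g f) (act g h) = act g (P f h);
  qp_schouten : forall f h l, schouten_square P f h l = cartan_trivector f h l }.

End RepresentationScheme.

Inductive gl_gen (n : nat) : Type :=
| GlX of 'I_n & 'I_n  (* entries of a matrix *)
| GlY of 'I_n & 'I_n. (* entries of its inverse *)

Section CoordinateRingGL.
Variables (k : fieldType) (d : 'I_3 -> nat).
Local Notation N := (tdim d).

Definition gl_x (i j : 'I_N) : pterm k (gl_gen N) := Gen (GlX i j).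
Definition gl_y (i j : 'I_N) : pterm k (gl_gen N) := Gen (GlY i j).

Inductive gl_rel : pterm k (gl_gen N) -> pterm k (gl_gen N) -> Prop :=
| gl_mulV i j :
    gl_rel (\sum_(l < N) (gl_x i l * gl_y l j)) (if i == j then 1 else 0)%pres
| gl_Vmul i j :
    gl_rel (\sum_(l < N) (gl_y i l * gl_x l j)) (if i == j then 1 else 0)%pres
| gl_blockx i j : blk i != blk j -> gl_rel (gl_x i j) 0
| gl_blocky i j : blk i != blk j -> gl_rel (gl_y i j) 0
| gl_comm s t : gl_rel (s * t) (t * s).

Definition glalg : Type := palg gl_rel.

HB.instance Definition _ := GRing.PzRing.on glalg.
HB.instance Definition _ := GRing.Lmodule.on glalg.

Fact glalg_mulC : commutative (@GRing.mul glalg).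
Proof.
elim/pclass_ind=> s; elim/pclass_ind=> t.
by rewrite -[LHS]pclassM -[RHS]pclassM; apply/pclassP/pres_rel/gl_comm.
Qed.

HB.instance Definition _ :=
  GRing.PzRing_hasCommutativeMul.Build glalg glalg_mulC.

Definition glX : 'M[glalg]_N := \matrix_(i, j) (pgen gl_rel (GlX i j) : glalg).
Definition glY : 'M[glalg]_N := \matrix_(i, j) (pgen gl_rel (GlY i j) : glalg).

Let sc (g : 'M[k]_N) : 'M[glalg]_N := scmx gl_rel g.

(* The function y |-> f (g y g^-1)                                            *)
Definition gl_conj_val (g : 'M[k]_N) (y : gl_gen N) : glalg :=
  match y with
  | GlX i j => (sc g *m glX *m sc (invmx g)) i j
  | GlY i j => (sc g *m glY *m sc (invmx g)) i j
  end.

Definition gl_conj (g : 'M[k]_N) : glalg -> glalg :=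
  plift (fun c : k => c *: (1 : glalg)) (gl_conj_val g).

(* The left and right invariant vector fields defined by xi in gl_d, i.e. the *)
(* derivatives at t = 0 of y |-> f (y exp (t xi)) and y |-> f (exp (t xi) y). *)
Definition gl_left_val (xi : 'M[k]_N) (y : gl_gen N) : glalg :=
  match y with
  | GlX i j => (glX *m sc xi) i j
  | GlY i j => - (sc xi *m glY) i j
  end.

Definition gl_left (xi : 'M[k]_N) : glalg -> glalg := pder (gl_left_val xi).

Definition gl_right_val (xi : 'M[k]_N) (y : gl_gen N) : glalg :=
  match y with
  | GlX i j => (sc xi *m glX) i j
  | GlY i j => - (glY *m sc xi) i j
  end.

Definition gl_right (xi : 'M[k]_N) : glalg -> glalg := pder (gl_right_val xi).

Section WellDefined.
Variables (g xi : 'M[k]_N).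
Hypotheses (g_GL : in_GL g) (xi_gl : block_diag xi).
Local Notation cst := (fun c : k => c *: (1 : glalg)).

Lemma glXY : glX *m glY = 1%:M.
Proof.
apply/matrixP=> i j; rewrite !mxE.
under eq_bigr => l _ do rewrite !mxE -[_ * _]pclassM.
rewrite -[LHS]pclass_sum.
transitivity (pclass gl_rel (if i == j then 1 else 0)%pres).
  exact/pclassP/pres_rel/gl_mulV.
by case: (i == j); rewrite pclass_const ?scale1r ?scale0r.
Qed.

Lemma glYX : glY *m glX = 1%:M.
Proof.
apply/matrixP=> i j; rewrite !mxE.
under eq_bigr => l _ do rewrite !mxE -[_ * _]pclassM.
rewrite -[LHS]pclass_sum.
transitivity (pclass gl_rel (if i == j then 1 else 0)%pres).
  exact/pclassP/pres_rel/gl_Vmul.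
by case: (i == j); rewrite pclass_const ?scale1r ?scale0r.
Qed.

Lemma glX_block : block_diag glX.
Proof.
move=> i j ij; rewrite mxE; transitivity (pclass gl_rel 0%pres).
  exact/pclassP/pres_rel/gl_blockx.
by rewrite pclass_const scale0r.
Qed.

Lemma glY_block : block_diag glY.
Proof.
move=> i j ij; rewrite mxE; transitivity (pclass gl_rel 0%pres).
  exact/pclassP/pres_rel/gl_blocky.
by rewrite pclass_const scale0r.
Qed.

Lemma sc_block h : block_diag h -> block_diag (sc h).
Proof. by move=> hd i j ij; rewrite mxE hd // scale0r. Qed.

Lemma gl_conj_val_rel s t :
  gl_rel s t -> eval cst (gl_conj_val g) s = eval cst (gl_conj_val g) t.
Proof.
have [gu gd] := g_GL; have vd := block_diag_inv g_GL.
have conjM (a b : 'M[glalg]_N) : a *m b = 1%:M ->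
    (sc g *m a *m sc (invmx g)) *m (sc g *m b *m sc (invmx g)) = 1%:M.
  move=> ab; rewrite -!mulmxA [sc (invmx g) *m (sc g *m _)]mulmxA -scmxM.
  rewrite mulVmx // scmx1 mul1mx [a *m (b *m _)]mulmxA ab mul1mx -scmxM.
  by rewrite mulmxV // scmx1.
have conjd (a : 'M[glalg]_N) : block_diag a ->
    block_diag (sc g *m a *m sc (invmx g)).
  by move=> ad; apply: block_diag_mul (sc_block vd);
    apply: block_diag_mul ad; apply: sc_block.
case=> /=.
- move=> i j; rewrite eval_sum /=.
  transitivity ((1%:M : 'M[glalg]_N) i j); first by rewrite -(conjM _ _ glXY) mxE.
  by rewrite mxE; case: eqP; rewrite /= ?scale1r ?scale0r.
- move=> i j; rewrite eval_sum /=.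
  transitivity ((1%:M : 'M[glalg]_N) i j); first by rewrite -(conjM _ _ glYX) mxE.
  by rewrite mxE; case: eqP; rewrite /= ?scale1r ?scale0r.
- by move=> i j ij; rewrite scale0r; apply: conjd ij; apply: glX_block.
- by move=> i j ij; rewrite scale0r; apply: conjd ij; apply: glY_block.
- by move=> u v; rewrite mulrC.
Qed.

Lemma gl_conj_pclass t :
  gl_conj g (pclass gl_rel t) = eval cst (gl_conj_val g) t.
Proof. exact/(eval_alg_pres gl_conj_val_rel)/repr_pclass. Qed.

Lemma gl_conj_glX : map_mx (gl_conj g) glX = sc g *m glX *m sc (invmx g).
Proof. by apply/matrixP=> i j; rewrite [LHS]mxE [in LHS]mxE gl_conj_pclass. Qed.

Lemma gl_left_val_rel s t :
  gl_rel s t -> dterm (gl_left_val xi) s = dterm (gl_left_val xi) t.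
Proof.
have dsum (a b a' b' : 'M[glalg]_N) i j :
    \sum_l a i l * b l j + \sum_l a' i l * - b' l j = (a *m b - a' *m b') i j.
  rewrite [RHS]mxE [X in _ = X + _]mxE [X in _ = _ + X]mxE [X in _ + - X]mxE.
  by rewrite -sumrN; congr (_ + _); apply: eq_bigr => l _; rewrite mulrN.
have dsum' (a b a' b' : 'M[glalg]_N) i j :
    \sum_l - a i l * b l j + \sum_l a' i l * b' l j = (a' *m b' - a *m b) i j.
  by rewrite addrC -dsum; congr (_ + _); apply: eq_bigr => l _; rewrite mulNr mulrN.
have pX i j : pclass gl_rel (gl_x i j) = glX i j by rewrite mxE.
have pY i j : pclass gl_rel (gl_y i j) = glY i j by rewrite mxE.
case=> /=.
- move=> i j; rewrite dterm_sum /= big_split /=.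
  under eq_bigr => l _ do rewrite pY.
  under [X in _ + X]eq_bigr => l _ do rewrite pX.
  rewrite [LHS]dsum mulmxA subrr mxE; by case: eqP.
- move=> i j; rewrite dterm_sum /= big_split /=.
  under eq_bigr => l _ do rewrite pX.
  under [X in _ + X]eq_bigr => l _ do rewrite pY.
  rewrite [LHS]dsum' mulmxA glYX mul1mx -mulmxA glYX mulmx1 subrr mxE; by case: eqP.
- move=> i j ij.
  by apply: block_diag_mul ij; [exact: glX_block | exact: sc_block].
- move=> i j ij; apply/eqP; rewrite oppr_eq0; apply/eqP.
  by apply: block_diag_mul ij; [exact: sc_block | exact: glY_block].
- by move=> u v; rewrite addrC; congr (_ + _); apply: glalg_mulC.
Qed.

Lemma gl_left_pclass t :
  gl_left xi (pclass gl_rel t) = dterm (gl_left_val xi) t.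
Proof. exact: pder_pclass gl_left_val_rel _. Qed.

Lemma gl_right_val_rel s t :
  gl_rel s t -> dterm (gl_right_val xi) s = dterm (gl_right_val xi) t.
Proof.
have dsum (a b a' b' : 'M[glalg]_N) i j :
    \sum_l a i l * b l j + \sum_l a' i l * - b' l j = (a *m b - a' *m b') i j.
  rewrite [RHS]mxE [X in _ = X + _]mxE [X in _ = _ + X]mxE [X in _ + - X]mxE.
  by rewrite -sumrN; congr (_ + _); apply: eq_bigr => l _; rewrite mulrN.
have dsum' (a b a' b' : 'M[glalg]_N) i j :
    \sum_l - a i l * b l j + \sum_l a' i l * b' l j = (a' *m b' - a *m b) i j.
  by rewrite addrC -dsum; congr (_ + _); apply: eq_bigr => l _; rewrite mulNr mulrN.
have pX i j : pclass gl_rel (gl_x i j) = glX i j by rewrite mxE.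
have pY i j : pclass gl_rel (gl_y i j) = glY i j by rewrite mxE.
case=> /=.
- move=> i j; rewrite dterm_sum /= big_split /=.
  under eq_bigr => l _ do rewrite pY.
  under [X in _ + X]eq_bigr => l _ do rewrite pX.
  rewrite [LHS]dsum -mulmxA glXY mulmx1 mulmxA glXY mul1mx subrr mxE; by case: eqP.
- move=> i j; rewrite dterm_sum /= big_split /=.
  under eq_bigr => l _ do rewrite pX.
  under [X in _ + X]eq_bigr => l _ do rewrite pY.
  rewrite [LHS]dsum' mulmxA subrr mxE; by case: eqP.
- move=> i j ij.
  by apply: block_diag_mul ij; [exact: sc_block | exact: glX_block].
- move=> i j ij; apply/eqP; rewrite oppr_eq0; apply/eqP.
  by apply: block_diag_mul ij; [exact: glY_block | exact: sc_block].
- by move=> u v; rewrite addrC; congr (_ + _); apply: glalg_mulC.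
Qed.

Lemma gl_right_pclass t :
  gl_right xi (pclass gl_rel t) = dterm (gl_right_val xi) t.
Proof. exact: pder_pclass gl_right_val_rel _. Qed.

Lemma gl_left_glX : map_mx (gl_left xi) glX = glX *m sc xi.
Proof. by apply/matrixP=> i j; rewrite mxE [glX i j]mxE gl_left_pclass. Qed.

Lemma gl_right_glX : map_mx (gl_right xi) glX = sc xi *m glX.
Proof. by apply/matrixP=> i j; rewrite mxE [glX i j]mxE gl_right_pclass. Qed.

End WellDefined.

End CoordinateRingGL.

Section HamiltonianStructure.
Variables (k : fieldType) (A : algType k) (e : 'I_3 -> A) (d : 'I_3 -> nat).
Local Notation Rep := (repalg e d).
Local Notation GL := (glalg k d).

(* A morphism Rep(A, d) -> GL_d is given by the algebra morphism mu between   *)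
(* coordinate rings.  The last condition is that of Alekseev,                 *)
(* Kosmann-Schwarzbach and Meinrenken:                                        *)
(*   P^#(d mu(f)) = 1/2 sum_a mu((E_a^L + E_a^R) f) (E*_a)_Rep.               *)
Record is_moment_map (P : rep_bracket_type e d) (mu : GL -> Rep) : Prop :=
  IsMomentMap {
  mm_linear : linear mu;
  mm_multiplicative : monoid_morphism mu;
  mm_equivariant : forall g f, in_GL g -> mu (gl_conj g f) = act g (mu f);
  mm_bracket : forall f h,
    P (mu f) h = (2%:R : k)^-1 *: \sum_(a | gl_index a)
      (mu (gl_left (gl_basis k a) f + gl_right (gl_basis k a) f)
       * infact (gl_dual k a) h : Rep) }.

Record is_hamiltonian_quasi_poisson
    (P : rep_bracket_type e d) (mu : GL -> Rep) : Prop :=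
  IsHamiltonianQuasiPoisson {
  hqp_quasi_poisson : is_quasi_poisson P;
  hqp_moment_map : is_moment_map P mu }.

Definition bracket_induced (br : double_bracket_type A)
    (P : rep_bracket_type e d) : Prop :=
  forall a b i j u v,
    P (coordmx e d a i j) (coordmx e d b u v) =
      \sum_(p <- sweedler (br a b)) coordmx e d p.1 u j * coordmx e d p.2 i v.

Definition moment_map_induced (Phi : A) (mu : GL -> Rep) : Prop :=
  map_mx mu (glX k d) = coordmx e d Phi.

Definition induces_hamiltonian_quasi_poisson
    (br : double_bracket_type A) (Phi : A) : Prop :=
  exists (P : rep_bracket_type e d) (mu : GL -> Rep),
    [/\ bracket_induced br P, moment_map_induced Phi mu
      & is_hamiltonian_quasi_poisson P mu].

End HamiltonianStructure.

Inductive arrow := a12 | a21 | a13 | a31 | a23 | a32.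

Definition i1 : 'I_3 := @Ordinal 3 0 isT.
Definition i2 : 'I_3 := @Ordinal 3 1 isT.
Definition i3 : 'I_3 := @Ordinal 3 2 isT.

(* the arrow a_ij goes from j to i                                            *)
Definition head (a : arrow) : 'I_3 :=
  match a with a12 | a13 => i1 | a21 | a23 => i2 | a31 | a32 => i3 end.
Definition tail (a : arrow) : 'I_3 :=
  match a with a21 | a31 => i1 | a12 | a32 => i2 | a13 | a23 => i3 end.

Inductive boalch_gen :=
| BE of 'I_3 | BV of arrow | BW of arrow | BG of 'I_3 | BGinv of 'I_3.

Section BoalchAlgebra.
Variable k : fieldType.

Let e i : pterm k boalch_gen := Gen (BE i).
Let v a : pterm k boalch_gen := Gen (BV a).
Let w a : pterm k boalch_gen := Gen (BW a).
Let g i : pterm k boalch_gen := Gen (BG i).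
Let g' i : pterm k boalch_gen := Gen (BGinv i).

Inductive boalch_rel : pterm k boalch_gen -> pterm k boalch_gen -> Prop :=
| boalch_one : boalch_rel 1 (e i1 + e i2 + e i3)
| boalch_idem i j : boalch_rel (e i * e j) (if i == j then e i else 0)%pres
| boalch_v a : boalch_rel (v a) (e (head a) * v a * e (tail a))
| boalch_w a : boalch_rel (w a) (e (head a) * w a * e (tail a))
| boalch_g i : boalch_rel (g i) (e i * g i * e i)
| boalch_g' i : boalch_rel (g' i) (e i * g' i * e i)
| boalch_gg' i : boalch_rel (g i * g' i) (e i)
| boalch_g'g i : boalch_rel (g' i * g i) (e i)
| boalch_gauss : boalch_rel
    ((1 + v a21 + v a31 + v a32) * (1 + v a12 + v a13 + v a23))
    ((1 + w a12 + w a13 + w a23) * (g i1 + g i2 + g i3)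
       * (1 + w a21 + w a31 + w a32)).

Definition boalch : Type := palg boalch_rel.

HB.instance Definition _ := GRing.PzRing.on boalch.
HB.instance Definition _ := GRing.Lmodule.on boalch.

Fact boalch_neq0 : (1 : boalch) != 0.
Proof.
pose val y : k := match y with
  | BE i | BG i | BGinv i => (i == i1)%:R | BV _ | BW _ => 0 end.
apply/eqP=> /pclassP eq10; have : (1 : k) = 0; last exact/eqP/oner_neq0.
pose evk := eval (fun c : k => c) val.
rewrite -[LHS]/(evk 1%pres) -[RHS]/(evk 0%pres); apply: eval_pres eq10 => //.
  by move=> c y; apply: mulrC.
move=> s t; case=> /=.
- by rewrite !addr0.
- move=> i j; have [<-|nij] := eqVneq i j => /=.
    by case: (i == i1); rewrite /= ?mulr1 ?mul0r.
  by have [<-|_] := eqVneq i i1; rewrite ?mul0r // eq_sym (negbTE nij) mulr0.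
- by move=> a; rewrite mulr0 mul0r.
- by move=> a; rewrite mulr0 mul0r.
- by move=> i; case: (i == i1); rewrite /= ?mulr1 ?mul0r.
- by move=> i; case: (i == i1); rewrite /= ?mulr1 ?mul0r.
- by move=> i; case: (i == i1); rewrite /= ?mulr1 ?mul0r.
- by move=> i; case: (i == i1); rewrite /= ?mulr1 ?mul0r.
- by rewrite !addr0 !mulr1.
Qed.

HB.instance Definition _ :=
  GRing.PzSemiRing_isNonZero.Build boalch boalch_neq0.
HB.instance Definition _ :=
  GRing.Lmodule_isLalgebra.Build k boalch (@pscalerAl _ _ boalch_rel).
HB.instance Definition _ :=
  GRing.Lalgebra_isAlgebra.Build k boalch (@pscalerAr _ _ boalch_rel).

Definition be (i : 'I_3) : boalch := pgen boalch_rel (BE i).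
Definition bv (a : arrow) : boalch := pgen boalch_rel (BV a).
Definition bw (a : arrow) : boalch := pgen boalch_rel (BW a).
Definition bgamma (i : 'I_3) : boalch := pgen boalch_rel (BG i).
Definition bgamma_inv (i : 'I_3) : boalch := pgen boalch_rel (BGinv i).

Definition boalch_moment : boalch := bgamma i1 + bgamma i2 + bgamma i3.

End BoalchAlgebra.

Section TriangleBracket.
Variables (k : fieldType) (br : double_bracket_type (boalch k)).

Let half : k := 2%:R^-1.
Let e1 : boalch k := be k i1.
Let e2 : boalch k := be k i2.
Let e3 : boalch k := be k i3.
Let v12 : boalch k := bv k a12.
Let v21 : boalch k := bv k a21.
Let v13 : boalch k := bv k a13.
Let v31 : boalch k := bv k a31.
Let v23 : boalch k := bv k a23.
Let v32 : boalch k := bv k a32.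

Record is_triangle_bracket : Prop := IsTriangleBracket {
  tb_double_bracket : is_double_bracket (be k) br;
  tb_same : forall a, br (bv k a) (bv k a) = 0;
  tb_12_13 : br v12 v13 = half *: (v12 ⊗ v13);
  tb_12_32 : br v12 v32 = half *: (v32 ⊗ v12);
  tb_21_31 : br v21 v31 = - (half *: (v31 ⊗ v21));
  tb_21_23 : br v21 v23 = - (half *: (v21 ⊗ v23));
  tb_13_23 : br v13 v23 = half *: (v23 ⊗ v13);
  tb_13_32 : br v13 v32 = - (half *: (e3 ⊗ (v13 * v32)));
  tb_31_23 : br v31 v23 = half *: ((v23 * v31) ⊗ e3);
  tb_31_32 : br v31 v32 = - (half *: (v31 ⊗ v32));
  tb_12_21 : br v12 v21 =
    - (e2 ⊗ e1) - half *: (e2 ⊗ (v12 * v21) + (v21 * v12) ⊗ e1);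
  tb_12_31 : br v12 v31 = - (half *: ((v31 * v12) ⊗ e1)) - v32 ⊗ e1;
  tb_12_23 : br v12 v23 = - (half *: (e2 ⊗ (v12 * v23))) + e2 ⊗ v13;
  tb_21_13 : br v21 v13 = half *: (e1 ⊗ (v21 * v13)) + e1 ⊗ v23;
  tb_21_32 : br v21 v32 = half *: ((v32 * v21) ⊗ e2) - v31 ⊗ e2;
  tb_13_31 : br v13 v31 = - (e3 ⊗ e1) - (v32 * v23) ⊗ e1
    - half *: (e3 ⊗ (v13 * v31) + (v31 * v13) ⊗ e1);
  tb_23_32 : br v23 v32 =
    - (e3 ⊗ e2) - half *: (e3 ⊗ (v23 * v32) + (v32 * v23) ⊗ e2) }.

End TriangleBracket.

(* Main.v *)
From HB Require Import structures.
Require Import Defs.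
From mathcomp Require Import all_boot all_order all_algebra.
From mathcomp Require Import boolp ring.

(** The proof has two independent halves.

    The algebra. Comparing the entries of the Gauss relation expresses gamma_3
    and gamma_1^-1 as polynomials in the v_ij, and then gamma_2 and the w_ij
    through the v_ij and the inverses of gamma_3 and gamma_2 (gamma3E,
    gamma1VE, gamma2E and the lemmas on the products of the w_ij with the
    gamma_i). So the e_i and v_ij generate the algebra once inverses in the
    corners are added (boalch_generation), and a derivation into a bimodule
    that kills the e_i is determined by its values on the v_ij
    (boalch_derivation_ext). Conversely all values in the right corners of the
    bimodule occur (boalch_der_derivation): the product rule for the Gauss
    relation can be solved for the derivatives of the three factors on the
    side of the w_ij. A double bracket is a derivation in its second argument
    for the outer bimodule structure of A (x) A and in its first argument for
    the inner one, and these two structures commute; using the two facts for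
    each argument in turn gives existence and uniqueness of the bracket
    (triangle_bracket_unique).

    Both sides of the moment map condition are derivations in the free
    argument, and both sides of the quasi-Poisson condition are derivations in
    the last argument and invariant under cyclic permutation (triple_leibniz,
    triple_rot, qp_rhs_leibniz, qp_rhs_rot). Hence it suffices to take arrows
    as arguments. What remains are finitely many identities between sums of
    tensors of paths, which are decided by computing with formal sums of paths
    (fvanishP). The moment map condition is checked in this way for gamma_3
    and for the polynomial gamma_1^-1, and carried over to gamma_3^-1 and
    gamma_1 by differentiating a product with value e_s (moment_inverse).
    Since gamma_2 is a polynomial in the v_ij and gamma_3^-1, for it a loop
    standing for gamma_3^-1 is added to the paths, and its products with
    gamma_3 are simplified (fred).

    The representation scheme. The passage to representations is the theorem
    of Van den Bergh, for an arbitrary algebra A with orthogonal idempotents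
    of sum 1 (hamiltonian_double_induces). The prescribed values on the functions a_ij
    extend to a biderivation because the double bracket satisfies the Leibniz
    rule in both arguments, and every identity between (multi)derivations
    needs to be checked on the a_ij only. There the Jacobiator is a difference
    of entries of triple brackets (jacobiator_coord). On the other side, the
    Cartan trivector evaluated at df, dh, dl is half the difference of
    tr (G_f G_h G_l) and tr (G_h G_f G_l), where the entries of the block
    diagonal matrix G_f are the derivatives of f along the infinitesimal
    action (cartan_trivectorE, trace_formE). For f = a_ij the matrix G_f is
    the block diagonal part of the commutator of the elementary matrix E_ji
    with (a_ij) (trace_mx_coord), so that the trace of a product of three such
    matrices expands into the eight terms of the quasi-Poisson condition
    (trace_commutator3, trace_form_coord). In the same way both sides of the
    condition on the group-valued moment map become the entries of
    1/2 (F G_h + G_h F), where F is the matrix of the function Phi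
    (rep_moment_bracket_coord, rep_moment_bracket). *)

Set Implicit Arguments.
Unset Strict Implicit.
Unset Printing Implicit Defensive.

Import GRing.Theory.
Local Open Scope ring_scope.

(** * Linear maps and tensor products *)

Section LinearMaps.
Variables (k : fieldType) (V W : lmodType k) (f : V -> W).
Hypothesis fL : linear f.
Let F : {linear V -> W} := HB.pack f (GRing.isLinear.Build _ _ _ _ f fL).

Lemma lin0 : f 0 = 0. Proof. exact: (raddf0 F). Qed.
Lemma linD x y : f (x + y) = f x + f y. Proof. exact: (raddfD F). Qed.
Lemma linN x : f (- x) = - f x. Proof. exact: (raddfN F). Qed.
Lemma linB x y : f (x - y) = f x - f y. Proof. exact: (raddfB F). Qed.
Lemma linZ c x : f (c *: x) = c *: f x. Proof. exact: (linearZ_LR F). Qed.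
Lemma linMn x n : f (x *+ n) = f x *+ n. Proof. exact: (raddfMn F). Qed.
Lemma linMz x c : f (x *~ c) = f x *~ c. Proof. exact: (raddfMz F). Qed.
Lemma lin_sum I (r : seq I) P (g : I -> V) :
  f (\sum_(i <- r | P i) g i) = \sum_(i <- r | P i) f (g i).
Proof. exact: (raddf_sum F). Qed.
End LinearMaps.

Section LinearClosure.
Variables (k : fieldType) (U V W : lmodType k).
Implicit Types (f g : V -> W).

Lemma linear_id : linear (fun x : V => x). Proof. by []. Qed.

Lemma linear_zero : linear (fun _ : V => 0 : W).
Proof. by move=> c x y; rewrite scaler0 addr0. Qed.

Lemma linear_add f g : linear f -> linear g -> linear (fun x => f x + g x).
Proof. by move=> fL gL c x y; rewrite fL gL scalerDr addrACA. Qed.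

Lemma linear_opp f : linear f -> linear (fun x => - f x).
Proof. by move=> fL c x y; rewrite fL opprD scalerN. Qed.

Lemma linear_scale a f : linear f -> linear (fun x => a *: f x).
Proof. by move=> fL c x y; rewrite fL scalerDr !scalerA mulrC. Qed.

Lemma linear_bigsum I (r : seq I) P (F : I -> V -> W) :
  (forall i, linear (F i)) -> linear (fun x => \sum_(i <- r | P i) F i x).
Proof.
move=> FL c x y; rewrite scaler_sumr -big_split.
by apply: eq_bigr => i _; apply: FL.
Qed.

Lemma linear_comp (f : V -> W) (g : U -> V) :
  linear f -> linear g -> linear (fun x => f (g x)).
Proof. by move=> fL gL c x y; rewrite gL fL. Qed.

End LinearClosure.

Lemma linear_mull (k : fieldType) (V : lmodType k) (A : algType k) (a : A)
    (f : V -> A) : linear f -> linear (fun x => a * f x).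
Proof. by move=> fL c x y; rewrite fL mulrDr scalerAr. Qed.

Lemma linear_mulr (k : fieldType) (V : lmodType k) (A : algType k) (a : A)
    (f : V -> A) : linear f -> linear (fun x => f x * a).
Proof. by move=> fL c x y; rewrite fL mulrDl scalerAl. Qed.

Section Bilinear.
Variables (k : fieldType) (U V W X : lmodType k) (B : V -> W -> X).
Hypothesis BL : bilinear_map B.

Lemma linear_bil_l w (f : U -> V) : linear f -> linear (fun x => B (f x) w).
Proof. by move=> fL c x y; rewrite fL; apply: BL.2. Qed.

Lemma linear_bil_r v (f : U -> W) : linear f -> linear (fun x => B v (f x)).
Proof. by move=> fL c x y; rewrite fL; apply: BL.1. Qed.

End Bilinear.

(** As a sum over the chosen Sweedler representative of t, so that the exchange
    of two nested lifts is an instance of exchange_big. *)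
Definition tlift (k : fieldType) (V W U : lmodType k) (f : V -> W -> U)
  (t : tensor V W) : U := \sum_(p <- sweedler t) f p.1 p.2.

Section TensorLift.
Variables (k : fieldType) (V W U : lmodType k) (f : V -> W -> U).

Lemma bilinear_tens : bilinear_map (@tens k V W).
Proof.
have tensE v w c v' w' : c *: (v ⊗ w) + v' ⊗ w' = tclass [:: (c *: v, w); (v', w')].
  by rewrite -[LHS]/(tadd (tscale _ _) _) tscaleE taddE.
split=> [v c x y|w c x y]; rewrite tensE; apply/tclassP=> X g [gr gl];
  rewrite !big_cons !big_nil /= !addr0 (linZ (gl _)); first exact: gr.
exact: gl.
Qed.

Hypothesis fL : bilinear_map f.

Lemma tlift_tens v w : tlift f (v ⊗ w) = f v w.
Proof. exact: sum_tens. Qed.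

Lemma tlift_linear : linear (tlift f).
Proof.
move=> c; elim/tclass_ind=> s; elim/tclass_ind=> t.
rewrite -[c *: _]/(tscale _ _) -[_ + _ in LHS]/(tadd _ _) tscaleE taddE.
by rewrite /tlift !sum_tclass // big_cat /= bilinear_sumZ.
Qed.

End TensorLift.

Lemma eq_tlift (k : fieldType) (V W U : lmodType k) (f g : V -> W -> U) t :
  (forall v w, f v w = g v w) -> tlift f t = tlift g t.
Proof. by move=> fg; apply: eq_bigr => p _; apply: fg. Qed.

Lemma lin_tlift (k : fieldType) (V W U X : lmodType k) (F : U -> X)
    (f : V -> W -> U) t :
  linear F -> F (tlift f t) = tlift (fun v w => F (f v w)) t.
Proof. by move=> FL; apply: lin_sum. Qed.

Lemma tlift_add (k : fieldType) (V W U : lmodType k) (f g : V -> W -> U) t :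
  tlift f t + tlift g t = tlift (fun v w => f v w + g v w) t.
Proof. by rewrite /tlift big_split. Qed.

Lemma exchange_tlift (k : fieldType) (V W V' W' U : lmodType k)
    (f : V -> W -> V' -> W' -> U) s t :
  tlift (fun v w => tlift (f v w) s) t =
  tlift (fun v' w' => tlift (fun v w => f v w v' w') t) s.
Proof. exact: exchange_big. Qed.

Lemma tens_ext (k : fieldType) (V W U : lmodType k) (f g : tensor V W -> U) :
  linear f -> linear g -> (forall v w, f (v ⊗ w) = g (v ⊗ w)) ->
  forall t, f t = g t.
Proof.
move=> fL gL fg t; rewrite [t]sweedlerK (lin_sum fL) (lin_sum gL).
by apply: eq_bigr => p _.
Qed.

Lemma linear_tensl (k : fieldType) (U V W : lmodType k) (w : W) (f : U -> V) :
  linear f -> linear (fun x => f x ⊗ w).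
Proof. exact: (linear_bil_l (bilinear_tens V W)). Qed.

Lemma linear_tensr (k : fieldType) (U V W : lmodType k) (v : V) (f : U -> W) :
  linear f -> linear (fun x => v ⊗ f x).
Proof. exact: (linear_bil_r (bilinear_tens V W)). Qed.

Lemma tens0l (k : fieldType) (V W : lmodType k) (w : W) : (0 : V) ⊗ w = 0.
Proof. by rewrite (lin0 (linear_tensl w (@linear_id k V))). Qed.

Lemma tens0r (k : fieldType) (V W : lmodType k) (v : V) : v ⊗ (0 : W) = 0.
Proof. by rewrite (lin0 (linear_tensr v (@linear_id k W))). Qed.

Lemma linear_tlift (k : fieldType) (X V W U : lmodType k) (f : V -> W -> U)
    (g : X -> tensor V W) :
  bilinear_map f -> linear g -> linear (fun x => tlift f (g x)).
Proof. by move=> fL; apply/linear_comp/tlift_linear. Qed.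

Lemma linear_tlift_param (k : fieldType) (X V W U : lmodType k)
    (f : X -> V -> W -> U) t :
  (forall v w, linear (fun x => f x v w)) -> linear (fun x => tlift (f x) t).
Proof. by move=> fL; apply: linear_bigsum => p; apply: fL. Qed.

Ltac lin_step :=
  first [ exact: linear_id | exact: linear_zero | eassumption
        | apply: linear_add | apply: linear_opp | apply: linear_scale
        | apply: linear_tensl | apply: linear_tensr
        | apply: linear_mull | apply: linear_mulr
        | apply: linear_tlift_param => ? ?
        | apply: linear_tlift; [split=> ? |]
        | apply: linear_bigsum => ? ].
Ltac lin := repeat lin_step.
Ltac bilin := split=> ?; lin.

(** * Derivations of presented algebras *)

Section BimoduleDerivations.
Variables (k : fieldType) (X : Type) (R : pterm k X -> pterm k X -> Prop).
Local Notation A := (palg R).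
Variables (M : lmodType k) (l : A -> M -> M) (r : M -> A -> M).

Record is_bimodule : Prop := IsBimodule {
  lact_bilinear : bilinear_map l;
  ract_bilinear : bilinear_map r;
  lact1 : forall m, l 1 m = m;
  ract1 : forall m, r m 1 = m;
  lactA : forall x y m, l x (l y m) = l (x * y) m;
  ractA : forall x y m, r (r m x) y = r m (x * y);
  lractA : forall x y m, r (l x m) y = l x (r m y) }.

Definition is_derivation (D : A -> M) : Prop :=
  linear D /\ forall x y, D (x * y) = l x (D y) + r (D x) y.

Hypothesis bimM : is_bimodule.

Lemma derivation1 D : is_derivation D -> D 1 = 0.
Proof.
move=> [_ DM]; have /eqP := DM 1 1.
by rewrite mulr1 (lact1 bimM) (ract1 bimM) -[eqbLHS]addr0 (inj_eq (addrI _)) => /eqP.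
Qed.

Lemma derivation_comb c D D' : is_derivation D -> is_derivation D' ->
  is_derivation (fun x => c *: D x + D' x).
Proof.
move=> [DL DM] [DL' DM']; split=> [|x y]; first by lin.
rewrite DM DM' (linD (bimM.(lact_bilinear).1 _)) (linD (bimM.(ract_bilinear).2 _)).
rewrite (linZ (bimM.(lact_bilinear).1 _)) (linZ (bimM.(ract_bilinear).2 _)).
by rewrite scalerDr addrACA.
Qed.

Lemma derivation0 : is_derivation (fun=> 0).
Proof.
split=> [|x y]; first exact: linear_zero.
by rewrite (lin0 (bimM.(lact_bilinear).1 _)) (lin0 (bimM.(ract_bilinear).2 _)) addr0.
Qed.

Lemma derivation_ext D D' : is_derivation D -> is_derivation D' ->
  (forall x, D (pgen R x) = D' (pgen R x)) -> forall a, D a = D' a.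
Proof.
move=> dD dD' DD'; elim/pclass_ind=> t; have [DL DM] := dD; have [DL' DM'] := dD'.
elim: t => [x|c|s IHs t IHt|s IHs t IHt]; first exact: DD'.
- by rewrite pclass_const (linZ DL) (linZ DL') (derivation1 dD) (derivation1 dD').
- by rewrite pclassD (linD DL) (linD DL') IHs IHt.
- by rewrite pclassM DM DM' IHs IHt.
Qed.

Variable delta : X -> M.

Fixpoint bder_term (t : pterm k X) : M :=
  match t with
  | Gen x => delta x
  | Const _ => 0
  | Add s t => bder_term s + bder_term t
  | Mul s t => l (pclass R s) (bder_term t) + r (bder_term s) (pclass R t)
  end.

(** Like pder, a total function, which is a derivation once delta respects the
    relations; here the values are in an arbitrary bimodule. *)
Definition bder (x : A) : M := bder_term (repr x).

Hypothesis delta_rel : forall s t, R s t -> bder_term s = bder_term t.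

Lemma bder_term_pres s t : pres_eq R s t -> bder_term s = bder_term t.
Proof.
have lD x m n : l x (m + n) = l x m + l x n by rewrite (linD (bimM.(lact_bilinear).1 x)).
have rD x m n : r (m + n) x = r m x + r n x.
  by rewrite (linD (bimM.(ract_bilinear).2 x)).
have Dl m x y : l (x + y) m = l x m + l y m by rewrite (linD (bimM.(lact_bilinear).2 m)).
have Dr m x y : r m (x + y) = r m x + r m y.
  by rewrite (linD (bimM.(ract_bilinear).1 m)).
have l0 x : l x 0 = 0 by rewrite (lin0 (bimM.(lact_bilinear).1 x)).
have r0 x : r 0 x = 0 by rewrite (lin0 (bimM.(ract_bilinear).2 x)).
have lc c m : l (pclass R (Const c)) m = c *: m.
  by rewrite pclass_const (linZ (bimM.(lact_bilinear).2 m)) (lact1 bimM).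
have rc c m : r m (pclass R (Const c)) = c *: m.
  by rewrite pclass_const (linZ (bimM.(ract_bilinear).1 m)) (ract1 bimM).
elim=> {s t} //=.
- by move=> s t u _ -> _ ->.
- by move=> s s' t t' _ -> _ ->.
- by move=> s s' t t' /pclassP-> -> /pclassP-> ->.
- by move=> s t u; rewrite addrA.
- by move=> s t; rewrite addrC.
- by move=> s; rewrite add0r.
- by move=> s; rewrite r0 lc addr0 scaleN1r addNr.
- by move=> s t u; rewrite lD rD (lactA bimM) (ractA bimM) (lractA bimM)
    !pclassM addrA.
- by move=> s; rewrite r0 lc addr0 scale1r.
- by move=> s; rewrite l0 rc add0r scale1r.
- by move=> s t u; rewrite pclassD Dl rD addrACA.
- by move=> s t u; rewrite pclassD Dr lD addrACA.
- by move=> a b; rewrite addr0.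
- by move=> a b; rewrite l0 r0 addr0.
- by move=> a s; rewrite l0 r0 add0r addr0 lc rc.
Qed.

Lemma bder_pclass t : bder (pclass R t) = bder_term t.
Proof. exact/bder_term_pres/repr_pclass. Qed.

Lemma bder_derivation : is_derivation bder.
Proof.
split=> [c|]; elim/pclass_ind=> s; elim/pclass_ind=> t; last first.
  by rewrite -pclassM !bder_pclass.
rewrite ![_ *: pclass _ _]pscaleE -pclassD !bder_pclass /=.
rewrite (lin0 (bimM.(ract_bilinear).2 _)) addr0 pclass_const.
by rewrite (linZ (bimM.(lact_bilinear).2 _)) (lact1 bimM).
Qed.

End BimoduleDerivations.

Section MorphismExt.
Variables (k : fieldType) (X : Type) (R : pterm k X -> pterm k X -> Prop).
Variables (Y : Type) (R' : pterm k Y -> pterm k Y -> Prop).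

Lemma morphism_ext (f g : palg R -> palg R') :
  linear f -> monoid_morphism f -> linear g -> monoid_morphism g ->
  (forall x, f (pgen R x) = g (pgen R x)) -> forall a, f a = g a.
Proof.
move=> fL [f1 fM] gL [g1 gM] fg; elim/pclass_ind.
elim=> [x|c|s IHs t IHt|s IHs t IHt]; first exact: fg.
- by rewrite pclass_const (linZ fL) (linZ gL) f1 g1.
- by rewrite pclassD (linD fL) (linD gL) IHs IHt.
- by rewrite pclassM fM gM IHs IHt.
Qed.

End MorphismExt.

Section AlgebraMorphisms.
Variables (k : fieldType) (X Y : Type).
Variables (R : pterm k X -> pterm k X -> Prop) (R' : pterm k Y -> pterm k Y -> Prop).
Variable val : Y -> palg R.
Local Notation cst := (fun c : k => c *: (1 : palg R)).
Hypothesis val_rel : forall s t, R' s t -> eval cst val s = eval cst val t.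

Let F : palg R' -> palg R := plift cst val.

Lemma plift_alg_pclass t : F (pclass R' t) = eval cst val t.
Proof. exact/(eval_alg_pres val_rel)/repr_pclass. Qed.

Lemma plift_alg_linear : linear F.
Proof.
move=> c; elim/pclass_ind=> s; elim/pclass_ind=> t.
rewrite ![_ *: pclass _ _]pscaleE -[LHS]/(F (_ + _)) -pclassD !plift_alg_pclass /=.
by rewrite -pscalerAl mul1r.
Qed.

Lemma plift_alg_morphism : monoid_morphism F.
Proof.
split=> [|x y].
  by rewrite -[1]/(pclass R' 1%pres) plift_alg_pclass /= scale1r.
by elim/pclass_ind: x => s; elim/pclass_ind: y => t; rewrite -pclassM !plift_alg_pclass.
Qed.

End AlgebraMorphisms.

(** * Double brackets and triple brackets *)

Section OuterInner.
Variables (k : fieldType) (A : algType k).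
Local Notation A2 := (tensor A A).
Implicit Types (a b c x y : A) (t : A2).

(** The bimodule structure for which a double bracket is a derivation in its
    first argument. It commutes with the outer one, and flip exchanges the
    two. *)
Definition inner x t y : A2 := tlift (fun u v => (u * y) ⊗ (x * v)) t.

Lemma outer_tens x u v y : outer x (u ⊗ v) y = (x * u) ⊗ (v * y).
Proof. by apply: (tlift_tens (f := fun u v => (x * u) ⊗ (v * y))); bilin. Qed.

Lemma inner_tens x u v y : inner x (u ⊗ v) y = (u * y) ⊗ (x * v).
Proof. by apply: (tlift_tens (f := fun u v => (u * y) ⊗ (x * v))); bilin. Qed.

Lemma flip_tens (u v : A) : flip (u ⊗ v) = v ⊗ u.
Proof. by apply: (tlift_tens (f := fun u v => v ⊗ u)); bilin. Qed.

Section LinearActions.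
Variables (V : lmodType k) (f : V -> A2) (g : V -> A).
Hypotheses (fL : linear f) (gL : linear g).

Lemma linear_outer x y : linear (fun z => outer x (f z) y).
Proof. by apply: (linear_tlift (f := fun u v => (x * u) ⊗ (v * y))) => //; bilin. Qed.

Lemma linear_inner x y : linear (fun z => inner x (f z) y).
Proof. by apply: linear_tlift => //; bilin. Qed.

Lemma linear_flip : linear (fun z => flip (f z)).
Proof. by apply: (linear_tlift (f := fun u v => v ⊗ u)) => //; bilin. Qed.

Lemma linear_outer_l y t : linear (fun z => outer (g z) t y).
Proof. by rewrite /outer; lin. Qed.

Lemma linear_outer_r x t : linear (fun z => outer x t (g z)).
Proof. by rewrite /outer; lin. Qed.

Lemma linear_inner_l y t : linear (fun z => inner (g z) t y).
Proof. by rewrite /inner; lin. Qed.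

Lemma linear_inner_r x t : linear (fun z => inner x t (g z)).
Proof. by rewrite /inner; lin. Qed.

End LinearActions.

End OuterInner.

Ltac lin_act :=
  repeat first [lin_step | apply: linear_outer | apply: linear_inner
    | apply: linear_flip | apply: linear_outer_l | apply: linear_outer_r
    | apply: linear_inner_l | apply: linear_inner_r].

Section Bimodules.
Variables (k : fieldType) (A : algType k).
Local Notation A2 := (tensor A A).
Local Notation A3 := (tensor A A2).
Implicit Types (a b c x y : A) (t : A2).

Lemma tlift_outer (U : lmodType k) (f : A -> A -> U) x t y : bilinear_map f ->
  tlift f (outer x t y) = tlift (fun u v => f (x * u) (v * y)) t.
Proof.
move=> fL; rewrite (lin_sum (tlift_linear fL)).
by apply: eq_bigr => p _; rewrite tlift_tens.
Qed.

Lemma tlift_inner (U : lmodType k) (f : A -> A -> U) x t y : bilinear_map f ->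
  tlift f (inner x t y) = tlift (fun u v => f (u * y) (x * v)) t.
Proof.
move=> fL; rewrite (lin_sum (tlift_linear fL)).
by apply: eq_bigr => p _; rewrite tlift_tens.
Qed.

Lemma tlift_flip (U : lmodType k) (f : A -> A -> U) t : bilinear_map f ->
  tlift f (flip t) = tlift (fun u v => f v u) t.
Proof.
move=> fL; rewrite (lin_sum (tlift_linear fL)).
by apply: eq_bigr => p _; rewrite tlift_tens.
Qed.

Lemma flipK : involutive (@flip k A).
Proof. by apply: tens_ext; lin_act => // u v; rewrite !flip_tens. Qed.

Lemma flip_outer x t y : flip (outer x t y) = inner x (flip t) y.
Proof.
move: t; apply: tens_ext; lin_act => // u v.
by rewrite outer_tens !flip_tens inner_tens.
Qed.

Lemma flip_inner x t y : flip (inner x t y) = outer x (flip t) y.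
Proof. by rewrite -[t in LHS]flipK -flip_outer flipK. Qed.

Lemma outer_outer x x' t y' y :
  outer x (outer x' t y') y = outer (x * x') t (y' * y).
Proof.
by move: t; apply: tens_ext; lin_act => // u v; rewrite !outer_tens !mulrA.
Qed.

Lemma inner_inner x x' t y' y :
  inner x (inner x' t y') y = inner (x * x') t (y' * y).
Proof.
by move: t; apply: tens_ext; lin_act => // u v; rewrite !inner_tens !mulrA.
Qed.

Lemma inner_outer x x' t y' y :
  inner x (outer x' t y') y = outer x' (inner x t y) y'.
Proof.
move: t; apply: tens_ext; lin_act => // u v.
by rewrite !(inner_tens, outer_tens) !mulrA.
Qed.

Lemma outer1 t : outer 1 t 1 = t.
Proof.
by move: t; apply: tens_ext; lin_act => // u v; rewrite outer_tens mul1r mulr1.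
Qed.

Lemma inner1 t : inner 1 t 1 = t.
Proof.
by move: t; apply: tens_ext; lin_act => // u v; rewrite inner_tens mul1r mulr1.
Qed.

Lemma tens3_ext (U : lmodType k) (f g : A3 -> U) : linear f -> linear g ->
  (forall u v w, f (u ⊗ (v ⊗ w)) = g (u ⊗ (v ⊗ w))) -> forall s, f s = g s.
Proof.
move=> fL gL fg; apply: tens_ext => // u.
by apply: tens_ext => [||v w]; [exact/linear_comp/linear_tensr/linear_id..|].
Qed.

(** The structure for which a triple bracket is a derivation in its last
    argument. *)
Definition outer3 x (s : A3) y : A3 :=
  tlift (fun u t => (x * u) ⊗ outer 1 t y) s.

Lemma bilinear_outer3 x y : bilinear_map (fun (u : A) (s : A2) => (x * u) ⊗ outer 1 s y).
Proof. by split=> ?; lin_act. Qed.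

Lemma linear_outer3 (V : lmodType k) (f : V -> A3) x y :
  linear f -> linear (fun z => outer3 x (f z) y).
Proof. exact/linear_tlift/bilinear_outer3. Qed.

Lemma linear_outer3_l (V : lmodType k) (g : V -> A) y s :
  linear g -> linear (fun z => outer3 (g z) s y).
Proof. by move=> gL; rewrite /outer3; lin. Qed.

Lemma linear_outer3_r (V : lmodType k) (g : V -> A) x s :
  linear g -> linear (fun z => outer3 x s (g z)).
Proof. by move=> gL; apply: linear_tlift_param => u t; lin_act. Qed.

Lemma outer3_tens x u v w y :
  outer3 x (u ⊗ (v ⊗ w)) y = (x * u) ⊗ (v ⊗ (w * y)).
Proof.
by rewrite -[LHS]/(tlift _ _) tlift_tens ?outer_tens ?mul1r //; apply: bilinear_outer3.
Qed.

Lemma outer3_outer3 x x' s y' y :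
  outer3 x (outer3 x' s y') y = outer3 (x * x') s (y' * y).
Proof.
move: s; apply: tens3_ext => [||u v w]; last by rewrite !outer3_tens !mulrA.
- by do 2!apply: linear_outer3; lin.
- by apply: linear_outer3; lin.
Qed.

Lemma outer3_1 s : outer3 1 s 1 = s.
Proof.
move: s; apply: tens3_ext => [||u v w]; last by rewrite !outer3_tens mul1r mulr1.
- by apply: linear_outer3; lin.
- by lin.
Qed.

(** The cyclic permutation tau_(123) of the three tensor factors. *)
Definition rot (s : A3) : A3 :=
  tlift (fun u t => tlift (fun v w => w ⊗ (u ⊗ v)) t) s.

Lemma bilinear_rot :
  bilinear_map (fun (u : A) (s : A2) => tlift (fun v w : A => w ⊗ (u ⊗ v)) s).
Proof. by split=> ?; lin; bilin. Qed.

Lemma linear_rot (V : lmodType k) (f : V -> A3) :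
  linear f -> linear (fun z => rot (f z)).
Proof. exact/linear_tlift/bilinear_rot. Qed.

Lemma rot_tens u v w : rot (u ⊗ (v ⊗ w)) = w ⊗ (u ⊗ v).
Proof.
rewrite -[LHS]/(tlift _ _) tlift_tens ?tlift_tens //; last exact: bilinear_rot.
by bilin.
Qed.

End Bimodules.

Section DoubleBracketTheory.
Variables (k : fieldType) (A : algType k) (e : 'I_3 -> A).
Variable br : double_bracket_type A.
Hypothesis brP : is_double_bracket e br.
Local Notation A2 := (tensor A A).
Local Notation A3 := (tensor A A2).
Implicit Types (a b c x y : A) (t : A2).

Let brL : bilinear_map br := dbr_bilinear brP.

Lemma linear_br_l (V : lmodType k) (f : V -> A) b :
  linear f -> linear (fun z => br (f z) b).
Proof. exact: linear_bil_l. Qed.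

Lemma linear_br_r (V : lmodType k) (f : V -> A) a :
  linear f -> linear (fun z => br a (f z)).
Proof. exact: linear_bil_r. Qed.

Lemma base_idem s : in_base e (e s).
Proof.
exists (fun r => (r == s)%:R); rewrite (bigD1 s) //= eqxx scale1r big1 ?addr0 //.
by move=> r /negPf->; rewrite scale0r.
Qed.

Lemma br_idem_l s a : br (e s) a = 0.
Proof. by apply: brP.(dbr_base); left; apply: base_idem. Qed.

Lemma br_idem_r s a : br a (e s) = 0.
Proof. by apply: brP.(dbr_base); right; apply: base_idem. Qed.

(** Antisymmetry moves the product to the second argument, where the Leibniz
    rule is the outer one, and flip turns outer into inner multiplications. *)
Lemma dbr_leibniz_l a b c : br (a * b) c = inner a (br b c) 1 + inner 1 (br a c) b.
Proof.
have flipL := @linear_flip k A _ _ (@linear_id k A2).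
rewrite (dbr_antisym brP) (dbr_leibniz brP) (linD flipL) !flip_outer opprD addrC.
rewrite (dbr_antisym brP b) (dbr_antisym brP a).
by rewrite !(linN (linear_inner (@linear_id k A2) _ _)).
Qed.

Lemma tripleE a b c : triple_bracket br a b c =
  tlift (fun p1 p2 => tlift (fun q1 q2 => q1 ⊗ (q2 ⊗ p2)) (br a p1)) (br b c)
  + tlift (fun p1 p2 => tlift (fun q1 q2 => p2 ⊗ (q1 ⊗ q2)) (br b p1)) (br c a)
  + tlift (fun p1 p2 => tlift (fun q1 q2 => q2 ⊗ (p2 ⊗ q1)) (br c p1)) (br a b).
Proof. by []. Qed.

Lemma bilin_triple1 a :
  bilinear_map (fun p1 p2 : A => tlift (fun q1 q2 => q1 ⊗ (q2 ⊗ p2)) (br a p1)).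
Proof. by split=> ?; lin; apply: linear_br_r; lin. Qed.

Lemma bilin_triple2 b :
  bilinear_map (fun p1 p2 : A => tlift (fun q1 q2 => p2 ⊗ (q1 ⊗ q2)) (br b p1)).
Proof. by split=> ?; lin; apply: linear_br_r; lin. Qed.

Lemma bilin_triple3 c :
  bilinear_map (fun p1 p2 : A => tlift (fun q1 q2 => q2 ⊗ (p2 ⊗ q1)) (br c p1)).
Proof. by split=> ?; lin; apply: linear_br_r; lin. Qed.

Lemma linear_triple a b : linear (triple_bracket br a b).
Proof.
suff: linear (fun c => triple_bracket br a b c) by [].
under eq_fun do rewrite tripleE.
apply: linear_add; first apply: linear_add.
- by apply: (linear_tlift (bilin_triple1 a)); apply: linear_br_r; lin.
- by apply: (linear_tlift (bilin_triple2 b)); apply: linear_br_l; lin.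
- by lin; apply: linear_br_l; lin.
Qed.

(** The three summands of the triple bracket are permuted cyclically. *)
Lemma triple_rot a b c : triple_bracket br a b c = rot (triple_bracket br b c a).
Proof.
have rotL := linear_rot (@linear_id k A3).
rewrite !tripleE !(linD rotL) /tlift !(lin_sum rotL) [RHS]addrC addrA.
congr (_ + _ + _); apply: eq_bigr => p _; rewrite (lin_sum rotL);
  by apply: eq_bigr => q _; rewrite rot_tens.
Qed.

Lemma triple_idem a b s : triple_bracket br a b (e s) = 0.
Proof.
rewrite tripleE br_idem_l br_idem_r !(lin0 (tlift_linear _)) ?add0r.
- apply: big1 => p _; rewrite br_idem_l.
  by rewrite (lin0 (tlift_linear (f := fun q1 q2 => q2 ⊗ (p.2 ⊗ q1)) _)) //; bilin.
- exact: bilin_triple2.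
- exact: bilin_triple1.
Qed.

(** Expanding a nested bracket by the two Leibniz rules gives, besides the two
    expected terms, a term in which both factors c and c' are bracketed. It
    occurs in two of the three summands of the triple bracket, with opposite
    signs by antisymmetry. *)
Lemma triple_leibniz a b c c' : triple_bracket br a b (c * c') =
  outer3 c (triple_bracket br a b c') 1 + outer3 1 (triple_bracket br a b c) c'.
Proof.
have o3L x y := linear_outer3 x y (@linear_id k A3).
(* The cross term: {{b, c'}} with its first factor multiplied by {{a, c}}. *)
pose X : A3 :=
  tlift (fun u v => tlift (fun q1 q2 => q1 ⊗ ((q2 * u) ⊗ v)) (br a c)) (br b c').
rewrite !tripleE !(linD (o3L _ _)) !(lin_tlift _ _ (o3L _ _)).
have -> : tlift (fun p1 p2 => tlift (fun q1 q2 => q1 ⊗ (q2 ⊗ p2)) (br a p1))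
      (br b (c * c')) =
    tlift (fun p1 p2 => outer3 c (tlift (fun q1 q2 => q1 ⊗ (q2 ⊗ p2)) (br a p1)) 1)
      (br b c') +
    tlift (fun p1 p2 => outer3 1 (tlift (fun q1 q2 => q1 ⊗ (q2 ⊗ p2)) (br a p1)) c')
      (br b c) + X.
  rewrite (dbr_leibniz brP) (linD (tlift_linear (bilin_triple1 a))).
  rewrite !(tlift_outer _ _ _ (bilin_triple1 a)) addrC addrAC /X tlift_add.
  congr (_ + _); apply: eq_tlift => u v; last first.
    rewrite (lin_tlift _ _ (o3L _ _)) mul1r; apply: eq_tlift => q1 q2.
    by rewrite outer3_tens mul1r.
  rewrite (dbr_leibniz brP) (linD (tlift_linear _)); last by bilin.
  rewrite !tlift_outer; try by bilin.
  rewrite addrC (lin_tlift _ _ (o3L _ _)).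
  congr (_ + _); apply: eq_tlift => q1 q2; first by rewrite outer3_tens !mulr1.
  by rewrite mul1r mulr1.
have -> : tlift (fun p1 p2 => tlift (fun q1 q2 => p2 ⊗ (q1 ⊗ q2)) (br b p1))
      (br (c * c') a) =
    tlift (fun p1 p2 => outer3 c (tlift (fun q1 q2 => p2 ⊗ (q1 ⊗ q2)) (br b p1)) 1)
      (br c' a) +
    tlift (fun p1 p2 => outer3 1 (tlift (fun q1 q2 => p2 ⊗ (q1 ⊗ q2)) (br b p1)) c')
      (br c a) - X.
  rewrite dbr_leibniz_l (linD (tlift_linear (bilin_triple2 b))).
  rewrite !(tlift_inner _ _ _ (bilin_triple2 b)) -addrA; congr (_ + _).
    apply: eq_tlift => u v; rewrite mulr1 (lin_tlift _ _ (o3L _ _)).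
    by apply: eq_tlift => q1 q2; rewrite outer3_tens mulr1.
  have -> : X = - tlift (fun u v => tlift (fun q1 q2 => v ⊗ ((u * q1) ⊗ q2)) (br b c'))
                   (br c a).
    rewrite (dbr_antisym brP c) (linN (tlift_linear _)); last first.
      by split=> ?; lin; bilin.
    rewrite tlift_flip; last by split=> ?; lin; bilin.
    by rewrite opprK exchange_tlift.
  rewrite opprK tlift_add; apply: eq_tlift => u v.
  rewrite (dbr_leibniz brP) (linD (tlift_linear _)); last by bilin.
  rewrite !tlift_outer; try by bilin.
  rewrite (lin_tlift _ _ (o3L _ _)).
  congr (_ + _); apply: eq_tlift => q1 q2; first by rewrite outer3_tens !mul1r.
  by rewrite mul1r mulr1.
have -> : tlift (fun p1 p2 => tlift (fun q1 q2 => q2 ⊗ (p2 ⊗ q1)) (br (c * c') p1))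
      (br a b) =
    tlift (fun p1 p2 => outer3 c (tlift (fun q1 q2 => q2 ⊗ (p2 ⊗ q1)) (br c' p1)) 1)
      (br a b) +
    tlift (fun p1 p2 => outer3 1 (tlift (fun q1 q2 => q2 ⊗ (p2 ⊗ q1)) (br c p1)) c')
      (br a b).
  rewrite tlift_add; apply: eq_tlift => u v.
  rewrite dbr_leibniz_l (linD (tlift_linear _)); last by bilin.
  rewrite !tlift_inner; try by bilin.
  rewrite !(lin_tlift _ _ (o3L _ _)).
  congr (_ + _); apply: eq_tlift => q1 q2; first by rewrite outer3_tens !mulr1.
  by rewrite outer3_tens !mul1r.
set t1 := tlift _ _; set t2 := tlift _ _; set t3 := tlift _ _; set t4 := tlift _ _.
set t5 := tlift _ _; set t6 := tlift _ _.
rewrite [t1 + t2 + X + _]addrACA subrr addr0.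
by rewrite (AC (2*2*2)%AC (1*3*5*(2*4*6))%AC).
Qed.

(** The element whose inner derivation, for the action of outer3, is
    qp_rhs a b. *)
Definition qp_kernel a b : A3 := \sum_s
  ((e s * a) ⊗ ((e s * b) ⊗ e s) - (e s * a) ⊗ (e s ⊗ (b * e s))
   - e s ⊗ ((a * e s * b) ⊗ e s) + e s ⊗ ((a * e s) ⊗ (b * e s))).

(** The right hand side of the quasi-Poisson condition, up to the factor 1/4. *)
Definition qp_rhs a b c : A3 := \sum_s
   ( (c * e s * a) ⊗ ((e s * b) ⊗ e s)
   - (c * e s * a) ⊗ (e s ⊗ (b * e s))
   - (c * e s) ⊗ ((a * e s * b) ⊗ e s)
   + (c * e s) ⊗ ((a * e s) ⊗ (b * e s))
   - (e s * a) ⊗ ((e s * b) ⊗ (e s * c))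
   + (e s * a) ⊗ (e s ⊗ (b * e s * c))
   + e s ⊗ ((a * e s * b) ⊗ (e s * c))
   - e s ⊗ ((a * e s) ⊗ (b * e s * c)) ).

Lemma qp_rhsE a b c :
  qp_rhs a b c = outer3 c (qp_kernel a b) 1 - outer3 1 (qp_kernel a b) c.
Proof.
have o3L x y := linear_outer3 x y (@linear_id k A3).
rewrite !(lin_sum (o3L _ _)) -sumrN -big_split; apply: eq_bigr => s _ /=.
rewrite !(linD (o3L _ _)) !(linN (o3L _ _)) !outer3_tens !mul1r !mulr1 !mulrA.
by rewrite !opprD !opprK !addrA.
Qed.

Lemma linear_qp_rhs a b : linear (qp_rhs a b).
Proof.
suff: linear (fun c => qp_rhs a b c) by [].
under eq_fun do rewrite qp_rhsE.
apply: linear_add; [|apply: linear_opp].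
- by apply: linear_outer3_l; lin.
- by apply: linear_outer3_r; lin.
Qed.

Lemma qp_rhs_leibniz a b c c' : qp_rhs a b (c * c') =
  outer3 c (qp_rhs a b c') 1 + outer3 1 (qp_rhs a b c) c'.
Proof.
have o3L x y := linear_outer3 x y (@linear_id k A3).
rewrite !qp_rhsE !(linB (o3L _ _)) !outer3_outer3 !mul1r !mulr1.
by rewrite addrA subrK.
Qed.

Lemma qp_rhs_idem a b s : (forall i j, e i * e j = if i == j then e i else 0) ->
  qp_rhs a b (e s) = 0.
Proof.
move=> eE; have o3L x y := linear_outer3 x y (@linear_id k A3).
rewrite qp_rhsE; apply/eqP; rewrite subr_eq0; apply/eqP.
rewrite !(lin_sum (o3L _ _)); apply: eq_bigr => r _.
rewrite !(linD (o3L _ _)) !(linN (o3L _ _)) !outer3_tens !mul1r !mulr1 -!mulrA !eE.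
rewrite !mulrA !eE; case: (eqVneq s r) => [->|_]; first by rewrite ?eqxx ?mulrA ?eE ?eqxx.
by rewrite !(mul0r, mulr0, tens0l, tens0r) ?subr0 ?addr0.
Qed.

Lemma qp_rhs_rot a b c : qp_rhs a b c = rot (qp_rhs b c a).
Proof.
have rotL := linear_rot (@linear_id k A3).
rewrite (lin_sum rotL); apply: eq_bigr => s _.
rewrite !(linD rotL) !(linN rotL) !rot_tens.
by rewrite [RHS](ACl (6*8*2*4*5*7*1*3)%AC).
Qed.

End DoubleBracketTheory.

(** * Computing with paths *)

(** Finite sums with integral coefficients, as lists that need not be reduced:
    all identities between double brackets of arrows are decided on them. *)
Definition fsum (X : Type) := seq (int * X).

Section FormalSums.
Variables (X : Type) (V : zmodType) (phi : X -> V).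

Definition fval (F : fsum X) : V := \sum_(t <- F) phi t.2 *~ t.1.

Definition fscale (c : int) (F : fsum X) : fsum X := [seq (c * t.1, t.2) | t <- F].

Lemma fval_cat F G : fval (F ++ G) = fval F + fval G.
Proof. exact: big_cat. Qed.

Lemma fval_scale c F : fval (fscale c F) = fval F *~ c.
Proof.
rewrite /fval big_map mulrz_suml; apply: eq_bigr => t _ /=.
by rewrite mulrC mulrzA.
Qed.

Lemma fvalMn F n : fval F *+ n = \sum_(t <- F) (phi t.2 *+ n) *~ t.1.
Proof.
by rewrite -sumrMnl; apply: eq_bigr => t _; rewrite !pmulrn mulrzAC.
Qed.

End FormalSums.

Section Vanishing.
Variables (X : eqType) (V : zmodType) (phi : X -> V).

(** The test is sufficient, but not necessary, for a formal sum to have value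
    zero. The predicate null recognises the terms that vanish by themselves,
    such as products of paths that do not compose. *)
Definition fvanish (null : pred X) (F : fsum X) : bool :=
  all (fun t => null t.2 ||
    (foldr (fun r c => if r.2 == t.2 then r.1 + c else c) 0 F == 0)) F.

Lemma fvanishP (null : pred X) F :
  (forall x, null x -> phi x = 0) -> fvanish null F -> fval phi F = 0.
Proof.
move=> null0 /allP F0.
have -> : fval phi F =
      \sum_(x <- undup [seq t.2 | t <- F]) phi x *~ (\sum_(t <- F | t.2 == x) t.1).
  rewrite /fval; under [RHS]eq_bigr => x _ do rewrite mulrz_sumr.
  under [RHS]eq_bigr => x _ do rewrite big_mkcond.
  rewrite exchange_big /=; rewrite [LHS]big_seq [RHS]big_seq.
  apply: eq_bigr => t tF; rewrite (bigD1_seq t.2) ?undup_uniq //=; last first.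
    by rewrite mem_undup map_f.
  by rewrite eqxx big1 ?addr0 // => x; rewrite eq_sym => /negPf->.
rewrite big_seq big1 // => x; rewrite mem_undup => /mapP[t /F0 /orP[/null0|] + ->].
  by move=> ->; rewrite mul0rz.
suff -> : foldr (fun r c => if r.2 == t.2 then r.1 + c else c) 0 F =
    \sum_(r <- F | r.2 == t.2) r.1 by move=> /eqP->.
by elim: F {F0} => [|r F IHF] /=; rewrite ?big_nil // big_cons IHF.
Qed.

End Vanishing.

Definition fmap (X Y : Type) (h : X -> Y) (F : fsum X) : fsum Y :=
  [seq (t.1, h t.2) | t <- F].

Definition fbind (X Y : Type) (h : X -> fsum Y) (F : fsum X) : fsum Y :=
  flatten [seq fscale t.1 (h t.2) | t <- F].

Lemma fval_map (X Y : Type) (V : zmodType) (phi : Y -> V) (h : X -> Y) F :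
  fval phi (fmap h F) = fval (phi \o h) F.
Proof. by rewrite /fval big_map. Qed.

Lemma fval_bind (X Y : Type) (V : zmodType) (phi : Y -> V) (h : X -> fsum Y) F :
  fval phi (fbind h F) = fval (fun x => fval phi (h x)) F.
Proof.
rewrite /fval big_flatten big_map; apply: eq_bigr => t _.
exact: fval_scale.
Qed.

Lemma eq_fval (X : Type) (V : zmodType) (phi psi : X -> V) F :
  phi =1 psi -> fval phi F = fval psi F.
Proof. by move=> E; apply: eq_bigr => t _; rewrite E. Qed.

Lemma lin_fval (X : Type) (k : fieldType) (V W : lmodType k) (f : V -> W)
  (phi : X -> V) F : linear f -> f (fval phi F) = fval (f \o phi) F.
Proof.
by move=> fL; rewrite (lin_sum fL); apply: eq_bigr => t _; rewrite (linMz fL).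
Qed.

Lemma ord3_ind (P : 'I_3 -> Prop) : P i1 -> P i2 -> P i3 -> forall i, P i.
Proof.
move=> P1 P2 P3 [[|[|[|//]]] lti].
- by rewrite (_ : Ordinal lti = i1) //; apply: val_inj.
- by rewrite (_ : Ordinal lti = i2) //; apply: val_inj.
- by rewrite (_ : Ordinal lti = i3) //; apply: val_inj.
Qed.

Lemma sum_ord3 (V : nmodType) (F : 'I_3 -> V) : \sum_i F i = F i1 + F i2 + F i3.
Proof.
rewrite !big_ord_recl big_ord0 addr0 addrA.
by congr (F _ + F _ + F _); apply: val_inj.
Qed.

(** There is at most one arrow from one vertex to another, so a path is
    recorded by the vertices that it visits, from its head to its tail. The
    empty sequence denotes zero, the product of paths that do not compose. *)
Definition path3 : Type := seq 'I_3.

Definition pmulp (p q : path3) : path3 :=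
  match p, q with
  | i :: s, j :: t => if last i s == j then i :: s ++ t else [::]
  | _, _ => [::]
  end.

Arguments pmulp : simpl never.

Section Paths.
Variables (k : fieldType) (A : algType k) (e : 'I_3 -> A) (u : 'I_3 -> 'I_3 -> A).
Hypothesis e_idem : forall i j, e i * e j = if i == j then e i else 0.
Hypothesis u_head : forall i j, e i * u i j = u i j.
Hypothesis u_tail : forall i j, u i j * e j = u i j.

Fixpoint pathv (i : 'I_3) (s : path3) : A :=
  match s with
  | [::] => e i
  | [:: j] => u i j
  | j :: t => u i j * pathv j t
  end.

Definition pval (p : path3) : A := if p is i :: s then pathv i s else 0.

Lemma pathv_cons i j t : pathv i (j :: t) = u i j * pathv j t.
Proof. by case: t => [|l t] //=; rewrite u_tail. Qed.

Lemma pathv_head i s : e i * pathv i s = pathv i s.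
Proof. by case: s => [|j s]; rewrite ?pathv_cons ?mulrA ?u_head //= e_idem eqxx. Qed.

Lemma pathv_tail i s : pathv i s * e (last i s) = pathv i s.
Proof.
elim: s i => [|j s IHs] i; first by rewrite /= e_idem eqxx.
by rewrite pathv_cons -mulrA IHs.
Qed.

Lemma pathv_cat i s t : pathv i (s ++ t) = pathv i s * pathv (last i s) t.
Proof.
elim: s i => [|j s IHs] i; first by rewrite /= pathv_head.
by rewrite cat_cons !pathv_cons IHs mulrA.
Qed.

Lemma pvalM p q : pval (pmulp p q) = pval p * pval q.
Proof.
case: p q => [|i s] [|j t]; rewrite /pmulp /= ?mul0r ?mulr0 //.
case: eqP => [<-|/eqP/negPf ne]; first exact: pathv_cat.
by rewrite -(pathv_tail i) -(pathv_head j) mulrA -(mulrA _ _ (e j)) e_idem ne mulr0 mul0r.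
Qed.

Definition pval2 (t : path3 * path3) : tensor A A := pval t.1 ⊗ pval t.2.
Definition pval3 (t : path3 * path3 * path3) : tensor A (tensor A A) :=
  pval t.1.1 ⊗ (pval t.1.2 ⊗ pval t.2).

Definition null2 (t : path3 * path3) := (t.1 == [::]) || (t.2 == [::]).
Definition null3 (t : path3 * path3 * path3) :=
  [|| t.1.1 == [::], t.1.2 == [::] | t.2 == [::]].

Lemma pval2_null t : null2 t -> pval2 t = 0.
Proof.
by rewrite /pval2; case/orP=> /eqP->; rewrite ?tens0l ?tens0r.
Qed.

Lemma pval3_null t : null3 t -> pval3 t = 0.
Proof.
rewrite /pval3; case/orP=> [/eqP->|/(@pval2_null (t.1.2, t.2))]; rewrite /pval2 /=.
  by rewrite tens0l.
by move=> ->; rewrite tens0r.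
Qed.

Definition fouter (p : path3) (F : fsum (path3 * path3)) (q : path3) :=
  fmap (fun t => (pmulp p t.1, pmulp t.2 q)) F.

Lemma fouterE p F q :
  fval pval2 (fouter p F q) = outer (pval p) (fval pval2 F) (pval q).
Proof.
rewrite fval_map (lin_fval _ _ (linear_outer (@linear_id k _) _ _)).
by apply: eq_fval => t /=; rewrite /pval2 outer_tens !pvalM.
Qed.

Definition fflip (F : fsum (path3 * path3)) : fsum (path3 * path3) :=
  fmap (fun t => (t.2, t.1)) F.

Lemma fflipE F : fval pval2 (fflip F) = flip (fval pval2 F).
Proof.
rewrite fval_map (lin_fval _ _ (linear_flip (@linear_id k _))).
by apply: eq_fval => t /=; rewrite /pval2 flip_tens.
Qed.

(** Values of twice a double bracket on pairs of arrows, each given by its head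
    and its tail; doubling makes all coefficients integral. *)
Definition btable : Type := 'I_3 -> 'I_3 -> 'I_3 -> 'I_3 -> fsum (path3 * path3).

Fixpoint fbr_path (T : btable) (a b i : 'I_3) (s : path3) : fsum (path3 * path3) :=
  match s with
  | [::] => [::]
  | j :: t => fmap (fun p => (p.1, pmulp p.2 (j :: t))) (T a b i j)
              ++ fmap (fun p => (pmulp [:: i; j] p.1, p.2)) (fbr_path T a b j t)
  end.

Definition fbr (T : btable) (a b : 'I_3) (p : path3) : fsum (path3 * path3) :=
  if p is i :: s then fbr_path T a b i s else [::].

Section Bracket.
Variable br : double_bracket_type A.
Hypothesis brP : is_double_bracket e br.
Variable T : btable.

Lemma fbrE a b : (forall i j, br (u a b) (u i j) *+ 2 = fval pval2 (T a b i j)) ->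
  forall p, br (u a b) (pval p) *+ 2 = fval pval2 (fbr T a b p).
Proof.
have brL := dbr_bilinear brP.
move=> TE [|i s]; first by rewrite /= (lin0 (brL.1 _)) mul0rn /fval big_nil.
rewrite /pval /fbr; elim: s i => [|j s IHs] i.
  by rewrite /= (br_idem_r brP) mul0rn /fval big_nil.
rewrite pathv_cons (dbr_leibniz brP) mulrnDl [fbr_path _ _ _ _ _]/= fval_cat.
have outerMn x t y : outer x t y *+ 2 = outer x (t *+ 2) y :> tensor A A.
  by rewrite !mulr2n (linD (linear_outer (@linear_id k _) _ _)).
rewrite !outerMn IHs TE !fval_map.
rewrite !(lin_fval _ _ (linear_outer (@linear_id k _) _ _)); congr (_ + _);
  apply: eq_fval => t /=; rewrite /pval2 outer_tens ?mul1r ?mulr1 pvalM //.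
Qed.

Lemma tlift_fval (U : lmodType k) (f : A -> A -> U) F : bilinear_map f ->
  tlift f (fval pval2 F) = fval (fun t => f (pval t.1) (pval t.2)) F.
Proof.
move=> fL; rewrite (lin_fval _ _ (tlift_linear fL)).
by apply: eq_fval => t /=; rewrite tlift_tens.
Qed.

(** Two brackets are nested in each summand and T doubles both of them, so
    this is four times the triple bracket. *)
Definition ftriple (a b c : 'I_3 * 'I_3) : fsum (path3 * path3 * path3) :=
  fbind (fun p => fmap (fun q => (q.1, q.2, p.2)) (fbr T a.1 a.2 p.1))
    (T b.1 b.2 c.1 c.2)
  ++ fbind (fun p => fmap (fun q => (p.2, q.1, q.2)) (fbr T b.1 b.2 p.1))
    (T c.1 c.2 a.1 a.2)
  ++ fbind (fun p => fmap (fun q => (q.2, p.2, q.1)) (fbr T c.1 c.2 p.1))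
    (T a.1 a.2 b.1 b.2).

Lemma ftripleE a b c :
  (forall x, x \in [:: a; b; c] -> forall i j,
    br (u x.1 x.2) (u i j) *+ 2 = fval pval2 (T x.1 x.2 i j)) ->
  triple_bracket br (u a.1 a.2) (u b.1 b.2) (u c.1 c.2) *+ 4 =
  fval pval3 (ftriple a b c).
Proof.
move=> TE; have brL := dbr_bilinear brP.
have bE x : x \in [:: a; b; c] ->
    forall p, br (u x.1 x.2) (pval p) *+ 2 = fval pval2 (fbr T x.1 x.2 p).
  by move=> xI; apply: fbrE; apply: TE.
have part (h : A -> A -> A -> A -> tensor A (tensor A A)) x y z
   (h' : path3 * path3 -> path3 * path3 -> path3 * path3 * path3) :
   x \in [:: a; b; c] -> y \in [:: a; b; c] ->
   (forall p1 p2, bilinear_map (h p1 p2)) ->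
   bilinear_map (fun p1 p2 => tlift (h p1 p2) (br (u x.1 x.2) p1)) ->
   (forall p q, pval3 (h' p q) = h (pval p.1) (pval p.2) (pval q.1) (pval q.2)) ->
   tlift (fun p1 p2 => tlift (h p1 p2) (br (u x.1 x.2) p1))
     (br (u y.1 y.2) (u z.1 z.2)) *+ 4 =
   fval pval3 (fbind (fun p => fmap (h' p) (fbr T x.1 x.2 p.1)) (T y.1 y.2 z.1 z.2)).
  move=> xI yI hL hL2 h'E; rewrite (mulrnA _ 2 2) -(linMn (tlift_linear hL2)) TE //.
  rewrite (tlift_fval _ hL2) fval_bind fvalMn; apply: eq_bigr => p _.
  rewrite -(linMn (tlift_linear (hL _ _))) bE // (tlift_fval _ (hL _ _)).
  by rewrite -/(fval pval3 _) fval_map; congr (_ *~ _); apply: eq_fval => q /=.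
have mulrn4D (x y z : tensor A (tensor A A)) : (x + y + z) *+ 4 = x *+ 4 + y *+ 4 + z *+ 4.
  by rewrite !mulrnDl.
rewrite tripleE mulrn4D /ftriple !fval_cat [RHS]addrA.
congr (_ + _ + _).
- apply: (part (fun _ p2 q1 q2 => q1 ⊗ (q2 ⊗ p2)) a b c); rewrite ?inE ?eqxx ?orbT //.
  + by move=> *; bilin.
  + exact: (bilin_triple1 brP).
- apply: (part (fun _ p2 q1 q2 => p2 ⊗ (q1 ⊗ q2)) b c a); rewrite ?inE ?eqxx ?orbT //.
  + by move=> *; bilin.
  + exact: (bilin_triple2 brP).
- apply: (part (fun _ p2 q1 q2 => q2 ⊗ (p2 ⊗ q1)) c a b); rewrite ?inE ?eqxx ?orbT //.
  + by move=> *; bilin.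
  + exact: (bilin_triple3 brP).
Qed.

End Bracket.

Definition fqp_rhs (a b c : path3) : fsum (path3 * path3 * path3) :=
  flatten [seq let E := [:: s] in
    [:: (1, (pmulp (pmulp c E) a, pmulp E b, E));
        (-1, (pmulp (pmulp c E) a, E, pmulp b E));
        (-1, (pmulp c E, pmulp (pmulp a E) b, E));
        (1, (pmulp c E, pmulp a E, pmulp b E));
        (-1, (pmulp E a, pmulp E b, pmulp E c));
        (1, (pmulp E a, E, pmulp (pmulp b E) c));
        (1, (E, pmulp (pmulp a E) b, pmulp E c));
        (-1, (E, pmulp a E, pmulp (pmulp b E) c))] | s <- [:: i1; i2; i3]].

Lemma fqp_rhsE a b c : fval pval3 (fqp_rhs a b c) = qp_rhs e (pval a) (pval b) (pval c).
Proof.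
rewrite /qp_rhs sum_ord3 /fqp_rhs [flatten _]/= /fval !big_cons big_nil /= /pval3 /= !pvalM.
by rewrite !mulrN1z addr0 !addrA.
Qed.

(** The right hand side of the moment map condition, up to the factor 1/2. *)
Definition moment_rhs (s : 'I_3) (x a : A) : tensor A A :=
  (a * e s) ⊗ x - e s ⊗ (x * a) + (a * x) ⊗ e s - x ⊗ (e s * a).

Definition fmoment_rhs (s : 'I_3) (F : fsum path3) (a : path3) : fsum (path3 * path3) :=
  fbind (fun p => [:: (1, (pmulp a [:: s], p)); (-1, ([:: s], pmulp p a));
                      (1, (pmulp a p, [:: s])); (-1, (p, pmulp [:: s] a))]) F.

Lemma linear_moment_rhs s a : linear (fun x => moment_rhs s x a).
Proof. by rewrite /moment_rhs; lin. Qed.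

Lemma fmoment_rhsE s F a :
  fval pval2 (fmoment_rhs s F a) = moment_rhs s (fval pval F) (pval a).
Proof.
rewrite fval_bind (lin_fval _ _ (linear_moment_rhs s (pval a))).
apply: eq_fval => p /=; rewrite /fval !big_cons big_nil /pval2 /= !pvalM !mulrN1z addr0.
by rewrite /moment_rhs !addrA.
Qed.

Lemma feq2 F G : fvanish null2 (F ++ fscale (-1) G) -> fval pval2 F = fval pval2 G.
Proof.
move=> /(fvanishP pval2_null) /eqP.
by rewrite fval_cat fval_scale mulrN1z subr_eq0 => /eqP.
Qed.

Lemma feq3 F G : fvanish null3 (F ++ fscale (-1) G) -> fval pval3 F = fval pval3 G.
Proof.
move=> /(fvanishP pval3_null) /eqP.
by rewrite fval_cat fval_scale mulrN1z subr_eq0 => /eqP.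
Qed.

End Paths.

(** * The Gauss decomposition *)

Local Notation hd := Defs.head.
Local Notation tl := Defs.tail.

(** Both the v_ij and the w_ij are such a family f, which treats the
    unipotent factors on the two sides of the Gauss relation at once. *)
Section ArrowFamily.
Variables (A : pzRingType) (e : 'I_3 -> A) (f : arrow -> A).
Hypothesis e_idem : forall i j, e i * e j = if i == j then e i else 0.
Hypothesis f_peirce : forall a, f a = e (hd a) * f a * e (tl a).

Lemma idem_arrow i a : e i * f a = if i == hd a then f a else 0.
Proof.
rewrite f_peirce !mulrA e_idem; case: eqP => [->|_]; last by rewrite !mul0r.
by rewrite -f_peirce.
Qed.

Lemma arrow_idem a i : f a * e i = if tl a == i then f a else 0.
Proof.
rewrite f_peirce -!mulrA e_idem; case: eqP => _; last by rewrite !mulr0.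
by rewrite !mulrA -f_peirce.
Qed.

Lemma arrow_mul0 a b : tl a != hd b -> f a * f b = 0.
Proof.
move=> /negPf ab; rewrite (f_peirce a) (f_peirce b) -!mulrA.
by rewrite [e (tl a) * _]mulrA e_idem ab mul0r !mulr0.
Qed.

Definition arrow_mulE :=
  (@arrow_mul0 a12 a12 isT, @arrow_mul0 a12 a13 isT, @arrow_mul0 a12 a31 isT,
   @arrow_mul0 a12 a32 isT, @arrow_mul0 a13 a12 isT, @arrow_mul0 a13 a13 isT,
   @arrow_mul0 a13 a21 isT, @arrow_mul0 a13 a23 isT, @arrow_mul0 a21 a21 isT,
   @arrow_mul0 a21 a23 isT, @arrow_mul0 a21 a31 isT, @arrow_mul0 a21 a32 isT,
   @arrow_mul0 a23 a12 isT, @arrow_mul0 a23 a13 isT, @arrow_mul0 a23 a21 isT,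
   @arrow_mul0 a23 a23 isT, @arrow_mul0 a31 a21 isT, @arrow_mul0 a31 a23 isT,
   @arrow_mul0 a31 a31 isT, @arrow_mul0 a31 a32 isT, @arrow_mul0 a32 a12 isT,
   @arrow_mul0 a32 a13 isT, @arrow_mul0 a32 a31 isT, @arrow_mul0 a32 a32 isT).

Definition upper := 1 + f a12 + f a13 + f a23.
Definition upperV := 1 - f a12 - f a13 - f a23 + f a12 * f a23.
Definition lower := 1 + f a21 + f a31 + f a32.
Definition lowerV := 1 - f a21 - f a31 - f a32 + f a32 * f a21.

(** For nilpotent n of order three, 1 - n + n^2 is the inverse of 1 + n; in the
    two uses below n is the strictly triangular part. *)
Lemma unipotentK (n m : A) : n * n = m -> n * m = 0 -> m * n = 0 ->
  (1 + n) * (1 - n + m) = 1 /\ (1 - n + m) * (1 + n) = 1.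
Proof.
move=> nn nm mn; split.
- by rewrite mulrDl mul1r !mulrDr mulr1 mulrN nn nm addr0 addrACA subrK subrr addr0.
- by rewrite mulrDr mulr1 !mulrDl mul1r mulNr nn mn addr0 addrACA subrK subrr addr0.
Qed.

Let sq := (mulrDl, mulrDr, arrow_mulE, addr0, add0r).

Lemma upperVE :
  upper = 1 + (f a12 + f a13 + f a23) /\
  upperV = 1 - (f a12 + f a13 + f a23) + f a12 * f a23.
Proof. by rewrite /upper /upperV !opprD !addrA. Qed.

Lemma lowerVE :
  lower = 1 + (f a21 + f a31 + f a32) /\
  lowerV = 1 - (f a21 + f a31 + f a32) + f a32 * f a21.
Proof. by rewrite /lower /lowerV !opprD !addrA. Qed.

Lemma upperK : upper * upperV = 1 /\ upperV * upper = 1.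
Proof.
have [-> ->] := upperVE; apply: unipotentK.
- by rewrite !sq.
- by rewrite !mulrDl !mulrA !arrow_mulE !mul0r !addr0.
- by rewrite !mulrDr -!mulrA !arrow_mulE !mulr0 !addr0.
Qed.

Lemma lowerK : lower * lowerV = 1 /\ lowerV * lower = 1.
Proof.
have [-> ->] := lowerVE; apply: unipotentK.
- by rewrite !sq.
- by rewrite !mulrDl !mulrA !arrow_mulE !mul0r !addr0.
- by rewrite !mulrDr -!mulrA !arrow_mulE !mulr0 !addr0.
Qed.

Let rowcol := (mulrDr, mulrDl, mulr1, mul1r, idem_arrow, arrow_idem).

Lemma idem_upper : [/\ e i1 * upper = e i1 + f a12 + f a13,
  e i2 * upper = e i2 + f a23 & e i3 * upper = e i3].
Proof. by split; rewrite /upper !rowcol /= ?addr0 ?add0r. Qed.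

Lemma upper_idem : [/\ upper * e i1 = e i1, upper * e i2 = e i2 + f a12
  & upper * e i3 = e i3 + f a13 + f a23].
Proof. by split; rewrite /upper !rowcol /= ?addr0 ?add0r. Qed.

Lemma idem_lower : [/\ e i1 * lower = e i1, e i2 * lower = e i2 + f a21
  & e i3 * lower = e i3 + f a31 + f a32].
Proof. by split; rewrite /lower !rowcol /= ?addr0 ?add0r. Qed.

Lemma lower_idem : [/\ lower * e i1 = e i1 + f a21 + f a31,
  lower * e i2 = e i2 + f a32 & lower * e i3 = e i3].
Proof. by split; rewrite /lower !rowcol /= ?addr0 ?add0r. Qed.

End ArrowFamily.

Section Presentation.
Variable k : fieldType.
Local Notation A := (boalch k).
Local Notation e := (be k).
Local Notation v := (bv k).
Local Notation w := (bw k).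
Local Notation g := (bgamma k).
Local Notation g' := (bgamma_inv k).

Let rel s t (st : boalch_rel s t) : pclass (@boalch_rel k) s = pclass _ t :=
  (pclassP _ s t).2 (pres_rel st).

Lemma be_one : 1 = e i1 + e i2 + e i3 :> A.
Proof. by have := rel (boalch_one k); rewrite !pclassD. Qed.

Lemma be_idem i j : e i * e j = if i == j then e i else 0.
Proof.
have := rel (boalch_idem k i j); rewrite pclassM => ->.
by case: eqP => // _; rewrite pclass_const scale0r.
Qed.

Lemma bv_peirce a : v a = e (hd a) * v a * e (tl a).
Proof. by have := rel (boalch_v k a); rewrite !pclassM. Qed.

Lemma bw_peirce a : w a = e (hd a) * w a * e (tl a).
Proof. by have := rel (boalch_w k a); rewrite !pclassM. Qed.

Lemma bgamma_peirce i : g i = e i * g i * e i.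
Proof. by have := rel (boalch_g k i); rewrite !pclassM. Qed.

Lemma bgamma_inv_peirce i : g' i = e i * g' i * e i.
Proof. by have := rel (boalch_g' k i); rewrite !pclassM. Qed.

Lemma bgammaV i : g i * g' i = e i.
Proof. by have := rel (boalch_gg' k i); rewrite !pclassM. Qed.

Lemma bgammaVl i : g' i * g i = e i.
Proof. by have := rel (boalch_g'g k i); rewrite !pclassM. Qed.

Lemma boalch_gaussE : lower v * upper v = upper w * boalch_moment k * lower w.
Proof. by have := rel (boalch_gauss k); rewrite !(pclassM, pclassD). Qed.

Let eE := be_idem.
Let vP := bv_peirce.
Let wP := bw_peirce.
Let G := boalch_moment k.
Let G' : A := g' i1 + g' i2 + g' i3.

Lemma idem_bgamma i j : e i * g j = if i == j then g i else 0.
Proof.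
rewrite bgamma_peirce !mulrA eE; case: eqP => [->|_]; last by rewrite !mul0r.
by rewrite -bgamma_peirce.
Qed.

Lemma bgamma_idem i j : g i * e j = if i == j then g i else 0.
Proof.
rewrite {1}bgamma_peirce -!mulrA eE; case: eqP => [->|_]; last by rewrite !mulr0.
by rewrite mulrA -bgamma_peirce.
Qed.

Lemma idem_bgammaV i j : e i * g' j = if i == j then g' i else 0.
Proof.
rewrite bgamma_inv_peirce !mulrA eE; case: eqP => [->|_]; last by rewrite !mul0r.
by rewrite -bgamma_inv_peirce.
Qed.

Lemma bgammaV_idem i j : g' i * e j = if i == j then g' i else 0.
Proof.
rewrite {1}bgamma_inv_peirce -!mulrA eE; case: eqP => [->|_]; last by rewrite !mulr0.
by rewrite mulrA -bgamma_inv_peirce.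
Qed.

Lemma idem_moment i : e i * G = g i.
Proof.
rewrite /G /boalch_moment !mulrDr !idem_bgamma.
by elim/ord3_ind: i; rewrite /= ?add0r ?addr0.
Qed.

Lemma moment_idem i : G * e i = g i.
Proof.
rewrite /G /boalch_moment !mulrDl !bgamma_idem.
by elim/ord3_ind: i; rewrite /= ?add0r ?addr0.
Qed.

Lemma idem_momentV i : e i * G' = g' i.
Proof.
rewrite /G' !mulrDr !idem_bgammaV.
by elim/ord3_ind: i; rewrite /= ?add0r ?addr0.
Qed.

Lemma momentV_idem i : G' * e i = g' i.
Proof.
rewrite /G' !mulrDl !bgammaV_idem.
by elim/ord3_ind: i; rewrite /= ?add0r ?addr0.
Qed.

Lemma momentK : G * G' = 1 /\ G' * G = 1.
Proof.
have gK i : G * g' i = e i.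
  have -> : g' i = e i * g' i by rewrite idem_bgammaV eqxx.
  by rewrite mulrA moment_idem bgammaV.
have Kg i : g' i * G = e i.
  have -> : g' i = g' i * e i by rewrite bgammaV_idem eqxx.
  by rewrite -mulrA idem_moment bgammaVl.
split; rewrite be_one /G'; first by rewrite !mulrDr !gK.
by rewrite 2!mulrDl !Kg.
Qed.

(** For i = 3 or j = 3 one of the unipotent factors on the right contributes
    e_3 only. The nine entries thus determine, successively from the lower
    right corner to the upper left one, the gamma_i and the w_ij. *)
Lemma boalch_entry i j :
  (e i * lower v) * (upper v * e j) = (e i * upper w) * G * (lower w * e j).
Proof. by rewrite !mulrA -(mulrA (e i)) boalch_gaussE !mulrA. Qed.

Let Kv := (mulrDl, mulrDr, eE, idem_arrow eE vP, arrow_idem eE vP, arrow_mulE eE vP,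
  addr0, add0r).

Lemma gamma3E : g i3 = e i3 + v a31 * v a13 + v a32 * v a23.
Proof.
have := boalch_entry i3 i3.
have [_ _ ->] := idem_lower eE vP; have [_ _ ->] := upper_idem eE vP.
have [_ _ ->] := idem_upper eE wP; have [_ _ ->] := lower_idem eE wP.
rewrite idem_moment bgamma_idem eqxx => <-.
by rewrite !Kv /= ?addr0 ?add0r.
Qed.

Lemma w23_gamma3 : w a23 * g i3 = v a21 * v a13 + v a23.
Proof.
have := boalch_entry i2 i3.
have [_ -> _] := idem_lower eE vP; have [_ _ ->] := upper_idem eE vP.
have [_ -> _] := idem_upper eE wP; have [_ _ ->] := lower_idem eE wP.
rewrite -mulrA moment_idem [(_ + w a23) * _]mulrDl idem_bgamma add0r => <-.
by rewrite !Kv /= ?addr0 ?add0r addrC.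
Qed.

Lemma w13_gamma3 : w a13 * g i3 = v a13.
Proof.
have := boalch_entry i1 i3.
have [-> _ _] := idem_lower eE vP; have [_ _ ->] := upper_idem eE vP.
have [-> _ _] := idem_upper eE wP; have [_ _ ->] := lower_idem eE wP.
rewrite -mulrA moment_idem [(_ + w a13) * _]mulrDl [(_ + w a12) * _]mulrDl.
rewrite idem_bgamma add0r.
have -> : w a12 * g i3 = 0.
  by rewrite -[g i3](idem_bgamma i3 i3) mulrA (arrow_idem eE wP) mul0r.
by rewrite add0r => <-; rewrite !Kv /= ?addr0 ?add0r.
Qed.

Lemma gamma3_w32 : g i3 * w a32 = v a31 * v a12 + v a32.
Proof.
have := boalch_entry i3 i2.
have [_ _ ->] := idem_lower eE vP; have [_ -> _] := upper_idem eE vP.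
have [_ _ ->] := idem_upper eE wP; have [_ -> _] := lower_idem eE wP.
rewrite idem_moment [g i3 * _]mulrDr bgamma_idem add0r => <-.
by rewrite !Kv /= ?addr0 ?add0r addrC.
Qed.

Lemma gamma3_w31 : g i3 * w a31 = v a31.
Proof.
have := boalch_entry i3 i1.
have [_ _ ->] := idem_lower eE vP; have [-> _ _] := upper_idem eE vP.
have [_ _ ->] := idem_upper eE wP; have [-> _ _] := lower_idem eE wP.
rewrite idem_moment [g i3 * _]mulrDr [g i3 * (_ + w a21)]mulrDr bgamma_idem add0r.
have -> : g i3 * w a21 = 0.
  by rewrite -[g i3](bgamma_idem i3 i3) -mulrA (idem_arrow eE wP) mulr0.
by rewrite add0r => <-; rewrite !Kv /= ?addr0 ?add0r.
Qed.

Lemma gamma2E : g i2 = e i2 + v a21 * v a12 - w a23 * (v a31 * v a12 + v a32).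
Proof.
rewrite -gamma3_w32.
have := boalch_entry i2 i2.
have [_ -> _] := idem_lower eE vP; have [_ -> _] := upper_idem eE vP.
have [_ -> _] := idem_upper eE wP; have [_ -> _] := lower_idem eE wP.
rewrite [(_ + w a23) * G]mulrDl idem_moment.
have -> : w a23 * G = w a23 * g i3.
  by rewrite -{1}[w a23](arrow_idem eE wP a23 i3) -mulrA idem_moment.
set X := (X in X = _); rewrite mulrDr !mulrDl -!mulrA.
have -> : g i3 * e i2 = 0 by rewrite bgamma_idem.
have -> : g i2 * w a32 = 0.
  by rewrite -[g i2](bgamma_idem i2 i2) -mulrA (idem_arrow eE wP) mulr0.
rewrite bgamma_idem eqxx mulr0 add0r addr0 => E.
apply/eqP; rewrite eq_sym subr_eq -E eq_sym; apply/eqP.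
by rewrite /X !Kv /= ?addr0 ?add0r.
Qed.

Lemma w12_gamma2 : w a12 * g i2 = v a12 - w a13 * (v a31 * v a12 + v a32).
Proof.
rewrite -gamma3_w32.
have := boalch_entry i1 i2.
have [-> _ _] := idem_lower eE vP; have [_ -> _] := upper_idem eE vP.
have [-> _ _] := idem_upper eE wP; have [_ -> _] := lower_idem eE wP.
rewrite [(_ + w a13) * G]mulrDl [(_ + w a12) * G]mulrDl idem_moment.
have -> : w a13 * G = w a13 * g i3.
  by rewrite -{1}[w a13](arrow_idem eE wP a13 i3) -mulrA idem_moment.
have -> : w a12 * G = w a12 * g i2.
  by rewrite -{1}[w a12](arrow_idem eE wP a12 i2) -mulrA idem_moment.
set X := (X in X = _); rewrite mulrDr !mulrDl -!mulrA.
have -> : g i3 * e i2 = 0 by rewrite bgamma_idem.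
have -> : g i1 * e i2 = 0 by rewrite bgamma_idem.
have -> : g i2 * w a32 = 0.
  by rewrite -[g i2](bgamma_idem i2 i2) -mulrA (idem_arrow eE wP) mulr0.
have -> : g i1 * w a32 = 0.
  by rewrite -[g i1](bgamma_idem i1 i1) -mulrA (idem_arrow eE wP) mulr0.
rewrite bgamma_idem eqxx !mulr0 !add0r !addr0 => E.
apply/eqP; rewrite eq_sym subr_eq -E eq_sym; apply/eqP.
by rewrite /X !Kv /= ?addr0 ?add0r.
Qed.

Lemma gamma2_w21 : g i2 * w a21 = v a21 - w a23 * v a31.
Proof.
rewrite -gamma3_w31.
have := boalch_entry i2 i1.
have [_ -> _] := idem_lower eE vP; have [-> _ _] := upper_idem eE vP.
have [_ -> _] := idem_upper eE wP; have [-> _ _] := lower_idem eE wP.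
rewrite [(_ + w a23) * G]mulrDl idem_moment.
have -> : w a23 * G = w a23 * g i3.
  by rewrite -{1}[w a23](arrow_idem eE wP a23 i3) -mulrA idem_moment.
set X := (X in X = _); rewrite !mulrDr !mulrDl -!mulrA.
have -> : g i3 * e i1 = 0 by rewrite bgamma_idem.
have -> : g i2 * e i1 = 0 by rewrite bgamma_idem.
have -> : g i2 * w a31 = 0.
  by rewrite -[g i2](bgamma_idem i2 i2) -mulrA (idem_arrow eE wP) mulr0.
have -> : g i3 * w a21 = 0.
  by rewrite -[g i3](bgamma_idem i3 i3) -mulrA (idem_arrow eE wP) mulr0.
rewrite !mulr0 !add0r !addr0 => E.
apply/eqP; rewrite eq_sym subr_eq -E eq_sym; apply/eqP.
by rewrite /X !Kv /= ?addr0 ?add0r.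
Qed.

(** The (1,1) entry of the inverted Gauss relation: the inverse of the diagonal
    factor is a product in which the outer unipotent factors contribute e_1,
    and the inner one is the inverse of the side of the v_ij. *)
Lemma gamma1VE :
  g' i1 = e i1 + v a12 * v a21 + (v a12 * v a23 - v a13) * (v a32 * v a21 - v a31).
Proof.
have [LK KL] := lowerK eE vP; have [UK KU] := upperK eE vP.
have [_ wKU] := upperK eE wP; have [_ KG] := momentK.
(* From lower v * upper v = upper w * G * lower w. *)
have GE : G' = lower w * (upperV v * lowerV v) * upper w.
  have E : G * (lower w * (upperV v * lowerV v)) = upperV w.
    rewrite -[LHS]mul1r -wKU -mulrA -[RHS]mulr1; congr (_ * _).
    rewrite !mulrA -boalch_gaussE -(mulrA (lower v)) UK.
    by rewrite mulr1 LK.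
  have GZ : G * (lower w * (upperV v * lowerV v) * upper w) = 1.
    by rewrite mulrA E wKU.
  by rewrite -[LHS]mulr1 -GZ mulrA KG mul1r.
have -> : g' i1 = (e i1 * upperV v) * (lowerV v * e i1).
  have [uw _ _] := upper_idem eE wP; have [lw _ _] := idem_lower eE wP.
  have -> : g' i1 = e i1 * G' * e i1 by rewrite idem_momentV bgammaV_idem.
  by rewrite GE !mulrA lw -[_ * upper w * _]mulrA uw.
set X := v a12 * v a23 - v a13; set Y := v a32 * v a21 - v a31.
have [v1 v2] : e i1 * upperV v = e i1 + - v a12 + X /\
               lowerV v * e i1 = e i1 + - v a21 + Y.
  rewrite /upperV /lowerV !mulrDr !mulrDl mulr1 mul1r !mulrN !mulNr -mulrA !mulrA.
  rewrite !(idem_arrow eE vP, arrow_idem eE vP) /= !subr0 -(mulrA (v a32)).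
  rewrite (arrow_idem eE vP) /= /X /Y.
  by split; rewrite -!addrA; congr (_ + _); congr (_ + _); rewrite addrC.
have eY : e i1 * Y = 0.
  by rewrite mulrDr mulrA mulrN !(idem_arrow eE vP) /= mul0r subr0.
have Xe : X * e i1 = 0.
  by rewrite mulrDl -mulrA mulNr !(arrow_idem eE vP) /= mulr0 subr0.
have vY : v a12 * Y = 0 by rewrite mulrDr mulrA mulrN !(arrow_mulE eE vP) mul0r subr0.
have Xv : X * v a21 = 0.
  by rewrite mulrDl -mulrA mulNr !(arrow_mulE eE vP) mulr0 subr0.
move: X Y v1 v2 eY Xe vY Xv => X Y -> -> eY Xe vY Xv.
rewrite !mulrDl !mulrDr !mulrN !mulNr eY Xe vY Xv.
by rewrite eE (idem_arrow eE vP) (arrow_idem eE vP) /= !(oppr0, addr0, add0r) opprK.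
Qed.

Ltac closure D M N := repeat first [apply: (D) | apply: (M) | apply: (N)].

(** The factors of the Gauss decomposition are obtained one after the other:
    gamma_3 is a polynomial in the v_ij, its inverse yields w_23, w_13, w_32
    and w_31, these yield gamma_2, its inverse yields w_12 and w_21, and
    gamma_1^-1 is again a polynomial in the v_ij. *)
Lemma boalch_generation (S : A -> Prop) :
  (forall c : k, S (c *: 1)) -> (forall x y, S x -> S y -> S (x + y)) ->
  (forall x y, S x -> S y -> S (x * y)) ->
  (forall i x y, S (e i) -> S x -> x * y = e i -> y * x = e i ->
     y * e i = y -> S y) ->
  (forall i, S (e i)) -> (forall a, S (v a)) -> forall x, S x.
Proof.
move=> Sc SD SM SV Se Sv.
have SN x : S x -> S (- x) by move=> Sx; rewrite -scaleN1r -[x]mul1r scalerAl; apply: (SM).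
have S3 : S (g i3) by rewrite gamma3E; closure SD SM SN.
have SgV i : S (g i) -> S (g' i).
  move=> Sg; apply: (SV i (g i)) => //; rewrite ?bgammaV ?bgammaVl //.
  by rewrite bgammaV_idem eqxx.
have SVg i : S (g' i) -> S (g i).
  move=> Sg; apply: (SV i (g' i)) => //; rewrite ?bgammaV ?bgammaVl //.
  by rewrite bgamma_idem eqxx.
have wr a i : tl a = i -> S (g i) -> S (w a * g i) -> S (w a).
  move=> ai Sg Sw; have -> : w a = (w a * g i) * g' i.
    by rewrite -mulrA bgammaV (arrow_idem eE wP) ai eqxx.
  exact/SM/SgV.
have wl a i : hd a = i -> S (g i) -> S (g i * w a) -> S (w a).
  move=> ai Sg Sw; have -> : w a = g' i * (g i * w a).
    by rewrite mulrA bgammaVl (idem_arrow eE wP) ai eqxx.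
  exact/SM/Sw/SgV.
have S23 : S (w a23) by apply: (wr _ i3) => //; rewrite w23_gamma3; closure SD SM SN.
have S13 : S (w a13) by apply: (wr _ i3) => //; rewrite w13_gamma3.
have S32 : S (w a32) by apply: (wl _ i3) => //; rewrite gamma3_w32; closure SD SM SN.
have S31 : S (w a31) by apply: (wl _ i3) => //; rewrite gamma3_w31.
have S2 : S (g i2) by rewrite gamma2E; closure SD SM SN.
have S12 : S (w a12).
  by apply: (wr _ i2) => //; rewrite w12_gamma2; closure SD SM SN.
have S21 : S (w a21).
  by apply: (wl _ i2) => //; rewrite gamma2_w21; closure SD SM SN.
have S1 : S (g i1).
  by apply: SVg; rewrite gamma1VE; closure SD SM SN.
have Sg i : S (g i) by elim/ord3_ind: i.
elim/pclass_ind; elim=> [x|c|s Ss t St|s Ss t St].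
- case: x => [i|a|a|i|i]; [exact: Se | exact: Sv | by case: a | exact: Sg |].
  exact/SgV/Sg.
- by rewrite pclass_const.
- by rewrite pclassD; apply: (SD).
- by rewrite pclassM; apply: (SM).
Qed.

Section DerivationUniqueness.
Variables (M : lmodType k) (l : A -> M -> M) (r : M -> A -> M).
Hypothesis bimM : is_bimodule (R := @boalch_rel k) l r.
Local Notation derivation := (is_derivation (R := @boalch_rel k) l r).

(** Differentiating x * y = e_i shows that the value at an inverse in a corner
    is determined by the value at the element, so boalch_generation applies to
    the set on which two derivations agree. *)
Lemma boalch_derivation_ext (D D' : A -> M) : derivation D -> derivation D' ->
  (forall i, D (e i) = D' (e i)) -> (forall a, D (v a) = D' (v a)) ->
  forall x, D x = D' x.
Proof.
move=> dD dD' De Dv; have [DL DM] := dD; have [DL' DM'] := dD'.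
apply: boalch_generation => //.
- by move=> c; rewrite (linZ DL) (linZ DL') (derivation1 bimM dD) (derivation1 bimM dD').
- by move=> x y Dx Dy; rewrite (linD DL) (linD DL') Dx Dy.
- by move=> x y Dx Dy; rewrite DM DM' Dx Dy.
move=> i x y Di Dx xy yx yi.
(* The formula for the derivative of the inverse y of x in the corner of e_i. *)
have D1 F : derivation F -> F y = l y (F (e i)) + (r (F (e i)) y - r (l y (F x)) y).
  move=> [FL FM]; rewrite -{1}yi FM; congr (_ + _).
  have -> : r (F (e i)) y = r (l y (F x)) y + r (r (F y) x) y.
    by rewrite -yx FM (linD (bimM.(ract_bilinear).2 y)).
  by rewrite (ractA bimM) xy addrAC subrr add0r.
by rewrite (D1 _ dD) (D1 _ dD') Di Dx.
Qed.
End DerivationUniqueness.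

End Presentation.

(** * Derivations of the Boalch algebra *)

Section DerivationExistence.
Variable k : fieldType.
Local Notation A := (boalch k).
Local Notation e := (be k).
Local Notation v := (bv k).
Local Notation w := (bw k).
Local Notation g := (bgamma k).
Local Notation g' := (bgamma_inv k).
Variables (M : lmodType k) (l : A -> M -> M) (r : M -> A -> M).
Hypothesis bimM : is_bimodule (R := @boalch_rel k) l r.
Local Notation derivation := (is_derivation (R := @boalch_rel k) l r).

Let lDr x n n' : l x (n + n') = l x n + l x n'.
Proof. by rewrite (linD (bimM.(lact_bilinear).1 x)). Qed.
Let rDl x n n' : r (n + n') x = r n x + r n' x.
Proof. by rewrite (linD (bimM.(ract_bilinear).2 x)). Qed.
Let lDl n (x y : A) : l (x + y) n = l x n + l y n.
Proof. by rewrite (linD (bimM.(lact_bilinear).2 n)). Qed.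
Let rDr n (x y : A) : r n (x + y) = r n x + r n y.
Proof. by rewrite (linD (bimM.(ract_bilinear).1 n)). Qed.
Let l0r x : l x 0 = 0. Proof. by rewrite (lin0 (bimM.(lact_bilinear).1 x)). Qed.
Let r0l x : r 0 x = 0. Proof. by rewrite (lin0 (bimM.(ract_bilinear).2 x)). Qed.
Let l0l n : l (0 : A) n = 0. Proof. by rewrite (lin0 (bimM.(lact_bilinear).2 n)). Qed.
Let r0r n : r n (0 : A) = 0. Proof. by rewrite (lin0 (bimM.(ract_bilinear).1 n)). Qed.
Let lN x n : l x (- n) = - l x n. Proof. by rewrite (linN (bimM.(lact_bilinear).1 x)). Qed.
Let rN x n : r (- n) x = - r n x. Proof. by rewrite (linN (bimM.(ract_bilinear).2 x)). Qed.
Let lA x y n : l x (l y n) = l (x * y : A) n. Proof. exact: (lactA bimM). Qed.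
Let rA x y n : r (r n x) y = r n (x * y : A). Proof. exact: (ractA bimM). Qed.
Let lrA x y n : r (l x n) y = l x (r n y). Proof. exact: (lractA bimM). Qed.
Let l1 n : l (1 : A) n = n. Proof. exact: (lact1 bimM). Qed.
Let r1 n : r n (1 : A) = n. Proof. exact: (ract1 bimM). Qed.

Definition peirce i j n : M := l (e i) (r n (e j)).

Lemma lact_peirce i j j' n :
  l (e i) (peirce j j' n) = if i == j then peirce j j' n else 0.
Proof. by rewrite /peirce lA be_idem; case: eqP => [->|] //; rewrite l0l. Qed.

Lemma ract_peirce i j j' n :
  r (peirce j j' n) (e i) = if j' == i then peirce j j' n else 0.
Proof.
rewrite /peirce lrA rA be_idem; case: eqP => [->|] //.
by rewrite r0r l0r.
Qed.

Lemma sum_peirce n : n =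
  (peirce i1 i2 n + peirce i1 i3 n + peirce i2 i3 n)
  + (peirce i1 i1 n + peirce i2 i2 n + peirce i3 i3 n)
  + (peirce i2 i1 n + peirce i3 i1 n + peirce i3 i2 n).
Proof.
rewrite /peirce -{1}[n]l1 -{1}[n]r1 be_one !rDr !lDl !lDr.
by rewrite (AC (3*3*3)%AC ((2*3*6)*(1*5*9)*(4*7*8))%AC).
Qed.

Lemma peirce_upper n : l (e i3) n = 0 -> r n (e i1) = 0 -> peirce i2 i2 n = 0 ->
  peirce i1 i2 n + peirce i1 i3 n + peirce i2 i3 n = n.
Proof.
move=> n3 n1 n2; rewrite [RHS]sum_peirce n2 /peirce n1 -!lrA n3 !r0l.
by rewrite !(lrA, n1) !l0r !addr0.
Qed.

Lemma peirce_lower n : l (e i1) n = 0 -> r n (e i3) = 0 -> peirce i2 i2 n = 0 ->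
  peirce i2 i1 n + peirce i3 i1 n + peirce i3 i2 n = n.
Proof.
move=> n3 n1 n2; rewrite [RHS]sum_peirce n2 /peirce n1 -!lrA n3 !r0l.
by rewrite !(lrA, n1) !l0r !addr0 !add0r.
Qed.

Variable m : arrow -> M.

Let G := boalch_moment k.
Let G' : A := g' i1 + g' i2 + g' i3.
Let dv a : M := peirce (hd a) (tl a) (m a).
Let x : M := l (lower v) (dv a12 + dv a13 + dv a23)
           + r (dv a21 + dv a31 + dv a32) (upper v).
Let y : M := l (upperV w) (r x (lowerV w)).
Let yup := peirce i1 i2 y + peirce i1 i3 y + peirce i2 i3 y.
Let ydiag := peirce i1 i1 y + peirce i2 i2 y + peirce i3 i3 y.
Let ylow := peirce i2 i1 y + peirce i3 i1 y + peirce i3 i2 y.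
Let z := l (upper w) (r yup G').
Let z' := l G' (r ylow (lower w)).

(** The product rule applied to the Gauss relation leaves no choice. Divided by
    the unipotent factors on the side of the w_ij it becomes an equation with
    left hand side y, whose strictly upper triangular, diagonal and strictly
    lower triangular parts are the derivatives of the three factors, up to
    translation. *)
Definition derivation_gen (c : boalch_gen) : M :=
  match c with
  | BE _ => 0
  | BV a => peirce (hd a) (tl a) (m a)
  | BW a => peirce (hd a) (tl a)
      (match a with a12 | a13 | a23 => z | a21 | a31 | a32 => z' end)
  | BG i => peirce i i y
  | BGinv i => - l (g' i) (r y (g' i))
  end.

(** Left multiplication by the upper unipotent factor and right multiplication
    by a diagonal element preserve strictly upper triangular elements, so the
    projections in derivation_gen lose nothing; z'E is the lower triangular
    counterpart. *)
Lemma zE : peirce i1 i2 z + peirce i1 i3 z + peirce i2 i3 z = z.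
Proof.
have [_ u2 u3] := idem_upper (@be_idem k) (@bw_peirce k).
have lup i : l (e i) yup = match val i with 0 => peirce i1 i2 y + peirce i1 i3 y
    | 1 => peirce i2 i3 y | _ => 0 end.
  by rewrite /yup !lDr !lact_peirce; elim/ord3_ind: i; rewrite /= ?addr0 ?add0r.
have rup i : r yup (e i) = match val i with 0 => 0
    | 1 => peirce i1 i2 y | _ => peirce i1 i3 y + peirce i2 i3 y end.
  by rewrite /yup !rDl !ract_peirce; elim/ord3_ind: i; rewrite /= ?addr0 ?add0r.
have eG i : G' * e i = e i * G' by rewrite momentV_idem idem_momentV.
apply: peirce_upper; rewrite /z.
- by rewrite lA u3 -lrA lup /= r0l.
- by rewrite lrA rA eG -rA rup /= r0l l0r.
- rewrite /peirce lrA rA lA u2 eG -rA rup /= -lrA lDl lact_peirce /=.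
  rewrite -[w a23](arrow_idem (@be_idem k) (@bw_peirce k) a23 i3) -lA lact_peirce /=.
  by rewrite l0r addr0 r0l.
Qed.

Lemma z'E : peirce i2 i1 z' + peirce i3 i1 z' + peirce i3 i2 z' = z'.
Proof.
have [_ u2 u3] := lower_idem (@be_idem k) (@bw_peirce k).
have llow i : l (e i) ylow = match val i with 0 => 0
    | 1 => peirce i2 i1 y | _ => peirce i3 i1 y + peirce i3 i2 y end.
  by rewrite /ylow !lDr !lact_peirce; elim/ord3_ind: i; rewrite /= ?addr0 ?add0r.
have rlow i : r ylow (e i) = match val i with 0 => peirce i2 i1 y + peirce i3 i1 y
    | 1 => peirce i3 i2 y | _ => 0 end.
  by rewrite /ylow !rDl !ract_peirce; elim/ord3_ind: i; rewrite /= ?addr0 ?add0r.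
have eG i : G' * e i = e i * G' by rewrite momentV_idem idem_momentV.
apply: peirce_lower; rewrite /z'.
- by rewrite lA -eG -lA -lrA llow /= r0l l0r.
- by rewrite lrA rA u3 rlow /= l0r.
- rewrite /peirce lrA rA lA u2 -eG -lA -lrA llow /= rDr ract_peirce /=.
  rewrite -[w a32](idem_arrow (@be_idem k) (@bw_peirce k) i3 a32) -rA ract_peirce /=.
  by rewrite r0l addr0 l0r.
Qed.

Lemma derivation_gauss :
  l (lower v) (dv a12 + dv a13 + dv a23) + r (dv a21 + dv a31 + dv a32) (upper v)
  = l (upper w * G) z' + r (l (upper w) ydiag + r z G) (lower w).
Proof.
have [uVK _] := upperK (@be_idem k) (@bw_peirce k).
have [_ lKV] := lowerK (@be_idem k) (@bw_peirce k).
have [GK KG] := momentK k.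
have -> : l (upper w * G) z' = l (upper w) (r ylow (lower w)).
  by rewrite /z' -lA; congr (l _ _); rewrite lA GK l1.
have -> : r z G = l (upper w) yup.
  by rewrite /z lrA rA KG r1.
rewrite -lDr lrA -lDr -rDl [ylow + _]addrC [ydiag + _]addrC -sum_peirce.
by rewrite /y lrA rA lKV r1 lA uVK l1.
Qed.

Lemma derivation_rel s t : boalch_rel s t ->
  bder_term (R := @boalch_rel k) l r derivation_gen s =
  bder_term (R := @boalch_rel k) l r derivation_gen t.
Proof.
have eE i : pclass (@boalch_rel k) (Gen (BE i)) = e i by [].
have gE i : pclass (@boalch_rel k) (Gen (BG i)) = g i by [].
have gVE i : pclass (@boalch_rel k) (Gen (BGinv i)) = g' i by [].
case=> /=.
- by rewrite !addr0.
- move=> i j; rewrite l0r r0l addr0; by case: eqP.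
- move=> a; rewrite l0r r0l add0r addr0 !eE lact_peirce eqxx ract_peirce.
  by rewrite eqxx.
- move=> a; rewrite l0r r0l add0r addr0 !eE lact_peirce eqxx ract_peirce.
  by rewrite eqxx.
- move=> i; rewrite l0r r0l add0r addr0 !eE lact_peirce eqxx ract_peirce.
  by rewrite eqxx.
- move=> i; rewrite l0r r0l add0r addr0 !eE lN rN (lrA (e i)) (lrA (g' i)) (lA (e i)).
  by rewrite (rA (g' i)) idem_bgammaV bgammaV_idem eqxx.
- move=> i; rewrite gE gVE lN (lA (g i)) bgammaV /peirce lrA (rA (e i)).
  rewrite idem_bgammaV eqxx.
  by rewrite addNr.
- move=> i; rewrite gE gVE rN lrA (rA (g' i)) bgammaVl /peirce (lA (g' i)).
  rewrite bgammaV_idem eqxx.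
  by rewrite subrr.
- rewrite !add0r !pclassM !pclassD.
  rewrite -[RHS]/(l (upper w * G) (peirce i2 i1 z' + peirce i3 i1 z' + peirce i3 i2 z')
    + r (l (upper w) ydiag + r (peirce i1 i2 z + peirce i1 i3 z + peirce i2 i3 z) G)
      (lower w)).
  by rewrite z'E zE -derivation_gauss.
Qed.

(** Only the component of m a in the corner of the arrow a matters, as a value
    on v_a has to lie in it. *)
Definition boalch_der : A -> M := bder (R := @boalch_rel k) l r derivation_gen.

Lemma boalch_der_derivation : derivation boalch_der.
Proof. exact: (bder_derivation bimM (@derivation_rel)). Qed.

Lemma boalch_der_idem i : boalch_der (e i) = 0.
Proof. exact: (bder_pclass bimM (@derivation_rel)). Qed.

Lemma boalch_der_arrow a : boalch_der (v a) = peirce (hd a) (tl a) (m a).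
Proof. exact: (bder_pclass bimM (@derivation_rel)). Qed.

End DerivationExistence.

(** * The double bracket of the triangle *)

Definition arrow_of (i j : 'I_3) : option arrow :=
  match val i, val j with
  | 0, 1 => Some a12 | 1, 0 => Some a21 | 0, 2 => Some a13
  | 2, 0 => Some a31 | 1, 2 => Some a23 | 2, 1 => Some a32
  | _, _ => None
  end.

(** Twice the values that define the double bracket: the doubling clears the
    denominators. *)
Definition half_table (a b : arrow) : fsum (path3 * path3) :=
  match a, b with
  | a12, a13 => [:: (1, ([:: i1; i2], [:: i1; i3]))]
  | a12, a32 => [:: (1, ([:: i3; i2], [:: i1; i2]))]
  | a21, a31 => [:: (-1, ([:: i3; i1], [:: i2; i1]))]
  | a21, a23 => [:: (-1, ([:: i2; i1], [:: i2; i3]))]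
  | a13, a23 => [:: (1, ([:: i2; i3], [:: i1; i3]))]
  | a13, a32 => [:: (-1, ([:: i3], [:: i1; i3; i2]))]
  | a31, a23 => [:: (1, ([:: i2; i3; i1], [:: i3]))]
  | a31, a32 => [:: (-1, ([:: i3; i1], [:: i3; i2]))]
  | a12, a21 => [:: (-2, ([:: i2], [:: i1])); (-1, ([:: i2], [:: i1; i2; i1]));
                    (-1, ([:: i2; i1; i2], [:: i1]))]
  | a12, a31 => [:: (-1, ([:: i3; i1; i2], [:: i1])); (-2, ([:: i3; i2], [:: i1]))]
  | a12, a23 => [:: (-1, ([:: i2], [:: i1; i2; i3])); (2, ([:: i2], [:: i1; i3]))]
  | a21, a13 => [:: (1, ([:: i1], [:: i2; i1; i3])); (2, ([:: i1], [:: i2; i3]))]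
  | a21, a32 => [:: (1, ([:: i3; i2; i1], [:: i2])); (-2, ([:: i3; i1], [:: i2]))]
  | a13, a31 => [:: (-2, ([:: i3], [:: i1])); (-2, ([:: i3; i2; i3], [:: i1]));
                    (-1, ([:: i3], [:: i1; i3; i1])); (-1, ([:: i3; i1; i3], [:: i1]))]
  | a23, a32 => [:: (-2, ([:: i3], [:: i2])); (-1, ([:: i3], [:: i2; i3; i2]));
                    (-1, ([:: i3; i2; i3], [:: i2]))]
  | _, _ => [::]
  end.

(** For each pair of arrows at most one of the two terms is non-zero. *)
Definition arrow_table (a b : arrow) : fsum (path3 * path3) :=
  half_table a b ++ fscale (-1) (fflip (half_table b a)).

Section Boalch.
Variable k : fieldType.
Hypothesis two_neq0 : 2%:R != 0 :> k.
Local Notation A := (boalch k).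
Local Notation A2 := (tensor A A).
Local Notation e := (be k).
Local Notation v := (bv k).
Local Notation g' := (bgamma_inv k).
Let half : k := 2%:R^-1.

(** With the loop, the vertex sequence 3, 3 stands for the inverse of gamma_3,
    so that gamma_2, which is not a polynomial in the arrows, becomes a sum of
    paths. *)
Definition edge (loop : bool) (i j : 'I_3) : A :=
  if arrow_of i j is Some a then v a
  else if [&& loop, i == i3 & j == i3] then g' i3 else 0.

Lemma edge_head loop i j : e i * edge loop i j = edge loop i j.
Proof.
case: loop; elim/ord3_ind: i; elim/ord3_ind: j; rewrite /edge /= ?mulr0 //;
  by rewrite ?(idem_arrow (@be_idem k) (@bv_peirce k)) ?idem_bgammaV.
Qed.

Lemma edge_tail loop i j : edge loop i j * e j = edge loop i j.
Proof.
case: loop; elim/ord3_ind: i; elim/ord3_ind: j; rewrite /edge /= ?mul0r //;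
  by rewrite ?(arrow_idem (@be_idem k) (@bv_peirce k)) ?bgammaV_idem.
Qed.

Lemma edge_arrow loop a : edge loop (hd a) (tl a) = v a.
Proof. by case: a. Qed.

Local Notation bval := (pval e (edge false)).
Local Notation bval2 := (pval2 e (edge false)).

Lemma half2 (V : lmodType k) (x : V) : (half *: x) *+ 2 = x.
Proof. by rewrite -scaler_nat scalerA mulfV ?scale1r. Qed.

Lemma mulrn2_inj (V : lmodType k) (x y : V) : x *+ 2 = y *+ 2 -> x = y.
Proof.
by move=> /(congr1 (fun z => half *: z)); rewrite -!scaler_nat !scalerA mulVf ?scale1r.
Qed.

Definition arrow_bracket (a b : arrow) : A2 :=
  half *: fval bval2 (arrow_table a b).

Lemma arrow_bracket2 a b : arrow_bracket a b *+ 2 = fval bval2 (arrow_table a b).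
Proof. exact: half2. Qed.

Lemma arrow_bracketC a b : arrow_bracket a b = - flip (arrow_bracket b a).
Proof.
have fL := linear_flip (@linear_id k A2).
apply: mulrn2_inj; rewrite mulNrn -(linMn fL) !arrow_bracket2 /arrow_table.
rewrite !fval_cat !fval_scale !fflipE !mulrN1z (linB fL) flipK opprB.
by rewrite addrC.
Qed.

Let halfN2 (x : A2) : half *: (x *~ (-2)) = - x.
Proof. by rewrite [x *~ _]mulrNz scalerN -pmulrn -scalerMnr half2. Qed.

Let half_2 (x : A2) : half *: (x *~ 2) = x.
Proof. by rewrite -pmulrn -scalerMnr half2. Qed.

Let halfN1 (x : A2) : half *: (x *~ (-1)) = - (half *: x).
Proof. by rewrite mulrN1z scalerN. Qed.

Let half_cons (x y : A2) c : half *: (x *~ c + y) = half *: (x *~ c) + half *: y.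
Proof. exact: scalerDr. Qed.

Ltac eval_arrow_bracket :=
  rewrite /arrow_bracket /fval /arrow_table /= !big_cons big_nil /= /pval2 /= /edge /=
    !addr0 ?half_cons ?halfN2 ?half_2 ?halfN1 ?mulr1z -?/half ?scalerDr ?opprD ?addrA //.

Lemma arrow_bracket_diag a : arrow_bracket a a = 0.
Proof.
apply: mulrn2_inj; rewrite arrow_bracket2 mul0rn.
by case: a; rewrite /fval /= ?big_nil.
Qed.

Lemma triangle_bracketP br : is_triangle_bracket br <->
  is_double_bracket e br /\ forall a b, br (v a) (v b) = arrow_bracket a b.
Proof.
split=> [[brP same h1 h2 h3 h4 h5 h6 h7 h8 h9 h10 h11 h12 h13 h14 h15]|[brP brE]].
  split=> // a b.
  have listed c d : half_table c d != [::] -> br (v c) (v d) = arrow_bracket c d.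
    case: c; case: d => // _; rewrite ?h1 ?h2 ?h3 ?h4 ?h5 ?h6 ?h7 ?h8 ?h9 ?h10 ?h11
     ?h12 ?h13 ?h14 ?h15; eval_arrow_bracket.
  have [/listed //|ab] := boolP (half_table a b != [::]).
  have [/listed ba|ba] := boolP (half_table b a != [::]).
    by rewrite (dbr_antisym brP) ba -arrow_bracketC.
  suff -> : a = b by rewrite same arrow_bracket_diag.
  by move: ab ba; case: a; case: b.
split=> //; first by move=> a; rewrite brE arrow_bracket_diag.
all: by rewrite brE; eval_arrow_bracket.
Qed.

Lemma outer_bimodule : is_bimodule (R := @boalch_rel k)
  (fun (x : A) (t : A2) => outer x t 1) (fun t (y : A) => outer 1 t y).
Proof.
split=> [||t|t|x y t|x y t|x y t]; rewrite ?outer1 ?outer_outer ?mulr1 ?mul1r //.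
- by split=> *; [apply: linear_outer | apply: linear_outer_l]; lin.
- by split=> *; [apply: linear_outer_r | apply: linear_outer]; lin.
Qed.

Lemma inner_bimodule : is_bimodule (R := @boalch_rel k)
  (fun (x : A) (t : A2) => inner x t 1) (fun t (y : A) => inner 1 t y).
Proof.
split=> [||t|t|x y t|x y t|x y t]; rewrite ?inner1 ?inner_inner ?mulr1 ?mul1r //.
- by split=> *; [apply: linear_inner | apply: linear_inner_l]; lin.
- by split=> *; [apply: linear_inner_r | apply: linear_inner]; lin.
Qed.

Lemma outer3_bimodule : is_bimodule (R := @boalch_rel k)
  (fun (x : A) (t : tensor A A2) => outer3 x t 1) (fun t (y : A) => outer3 1 t y).
Proof.
split=> [||t|t|x y t|x y t|x y t]; rewrite ?outer3_1 ?outer3_outer3 ?mulr1 ?mul1r //.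
- by split=> *; [apply: linear_outer3 | apply: linear_outer3_l]; lin.
- by split=> *; [apply: linear_outer3_r | apply: linear_outer3]; lin.
Qed.

Section Uniqueness.
Variables br br' : double_bracket_type A.
Hypotheses (brP : is_double_bracket e br) (brP' : is_double_bracket e br').

(** A double bracket is an outer derivation in its second argument. *)
Lemma bracket_ext_r a : (forall c, br a (v c) = br' a (v c)) ->
  forall b, br a b = br' a b.
Proof.
move=> vE; apply: (boalch_derivation_ext outer_bimodule) => // [||i].
- by split=> [|x y]; [apply: (dbr_bilinear brP).1 | rewrite (dbr_leibniz brP) addrC].
- by split=> [|x y]; [apply: (dbr_bilinear brP').1 | rewrite (dbr_leibniz brP') addrC].
- by rewrite (br_idem_r brP) (br_idem_r brP').
Qed.

(** By antisymmetry the two arguments can be reduced to arrows in turn. *)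
Lemma bracket_ext : (forall c c', br (v c) (v c') = br' (v c) (v c')) -> br = br'.
Proof.
move=> vE; have vE' c b : br (v c) b = br' (v c) b by apply: bracket_ext_r.
apply/funext => a; apply/funext; apply: bracket_ext_r => c.
by rewrite (dbr_antisym brP) (dbr_antisym brP') vE'.
Qed.
End Uniqueness.
Section Existence.

Definition arrow_der (a : arrow) : A -> A2 :=
  boalch_der (fun (x : A) (t : A2) => outer x t 1) (fun t (y : A) => outer 1 t y)
    (arrow_bracket a).

(** The derivation in the first argument, for the inner structure, whose values
    on the arrows are derivations in the second argument, for the outer one. It
    remains a derivation in the second argument for all x because the two
    structures commute. *)
Definition boalch_bracket (x b : A) : A2 :=
  boalch_der (fun (x : A) (t : A2) => inner x t 1) (fun t (y : A) => inner 1 t y)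
    (fun a => arrow_der a b) x.

Local Notation outer_der := (is_derivation (R := @boalch_rel k)
  (fun (x : A) (t : A2) => outer x t 1) (fun t (y : A) => outer 1 t y)).
Local Notation inner_der := (is_derivation (R := @boalch_rel k)
  (fun (x : A) (t : A2) => inner x t 1) (fun t (y : A) => inner 1 t y)).

Lemma arrow_derP a : outer_der (arrow_der a).
Proof. exact: boalch_der_derivation outer_bimodule _. Qed.

Lemma boalch_bracketP b : inner_der (boalch_bracket^~ b).
Proof. exact: boalch_der_derivation inner_bimodule _. Qed.

Lemma boalch_bracket_idem i b : boalch_bracket (e i) b = 0.
Proof. exact: boalch_der_idem inner_bimodule _ _. Qed.

Lemma boalch_bracket_arrow a b :
  boalch_bracket (v a) b = inner (e (hd a)) (arrow_der a b) (e (tl a)).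
Proof.
rewrite [LHS](boalch_der_arrow inner_bimodule) /peirce.
by rewrite inner_inner !mulr1.
Qed.

Lemma linear_boalch_bracket x : linear (boalch_bracket x).
Proof.
move=> c b b'; move: x; apply: (boalch_derivation_ext inner_bimodule) => [||i|a].
- exact: boalch_bracketP.
- exact: (derivation_comb inner_bimodule c (boalch_bracketP b) (boalch_bracketP b')).
- by rewrite !boalch_bracket_idem scaler0 addr0.
rewrite !boalch_bracket_arrow (arrow_derP a).1.
by rewrite (linear_inner (@linear_id k A2)).
Qed.

Lemma boalch_bracket_leibniz x b b' : boalch_bracket x (b * b') =
  outer 1 (boalch_bracket x b) b' + outer b (boalch_bracket x b') 1.
Proof.
have iL y z := linear_inner (@linear_id k A2) y z.
have oL y z := linear_outer (@linear_id k A2) y z.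
move: x; apply: (boalch_derivation_ext inner_bimodule) => [||i|a].
- exact: boalch_bracketP.
- have [DL DM] := boalch_bracketP b; have [DL' DM'] := boalch_bracketP b'.
  split=> [|x y]; first by lin_act; exact: (boalch_bracketP _).1.
  rewrite DM DM' !(linD (iL _ _)) !(linD (oL _ _)) !inner_outer.
  by rewrite addrACA.
- by rewrite !boalch_bracket_idem !(lin0 (oL _ _)) addr0.
rewrite !boalch_bracket_arrow (arrow_derP a).2 -!inner_outer -(linD (iL _ _)).
by rewrite addrC.
Qed.

Lemma boalch_bracket_idem_r x i : boalch_bracket x (e i) = 0.
Proof.
move: x; apply: (boalch_derivation_ext inner_bimodule) => [||j|a].
- exact: boalch_bracketP.
- exact: derivation0 inner_bimodule.
- exact: boalch_bracket_idem.
rewrite boalch_bracket_arrow [arrow_der _ _](boalch_der_idem outer_bimodule).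
by rewrite (lin0 (linear_inner (@linear_id k A2) _ _)).
Qed.

Lemma boalch_bracket_arrows a b : boalch_bracket (v a) (v b) = arrow_bracket a b.
Proof.
have iL y z := linear_inner (@linear_id k A2) y z.
have oL y z := linear_outer (@linear_id k A2) y z.
rewrite boalch_bracket_arrow [arrow_der _ _](boalch_der_arrow outer_bimodule).
rewrite /peirce outer_outer !mulr1 -[inner _ _ _]flipK flip_inner.
apply: mulrn2_inj; have fL := linear_flip (@linear_id k A2).
rewrite -(linMn fL) -(linMn (oL _ _)) -(linMn fL) -(linMn (oL _ _)).
rewrite arrow_bracket2 -[e (hd a)]/(bval [:: hd a]) -[e (tl a)]/(bval [:: tl a]).
rewrite -[e (hd b)]/(bval [:: hd b]) -[e (tl b)]/(bval [:: tl b]).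
rewrite -!(fouterE (@be_idem k) (edge_head false) (edge_tail false), fflipE).
by apply: feq2; case: a; case: b; vm_compute.
Qed.

Lemma outer_der_flip b : outer_der (fun x => - flip (boalch_bracket x b)).
Proof.
have fL := linear_flip (@linear_id k A2).
have [DL DM] := boalch_bracketP b; split=> [|x y].
  by apply: linear_opp; apply: linear_flip.
rewrite DM (linD fL) !flip_inner opprD.
by rewrite !(linN (linear_outer (@linear_id k A2) _ _)).
Qed.

(** Both sides are outer derivations in b, and then, after a flip, in x; on two
    arrows they agree by the choice of arrow_table. *)
Lemma boalch_bracket_antisym x b : boalch_bracket x b = - flip (boalch_bracket b x).
Proof.
have fL := linear_flip (@linear_id k A2).
have Dr x' : outer_der (boalch_bracket x').
  split=> [|y z]; first exact: linear_boalch_bracket.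
  by rewrite boalch_bracket_leibniz addrC.
have vE a y : boalch_bracket (v a) y = - flip (boalch_bracket y (v a)).
  move: y; apply: (boalch_derivation_ext outer_bimodule) => [||i|c].
  - exact: Dr.
  - exact: outer_der_flip.
  - by rewrite boalch_bracket_idem boalch_bracket_idem_r (lin0 fL) oppr0.
  by rewrite !boalch_bracket_arrows arrow_bracketC.
rewrite -[LHS]flipK -[flip (boalch_bracket x b)]opprK (linN fL); congr (- flip _).
move: x; apply: (boalch_derivation_ext outer_bimodule) => [||i|c].
- exact: outer_der_flip.
- exact: Dr.
- by rewrite boalch_bracket_idem boalch_bracket_idem_r (lin0 fL) oppr0.
by rewrite vE (linN fL) opprK flipK.
Qed.

Lemma boalch_bracket_triangle : is_triangle_bracket boalch_bracket.
Proof.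
apply/triangle_bracketP; split; last exact: boalch_bracket_arrows.
split=> [|a b|a b|a b c].
- split=> [x|b]; first exact: linear_boalch_bracket.
  exact: (boalch_bracketP b).1.
- have lr x : linear (boalch_bracket x) by apply: linear_boalch_bracket.
  have ll y : linear (boalch_bracket^~ y) by apply: (boalch_bracketP y).1.
  case=> -[c ->].
    rewrite (lin_sum (ll b)) big1 // => i _.
    by rewrite (linZ (ll b)) boalch_bracket_idem scaler0.
  rewrite (lin_sum (lr a)) big1 // => i _.
  by rewrite (linZ (lr a)) boalch_bracket_idem_r scaler0.
- exact: boalch_bracket_antisym.
- exact: boalch_bracket_leibniz.
Qed.

Lemma triangle_bracket_unique : exists! br, @is_triangle_bracket k br.
Proof.
exists boalch_bracket; split; first exact: boalch_bracket_triangle.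
have [brP brE] := (triangle_bracketP _).1 boalch_bracket_triangle.
move=> br /triangle_bracketP[brP' brE']; apply: bracket_ext => // a b.
by rewrite brE brE'.
Qed.

End Existence.
End Boalch.

(** * The moment map and the quasi-Poisson property *)

(** Twice the bracket of an arrow with gamma_3^-1, as forced by the moment map
    condition for gamma_3 and moment_inverse; the path 3, 3 is the loop. *)
Definition gamma3V_table (a : arrow) : fsum (path3 * path3) :=
  fflip (fmoment_rhs i3 [:: (1, [:: i3; i3])] [:: hd a; tl a]).

Definition edge_table (loop : bool) : btable := fun i j l m =>
  match arrow_of i j, arrow_of l m with
  | Some a, Some b => arrow_table a b
  | Some a, None => if [&& loop, l == i3 & m == i3] then gamma3V_table a else [::]
  | None, _ => [::]
  end.

Definition gamma3_paths : fsum path3 :=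
  [:: (1, [:: i3]); (1, [:: i3; i1; i3]); (1, [:: i3; i2; i3])].

Definition gamma1V_paths : fsum path3 :=
  [:: (1, [:: i1]); (1, [:: i1; i2; i1]); (1, [:: i1; i2; i3; i2; i1]);
      (-1, [:: i1; i2; i3; i1]); (-1, [:: i1; i3; i2; i1]); (1, [:: i1; i3; i1])].

(** The factor w_23 of gamma2E is (v_21 v_13 + v_23) gamma_3^-1; the steps from
    3 to 3 are the loop. *)
Definition gamma2_paths : fsum path3 :=
  [:: (1, [:: i2]); (1, [:: i2; i1; i2]); (-1, [:: i2; i1; i3; i3; i1; i2]);
      (-1, [:: i2; i1; i3; i3; i2]); (-1, [:: i2; i3; i3; i1; i2]);
      (-1, [:: i2; i3; i3; i2])].

(** As gamma_3 = e_3 + v_31 v_13 + v_32 v_23, the relations between gamma_3 and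
    its inverse express gamma_3^-1 v_31 v_13 and v_31 v_13 gamma_3^-1 through
    terms without these products. Only the first redex of a path is rewritten,
    so the function may have to be applied more than once. *)
Fixpoint fred (s : path3) : fsum path3 :=
  match s with
  | [::] => [::]
  | [:: i] => [:: (1, [:: i])]
  | i :: (j :: _) as t =>
      if take 4 s == [:: i3; i3; i1; i3] then
        [:: (1, i3 :: drop 4 s); (-1, i3 :: i3 :: drop 4 s);
            (-1, [:: i3, i3, i2, i3 & drop 4 s])]
      else if take 4 s == [:: i3; i1; i3; i3] then
        [:: (1, i3 :: drop 4 s); (-1, i3 :: i3 :: drop 4 s);
            (-1, [:: i3, i2, i3, i3 & drop 4 s])]
      else fmap (pmulp [:: i; j]) (fred t)
  end.

Definition fred2 (t : path3 * path3) : fsum (path3 * path3) :=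
  fbind (fun p => fmap (pair p) (fred t.2)) (fred t.1).

Section QuasiPoisson.
Variable k : fieldType.
Hypothesis two_neq0 : 2%:R != 0 :> k.
Local Notation A := (boalch k).
Local Notation A2 := (tensor A A).
Local Notation e := (be k).
Local Notation v := (bv k).
Local Notation g := (bgamma k).
Local Notation g' := (bgamma_inv k).
Let half : k := 2%:R^-1.
Local Notation bval loop := (pval e (edge k loop)).
Local Notation bval2 loop := (pval2 e (edge k loop)).
Local Notation bval3 loop := (pval3 e (edge k loop)).

Let eE := @be_idem k.
Let uh := @edge_head k.
Let ut := @edge_tail k.

Lemma fredE s : fval (bval true) (fred s) = bval true s.
Proof.
have pc i j t : bval true [:: i, j & t] = edge k true i j * bval true (j :: t).
  by rewrite /pval (pathv_cons (ut true)).
elim: s => [|i [|j t] IHs]; first by rewrite /fval big_nil.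
  by rewrite /fval big_seq1.
rewrite [fred _]/=.
have red (x : A) : e i3 * x = x ->
    g' i3 * (v a31 * (v a13 * x)) = x - g' i3 * x - g' i3 * (v a32 * (v a23 * x)) /\
    v a31 * (v a13 * (g' i3 * x)) = x - g' i3 * x - v a32 * (v a23 * (g' i3 * x)).
  move=> ex; have gE : v a31 * v a13 = g i3 - e i3 - v a32 * v a23.
    by rewrite gamma3E [e i3 + _]addrC addrAC addrK addrK.
  rewrite !mulrA -(mulrA (g' i3)) gE !mulrBr !mulrBl bgammaVl bgammaV_idem ex.
  by rewrite !mulrA bgammaV ex idem_bgammaV.
have h x : e i3 * bval true (i3 :: x) = bval true (i3 :: x).
  exact: (pathv_head eE (uh true) (ut true)).
case: ifP => [/eqP|_].
  case: t {IHs} => [|t1 [|t2 x]] // E.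
  have {E} [-> -> -> ->] : [/\ i = i3, j = i3, t1 = i1 & t2 = i3] by case: E.
  have dE y z : drop 2 [:: y, z & x] = x by rewrite /= drop0.
  rewrite dE /fval !big_cons big_nil.
  rewrite !mulrN1z addr0 addrA !pc; by have [-> _] := red _ (h x).
case: ifP => [/eqP|_].
  case: t {IHs} => [|t1 [|t2 x]] // E.
  have {E} [-> -> -> ->] : [/\ i = i3, j = i1, t1 = i3 & t2 = i3] by case: E.
  have dE y z : drop 2 [:: y, z & x] = x by rewrite /= drop0.
  rewrite dE /fval !big_cons big_nil.
  rewrite !mulrN1z addr0 addrA !pc; by have [_ ->] := red _ (h x).
rewrite fval_map pc -IHs (lin_fval _ _ (linear_mull (edge k true i j) (@linear_id k A))).
by apply: eq_fval => x /=; rewrite (pvalM eE (uh true) (ut true)).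
Qed.

Lemma fred2E t : fval (bval2 true) (fred2 t) = bval2 true t.
Proof.
rewrite fval_bind /pval2 -!fredE (lin_fval _ _ (linear_tensl _ (@linear_id k A))).
apply: eq_fval => p /=; rewrite fval_map.
by rewrite (lin_fval _ _ (linear_tensr _ (@linear_id k A))).
Qed.

Lemma fred2_bind F : fval (bval2 true) (fbind fred2 F) = fval (bval2 true) F.
Proof. by rewrite fval_bind; apply: eq_fval => t; apply: fred2E. Qed.

Definition loopless (s : path3) : bool := sorted [rel i j | i != j] s.

Lemma loopless_val loop s : loopless s -> bval loop s = bval false s.
Proof.
have eqe i j : i != j -> edge k loop i j = edge k false i j.
  rewrite /edge; case: arrow_of => // ij; case: ifP => // /and3P[_ /eqP i3E /eqP j3E].
  by rewrite i3E j3E eqxx in ij.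
case: s => // i s; rewrite /pval /=.
elim: s i => // j s IHs i /= /andP[ij js]; rewrite -(IHs _ js).
by case: s {IHs js} => [|l s]; rewrite eqe.
Qed.

Lemma loopless_arrow_table loop a b :
  fval (bval2 false) (arrow_table a b) = fval (bval2 loop) (arrow_table a b).
Proof.
have /allP ll : all (fun t => loopless t.2.1 && loopless t.2.2) (arrow_table a b).
  by case: a; case: b.
apply: eq_big_seq => t /ll /andP[t1 t2].
by rewrite /pval2 -(loopless_val loop t1) -(loopless_val loop t2).
Qed.

Variable br : double_bracket_type A.
Hypothesis brT : is_triangle_bracket br.
Let brP : is_double_bracket e br := tb_double_bracket brT.
Let brL := dbr_bilinear brP.

Lemma edge_tableE (loop : bool) :
  (loop -> forall a, br (g' i3) (v a) *+ 2 = - moment_rhs e i3 (g' i3) (v a)) ->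
  forall a i j,
  br (v a) (edge k loop i j) *+ 2 = fval (bval2 loop) (edge_table loop (hd a) (tl a) i j).
Proof.
move=> gE a i j; rewrite /edge_table /edge.
have -> : arrow_of (hd a) (tl a) = Some a by case: a.
case: arrow_of => [b|].
  have [_ ->] := (triangle_bracketP two_neq0 br).1 brT.
  by rewrite arrow_bracket2 // -loopless_arrow_table; case: a.
case: ifP => [/and3P[lo _ _]|_]; last first.
  by rewrite (lin0 (brL.1 _)) mul0rn /fval big_nil.
have fL := linear_flip (@linear_id k A2).
rewrite /gamma3V_table fflipE (fmoment_rhsE eE (uh loop) (ut loop)).
rewrite (dbr_antisym brP) mulNrn -(linMn fL) gE // (linN fL) opprK.
congr (flip (moment_rhs _ _ _ _)); last by case: a.
by rewrite /fval big_seq1 /= /edge /= lo.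
Qed.

Lemma moment_arrow (loop : bool) c s F a (x := fval (bval loop) F) :
  (loop -> forall a, br (g' i3) (v a) *+ 2 = - moment_rhs e i3 (g' i3) (v a)) ->
  fval (bval2 loop) (fbind (fbr (edge_table loop) (hd a) (tl a)) F ++
    fscale c (fflip (fmoment_rhs s F [:: hd a; tl a]))) = 0 ->
  br x (v a) *+ 2 = moment_rhs e s x (v a) *~ c.
Proof.
move=> gE; rewrite fval_cat fval_scale fflipE (fmoment_rhsE eE (uh loop) (ut loop)) -/x.
have -> : bval loop [:: hd a; tl a] = v a by case: a.
have -> : fval (bval2 loop) (fbind (fbr (edge_table loop) (hd a) (tl a)) F) =
    br (v a) x *+ 2.
  rewrite fval_bind /x (lin_fval _ _ (brL.1 _)) fvalMn; apply: eq_bigr => t _ /=.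
  rewrite -(edge_arrow _ loop a).
  rewrite (fbrE eE (uh loop) (ut loop) brP (T := edge_table loop)) // => i j.
  by rewrite (edge_arrow _ loop a); apply: edge_tableE.
have fL := linear_flip (@linear_id k A2).
move=> /eqP; rewrite addr_eq0 => /eqP E.
by rewrite (dbr_antisym brP) mulNrn -(linMn fL) E (linN fL) (linMz fL) flipK opprK.
Qed.

(** As a function of the other argument, moment_rhs is the inner derivation of
    e_s (x) x + x (x) e_s, hence both sides are derivations that kill the
    idempotents. *)
Lemma moment_generators c s x : x * e s = x -> e s * x = x ->
  (forall a, br x (v a) = c *: moment_rhs e s x (v a)) ->
  forall y, br x y = c *: moment_rhs e s x y.
Proof.
move=> xs sx xv.
have mE y : moment_rhs e s x y =
    outer y (e s ⊗ x + x ⊗ e s) 1 - outer 1 (e s ⊗ x + x ⊗ e s) y.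
  rewrite !(linD (linear_outer (@linear_id k A2) _ _)) !outer_tens !mul1r !mulr1.
  by rewrite /moment_rhs opprD addrACA addrA.
apply: (boalch_derivation_ext (outer_bimodule k)) => // [||i].
- by split=> [|y z]; [apply: brL.1 | rewrite (dbr_leibniz brP) addrC].
- split=> [|y z].
    under eq_fun do rewrite mE; apply: linear_scale; apply: linear_add.
      by apply: linear_outer_l; lin.
    by apply: linear_opp; apply: linear_outer_r; lin.
  rewrite !mE; move: (e s ⊗ x + x ⊗ e s) => t.
  have oL a b := linear_outer (@linear_id k A2) a b.
  rewrite !(linZ (oL _ _)) -scalerDr; congr (_ *: _).
  by rewrite !(linB (oL _ _)) !outer_outer !mul1r !mulr1 addrA subrK.
- have xi : x * e i = if s == i then x else 0.
    by rewrite -{1}xs -mulrA eE; case: eqP => _; rewrite ?mulr0 ?xs.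
  have ix : e i * x = if s == i then x else 0.
    by rewrite -{1}sx mulrA eE eq_sym; case: eqP => [<-|_]; rewrite ?mul0r ?sx.
  rewrite (br_idem_r brP) /moment_rhs xi ix !eE [i == s]eq_sym.
  case: eqP => [->|_]; first by rewrite subrr add0r subrr scaler0.
  by rewrite !tens0l !tens0r !(subr0, addr0) scaler0.
Qed.

(** Differentiating x * y = e_s expresses the bracket of x through that of its
    inverse y, and multiplying by x on both sides permutes the terms of
    moment_rhs. *)
Lemma moment_inverse c s x y : x * y = e s -> y * x = e s ->
  x * e s = x -> y * e s = y -> e s * x = x -> e s * y = y ->
  (forall b, br y b = c *: moment_rhs e s y b) ->
  forall b, br x b = - c *: moment_rhs e s x b.
Proof.
move=> xy yx xs ys sx sy yE b.
have iL := linear_inner (@linear_id k A2).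
have xE : br x b = inner 1 (br x b) (e s).
  by rewrite -{1}xs (dbr_leibniz_l brP) (br_idem_l brP) (lin0 (iL _ _)) add0r.
have E : inner 1 (br x b) y = - inner x (br y b) 1.
  apply/eqP; rewrite -addr_eq0 addrC -(dbr_leibniz_l brP) xy.
  by rewrite (br_idem_l brP).
have -> : br x b = inner 1 (inner 1 (br x b) y) x.
  by rewrite inner_inner mulr1 yx.
rewrite E yE (linN (iL _ _)) inner_inner mul1r (linZ (iL _ _)) scaleNr.
congr (- (_ *: _)); rewrite /moment_rhs !(linD (iL _ _)) !(linN (iL _ _)) !inner_tens.
rewrite -!mulrA sx yx xs !mulrA xy xs.
by rewrite [LHS](ACl (3*4*1*2)%AC).
Qed.

Lemma gamma3_eval loop : fval (bval loop) gamma3_paths = g i3.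
Proof.
rewrite gamma3E /gamma3_paths /fval !big_cons big_nil /= /edge /=.
by rewrite addr0 !mulr1z addrA.
Qed.

Lemma gamma1V_eval : fval (bval false) gamma1V_paths = g' i1.
Proof.
rewrite gamma1VE /gamma1V_paths /fval !big_cons big_nil /= /edge /=.
rewrite addr0 !mulrDl !mulrDr !mulrN !mulNr opprK -!mulrA.
by rewrite !mulr1z !mulrN1z !addrA.
Qed.

Lemma gamma2_eval : fval (bval true) gamma2_paths = g i2.
Proof.
have w23E : bw k a23 = (v a21 * v a13 + v a23) * g' i3.
  by rewrite -w23_gamma3 -mulrA bgammaV (arrow_idem eE (@bw_peirce k)).
rewrite gamma2E w23E /gamma2_paths /fval !big_cons big_nil /= /edge /=.
rewrite addr0 !mulrDl !mulrDr !opprD -!mulrA.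
by rewrite !mulr1z !mulrN1z !addrA.
Qed.

(** For gamma_3 and gamma_1^-1 the condition is a computation with paths in the
    v_ij; it passes to gamma_1 and gamma_3^-1 by moment_inverse, and with the
    brackets of gamma_3^-1 known, gamma_2 becomes a computation as well. *)
Lemma gamma_moment s b : br (g s) b = half *: moment_rhs e s (g s) b.
Proof.
have half_inj (x y : A2) : x *+ 2 = y -> x = half *: y.
  by move=> xy; apply: (mulrn2_inj two_neq0); rewrite half2.
have gs i : g i * e i = g i by rewrite bgamma_idem eqxx.
have sg i : e i * g i = g i by rewrite idem_bgamma eqxx.
have gVs i : g' i * e i = g' i by rewrite bgammaV_idem eqxx.
have sgV i : e i * g' i = g' i by rewrite idem_bgammaV eqxx.
have g3 y : br (g i3) y = half *: moment_rhs e i3 (g i3) y.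
  apply: moment_generators => // a; apply: half_inj.
  rewrite -(gamma3_eval false) -[RHS]mulr1z; apply: moment_arrow => //.
  by apply: (fvanishP (@pval2_null _ _ _ _)); case: a; vm_compute.
have g3V a : br (g' i3) (v a) *+ 2 = - moment_rhs e i3 (g' i3) (v a).
  rewrite (moment_inverse (c := half) (bgammaVl k i3) (bgammaV k i3)) //.
  by rewrite scaleNr mulNrn half2.
have g1V y : br (g' i1) y = - half *: moment_rhs e i1 (g' i1) y.
  apply: moment_generators => // a; rewrite scaleNr -scalerN.
  apply: half_inj; rewrite -gamma1V_eval -mulrN1z; apply: moment_arrow => //.
  by apply: (fvanishP (@pval2_null _ _ _ _)); case: a; vm_compute.
elim/ord3_ind: s => //.
  by rewrite (moment_inverse (bgammaV k i1) (bgammaVl k i1) _ _ _ _ g1V) // opprK.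
move: b; apply: moment_generators => // a; apply: half_inj.
rewrite -gamma2_eval -[RHS]mulr1z; apply: moment_arrow => //.
(* Two passes, as fred stops at the first product that it rewrites. *)
rewrite -2!fred2_bind.
by apply: (fvanishP (@pval2_null _ _ _ _)); case: a; vm_compute.
Qed.

Lemma boalch_moment_map : is_double_moment_map e br (boalch_moment k).
Proof.
have [GK KG] := momentK k.
split.
- by exists (g' i1 + g' i2 + g' i3).
- rewrite sum_ord3 !idem_moment !bgamma_idem !eqxx; reflexivity.
- move=> s a; rewrite idem_moment bgamma_idem eqxx; exact: gamma_moment.
Qed.

(** Both sides are derivations in the last argument. By cyclic invariance each
    argument can be moved to the last place, so three arrows suffice; there the
    identity is a computation with paths. *)
Lemma boalch_quasi_poisson : is_quasi_poisson_double e br.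
Proof.
have four_neq0 : 4%:R != 0 :> k by rewrite (natrM k 2 2) mulf_neq0.
have rhsL a b : linear (fun x => (4%:R : k)^-1 *: qp_rhs e a b x).
  by apply: linear_scale; apply: linear_qp_rhs.
have step (a b : A) :
    (forall c, triple_bracket br a b (v c) = 4%:R^-1 *: qp_rhs e a b (v c)) ->
    forall c, triple_bracket br a b c = 4%:R^-1 *: qp_rhs e a b c.
  move=> vE; apply: (boalch_derivation_ext (outer3_bimodule k)) => // [||i].
  - split=> [|x y]; first exact: (linear_triple brP).
    by rewrite (triple_leibniz brP).
  - split=> [|x y]; first exact: rhsL.
    rewrite qp_rhs_leibniz scalerDr.
    have o3L y z := linear_outer3 y z (@linear_id k (tensor A A2)).
    by rewrite !(linZ (o3L _ _)).
  - by rewrite (triple_idem brP) (qp_rhs_idem _ _ _ eE) scaler0.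
have rotE a b c : triple_bracket br b c a = 4%:R^-1 *: qp_rhs e b c a ->
    triple_bracket br a b c = 4%:R^-1 *: qp_rhs e a b c.
  move=> E; rewrite triple_rot E (linZ (linear_rot (@linear_id k _))).
  by rewrite -qp_rhs_rot.
have arrows a b c :
    triple_bracket br (v a) (v b) (v c) = 4%:R^-1 *: qp_rhs e (v a) (v b) (v c).
  have E : triple_bracket br (v a) (v b) (v c) *+ 4 = qp_rhs e (v a) (v b) (v c).
    have vE c' : v c' = bval false [:: hd c'; tl c'] by case: c'.
    have -> : qp_rhs e (v a) (v b) (v c) = fval (bval3 false)
        (fqp_rhs [:: hd a; tl a] [:: hd b; tl b] [:: hd c; tl c]).
      by rewrite (fqp_rhsE eE (uh false) (ut false)) -!vE.
    have := @ftripleE _ _ e (edge k false) eE (uh false) (ut false) br brP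
      (edge_table false) (hd a, tl a) (hd b, tl b) (hd c, tl c).
    rewrite /= !edge_arrow => ->.
      by apply: feq3; case: a; case: b; case: c; vm_compute.
    move=> x; rewrite !inE => /or3P[] /eqP-> i j /=; rewrite edge_arrow;
      exact: edge_tableE.
  by rewrite -E -scaler_nat scalerA mulVf // scale1r.
have a1 a b x := step _ _ (arrows a b) x.
have a2 a x y : triple_bracket br (v a) x y = 4%:R^-1 *: qp_rhs e (v a) x y.
  by apply: step => c; do 2!apply: (rotE); apply: a1.
move=> x y z; apply: step => c; do 2!apply: (rotE); exact: a2.
Qed.

Lemma boalch_hamiltonian : is_hamiltonian_double e br (boalch_moment k).
Proof.
split; [exact: brP | exact: boalch_quasi_poisson | exact: boalch_moment_map].
Qed.

End QuasiPoisson.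

(** With f the identity these are the vector fields on an affine scheme. The
    general case serves to check on generators the identities that involve the
    action of a group element or the morphism to the group. *)
Section MorphismDerivations.
Variables (k : fieldType) (X Y : Type).
Variables (R : pterm k X -> pterm k X -> Prop) (R' : pterm k Y -> pterm k Y -> Prop).
Local Notation A := (palg R).
Local Notation C := (palg R').
Hypothesis CC : commutative (@GRing.mul C).

Definition derivation_along (f : A -> C) (D : A -> C) : Prop :=
  linear D /\ forall x y, D (x * y) = D x * f y + f x * D y.

Lemma linear_palgl (V : lmodType k) (c : C) (F : V -> C) :
  linear F -> linear (fun x => F x * c).
Proof. by move=> FL a x y; rewrite FL mulrDl pscalerAl. Qed.

Lemma linear_palgr (V : lmodType k) (c : C) (F : V -> C) :
  linear F -> linear (fun x => c * F x).
Proof. by move=> FL a x y; rewrite FL mulrDr pscalerAr. Qed.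

Variable f : A -> C.
Hypotheses (fL : linear f) (fM : monoid_morphism f).

Lemma morphism_bimodule :
  is_bimodule (R := R) (fun x (m : C) => f x * m) (fun (m : C) y => m * f y).
Proof.
have [f1 fMM] := fM.
split=> [||m|m|x y m|x y m|x y m]; rewrite ?f1 ?mul1r ?mulr1 ?fMM ?mulrA //.
- by split=> m; [apply: linear_palgr; lin | apply: linear_palgl; lin].
- by split=> m; [apply: linear_palgr; lin | apply: linear_palgl; lin].
Qed.

Lemma derivation_alongP D : derivation_along f D ->
  is_derivation (R := R) (fun x (m : C) => f x * m) (fun (m : C) y => m * f y) D.
Proof. by move=> [DL DM]; split=> // x y; rewrite DM addrC. Qed.

Lemma derivation_along_ext D D' : derivation_along f D -> derivation_along f D' ->
  (forall x, D (pgen R x) = D' (pgen R x)) -> forall a, D a = D' a.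
Proof.
move=> /derivation_alongP dD /derivation_alongP dD'.
exact: derivation_ext morphism_bimodule _ _ dD dD'.
Qed.

Lemma derivation_along1 D : derivation_along f D -> D 1 = 0.
Proof. by move=> /derivation_alongP; apply: derivation1 morphism_bimodule _. Qed.

Lemma derivation_along0 : derivation_along f (fun=> 0).
Proof. by split=> [|x y]; [exact: linear_zero | rewrite mul0r mulr0 addr0]. Qed.

Lemma derivation_along_add D D' : derivation_along f D -> derivation_along f D' ->
  derivation_along f (fun x => D x + D' x).
Proof.
move=> [DL DM] [DL' DM']; split=> [|x y]; first by lin.
by rewrite DM DM' mulrDl mulrDr addrACA.
Qed.

Lemma derivation_along_opp D :
  derivation_along f D -> derivation_along f (fun x => - D x).
Proof.
move=> [DL DM]; split=> [|x y]; first by lin.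
by rewrite DM opprD mulNr mulrN.
Qed.

Lemma derivation_along_scale c D :
  derivation_along f D -> derivation_along f (fun x => c *: D x).
Proof.
move=> [DL DM]; split=> [|x y]; first by lin.
by rewrite DM scalerDr pscalerAl pscalerAr.
Qed.

Lemma derivation_along_mull c D :
  derivation_along f D -> derivation_along f (fun x => c * D x).
Proof.
move=> [DL DM]; split=> [|x y]; first exact: linear_palgr.
by rewrite DM mulrDr !mulrA [c * f x]CC.
Qed.

Lemma derivation_along_mulr c D :
  derivation_along f D -> derivation_along f (fun x => D x * c).
Proof.
move=> [DL DM]; split=> [|x y]; first exact: linear_palgl.
by rewrite DM mulrDl -!mulrA [f y * c]CC.
Qed.

Lemma derivation_along_sum I (r : seq I) (P : pred I) (D : I -> A -> C) :
  (forall i, P i -> derivation_along f (D i)) ->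
  derivation_along f (fun x => \sum_(i <- r | P i) D i x).
Proof.
move=> dD; split=> [c x y|x y].
  rewrite scaler_sumr -big_split; apply: eq_bigr => i /dD[DL _]; exact: DL.
rewrite mulr_suml mulr_sumr -big_split; apply: eq_bigr => i /dD[_ DM]; exact: DM.
Qed.

End MorphismDerivations.

(** * The bracket on the representation scheme *)

Section RepBracket.
Variables (k : fieldType) (A : algType k) (e : 'I_3 -> A) (d : 'I_3 -> nat).
Variable br : double_bracket_type A.
Hypothesis brP : is_double_bracket e br.
Local Notation N := (tdim d).
Local Notation Rp := (repalg e d).
Local Notation X := (coordmx e d).
Local Notation RC := (@repalg_mulC k A e d).
Local Notation der :=
  (derivation_along (R := rep_rel e (d := d)) (R' := rep_rel e (d := d)) id).

Lemma coordE a i j : X a i j = pgen (rep_rel e (d := d)) (a, i, j).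
Proof. by rewrite mxE. Qed.

Lemma linear_coord i j : linear (fun a => X a i j : Rp).
Proof.
move=> c a b; rewrite coordmxD !mxE; congr (_ + _).
rewrite -[RHS]mul1r -pscalerAr pscalerAl -pclass_const -[RHS]pclassM.
exact/pclassP/pres_rel/rep_scale.
Qed.

Lemma rep_ext D D' : der D -> der D' -> (forall a i j, D (X a i j) = D' (X a i j)) ->
  forall x, D x = D' x.
Proof.
move=> dD dD' E; apply: (derivation_along_ext _ _ dD dD') => // -[[a i] j].
by rewrite -coordE.
Qed.

(** With these indices entry2 u j i v of {{a, b}} is the bracket of a_ij and
    b_uv: outer multiplication acts on u and v, the indices of b, and inner
    multiplication on i and j, the indices of a. *)
Definition entry2 (u j i v : 'I_N) (t : tensor A A) : Rp :=
  tlift (fun x y => X x u j * X y i v) t.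

Lemma bilinear_entry2 u j i v : bilinear_map (fun x y => X x u j * X y i v).
Proof.
by split=> x; [apply: linear_palgr | apply: linear_palgl]; apply: linear_coord.
Qed.

Lemma linear_entry2 u j i v : linear (entry2 u j i v).
Proof. exact/tlift_linear/bilinear_entry2. Qed.

Lemma entry2_outerr u j i v t c :
  entry2 u j i v (outer 1 t c) = \sum_l entry2 u j i l t * X c l v.
Proof.
rewrite [LHS]tlift_outer; last exact: bilinear_entry2.
rewrite [LHS](_ : _ =
    tlift (fun x y => \sum_l X x u j * X y i l * X c l v) t); last first.
  apply: eq_tlift => x y; rewrite mul1r coordmxM [(_ *m _) i v]mxE mulr_sumr.
  by apply: eq_bigr => l _; rewrite mulrA.
by rewrite [LHS]exchange_big; apply: eq_bigr => l _; rewrite mulr_suml.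
Qed.

Lemma entry2_outerl u j i v t b :
  entry2 u j i v (outer b t 1) = \sum_l X b u l * entry2 l j i v t.
Proof.
rewrite [LHS]tlift_outer; last exact: bilinear_entry2.
rewrite [LHS](_ : _ =
    tlift (fun x y => \sum_l X b u l * (X x l j * X y i v)) t); last first.
  apply: eq_tlift => x y; rewrite mulr1 coordmxM [(_ *m _) u j]mxE mulr_suml.
  by apply: eq_bigr => l _; rewrite mulrA.
by rewrite [LHS]exchange_big; apply: eq_bigr => l _; rewrite mulr_sumr.
Qed.

Lemma entry2_flip u j i v t : entry2 u j i v (flip t) = entry2 i v u j t.
Proof.
rewrite [LHS]tlift_flip; last exact: bilinear_entry2.
by apply: eq_tlift => x y; apply: RC.
Qed.

Lemma entry2_innerl u j i v t a :
  entry2 u j i v (inner a t 1) = \sum_l X a i l * entry2 u j l v t.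
Proof.
rewrite -[inner a t 1]flipK flip_inner entry2_flip entry2_outerl.
by apply: eq_bigr => l _; rewrite entry2_flip.
Qed.

Lemma entry2_innerr u j i v t b :
  entry2 u j i v (inner 1 t b) = \sum_l entry2 u l i v t * X b l j.
Proof.
rewrite -[inner 1 t b]flipK flip_inner entry2_flip entry2_outerr.
by apply: eq_bigr => l _; rewrite entry2_flip.
Qed.

(** The Hamiltonian vector field of the function a_ij. *)
Definition coord_der_gen a i j (y : A * 'I_N * 'I_N) : Rp :=
  let: (b, u, v) := y in entry2 u j i v (br a b).

Definition coord_der a i j : Rp -> Rp := pder (coord_der_gen a i j).

Lemma coord_der_rel a i j s t : rep_rel e s t ->
  dterm (coord_der_gen a i j) s = dterm (coord_der_gen a i j) t.
Proof.
have brL := (dbr_bilinear brP).1 a.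
case=> /=.
- by move=> b c u v; rewrite (linD brL) (linD (linear_entry2 _ _ _ _)).
- move=> c b u v; rewrite (linZ brL) (linZ (linear_entry2 _ _ _ _)).
  by rewrite mul0r add0r pclass_const -pscalerAl mul1r.
- move=> b c u v; rewrite dterm_sum /= (dbr_leibniz brP).
  rewrite (linD (linear_entry2 _ _ _ _)) entry2_outerr entry2_outerl -big_split.
  by apply: eq_bigr => l _; rewrite !coordE.
- move=> s' u v; rewrite (br_idem_r brP) (lin0 (linear_entry2 _ _ _ _)).
  by case: (_ && _).
- by move=> x y; rewrite addrC; congr (_ + _); apply: RC.
Qed.

Lemma coord_der_coord a i j b u v :
  coord_der a i j (X b u v) = entry2 u j i v (br a b).
Proof. by rewrite coordE; apply: pder_pclass (@coord_der_rel a i j) _. Qed.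

Lemma coord_derP a i j : der (coord_der a i j).
Proof.
split; first exact: pder_linear (@coord_der_rel a i j).
exact: pderM (@coord_der_rel a i j).
Qed.

(** The bracket is extended from generators in the second argument first, by
    coord_der, and then in the first one. *)
Definition rep_bracket_gen (h : Rp) (y : A * 'I_N * 'I_N) : Rp :=
  let: (a, i, j) := y in coord_der a i j h.

Definition rep_bracket (f h : Rp) : Rp := pder (rep_bracket_gen h) f.

(** Each relation between the a_ij gives an equality of vector fields, which is
    checked on the functions b_uv; products use the inner Leibniz rule. *)
Lemma rep_bracket_rel h s t : rep_rel e s t ->
  dterm (rep_bracket_gen h) s = dterm (rep_bracket_gen h) t.
Proof.
have cP := coord_derP.
have brL b := (dbr_bilinear brP).2 b.
case=> /=.
- move=> a b i j; move: h; apply: rep_ext => [||c u v]; rewrite ?coord_der_coord.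
  + exact: cP.
  + by apply: derivation_along_add; apply: cP.
  + by rewrite (linD (brL c)) (linD (linear_entry2 _ _ _ _)).
- move=> c a i j; rewrite mul0r add0r pclass_const -pscalerAl mul1r.
  move: h; apply: rep_ext => [||b u v]; rewrite ?coord_der_coord.
  + exact: cP.
  + by apply: derivation_along_scale; apply: cP.
  + by rewrite (linZ (brL b)) (linZ (linear_entry2 _ _ _ _)).
- move=> a b i j; rewrite dterm_sum /=.
  move: h; apply: rep_ext => [||c u v]; rewrite ?coord_der_coord.
  + exact: cP.
  + apply: derivation_along_sum => l _; apply: derivation_along_add.
      by apply: (derivation_along_mulr RC); apply: cP.
    by apply: (derivation_along_mull RC); apply: cP.
  rewrite (dbr_leibniz_l brP) (linD (linear_entry2 _ _ _ _)) entry2_innerl entry2_innerr.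
  rewrite addrC -big_split; apply: eq_bigr => l _.
  by rewrite !coord_der_coord !coordE.
- move=> s' i j; rewrite [RHS](_ : _ = 0); last by case: (_ && _).
  move: h; apply: rep_ext => [||c u v]; rewrite ?coord_der_coord.
  + exact: cP.
  + exact: derivation_along0.
  + by rewrite (br_idem_l brP) (lin0 (linear_entry2 _ _ _ _)).
- by move=> x y; rewrite addrC; congr (_ + _); apply: RC.
Qed.

Lemma rep_bracket_coordl a i j h : rep_bracket (X a i j) h = coord_der a i j h.
Proof. by rewrite coordE; apply: pder_pclass (@rep_bracket_rel h) _. Qed.

Lemma rep_bracket_coord a i j b u v :
  rep_bracket (X a i j) (X b u v) = entry2 u j i v (br a b).
Proof. by rewrite rep_bracket_coordl coord_der_coord. Qed.

Lemma rep_bracket_derl h : der (rep_bracket^~ h).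
Proof.
split; first exact: pder_linear (@rep_bracket_rel h).
exact: pderM (@rep_bracket_rel h).
Qed.

Lemma rep_bracket_derr f : der (rep_bracket f).
Proof.
split=> [c h h'|h h']; move: f; apply: rep_ext => [||a i j].
- exact: rep_bracket_derl.
- by apply: derivation_along_add; [apply: derivation_along_scale|];
    apply: rep_bracket_derl.
- by rewrite !rep_bracket_coordl (coord_derP _ _ _).1.
- exact: rep_bracket_derl.
- apply: derivation_along_add.
    by apply: (derivation_along_mulr RC); apply: rep_bracket_derl.
  by apply: (derivation_along_mull RC); apply: rep_bracket_derl.
- by rewrite !rep_bracket_coordl (coord_derP _ _ _).2.
Qed.

Lemma rep_bracket_antisym f h : rep_bracket f h = - rep_bracket h f.
Proof.
move: f; apply: rep_ext => [||a i j].
- exact: rep_bracket_derl.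
- exact/derivation_along_opp/rep_bracket_derr.
move: h; apply: rep_ext => [||b u v].
- exact: rep_bracket_derr.
- exact/derivation_along_opp/rep_bracket_derl.
rewrite !rep_bracket_coord (dbr_antisym brP).
by rewrite (linN (linear_entry2 _ _ _ _)) entry2_flip.
Qed.

End RepBracket.

(** * Invariance and the Jacobiator *)

Section RepJacobi.
Variables (k : fieldType) (A : algType k) (e : 'I_3 -> A) (d : 'I_3 -> nat).
Variable br : double_bracket_type A.
Hypothesis brP : is_double_bracket e br.
Local Notation N := (tdim d).
Local Notation Rp := (repalg e d).
Local Notation X := (coordmx e d).
Local Notation RC := (@repalg_mulC k A e d).
Local Notation der :=
  (derivation_along (R := rep_rel e (d := d)) (R' := rep_rel e (d := d)) id).
Local Notation P := (rep_bracket (e := e) (d := d) br).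
Local Notation E2 := (@entry2 k A e d).
Local Notation sc := (scmx (rep_rel e (d := d))).

Lemma conj_entry (g h : 'M[k]_N) (M : 'M[Rp]_N) i j :
  (sc g *m M *m sc h) i j = \sum_l \sum_m (g i l * h m j) *: M l m.
Proof.
rewrite mxE exchange_big; apply: eq_bigr => m _.
rewrite !mxE mulr_suml; apply: eq_bigr => l _; rewrite !mxE.
by rewrite -pscalerAr mulr1 -pscalerAl mul1r scalerA mulrC.
Qed.

Lemma act_coord g a i j : in_GL g ->
  act g (X a i j) = \sum_l \sum_m (g i l * invmx g m j) *: X a l m.
Proof. by move=> gG; rewrite -conj_entry -(act_coordmx _ gG) [RHS]mxE. Qed.

(** For fixed g both sides are biderivations along the action of g. On two
    coordinates the equality is bilinear in the double bracket, and on a pure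
    tensor both sides are the same quadruple sum. *)
Lemma rep_bracket_invariant g f h : in_GL g -> P (act g f) (act g h) = act g (P f h).
Proof.
move=> gG; have aL : linear (act g : Rp -> Rp) by apply: act_linear.
have aMM : monoid_morphism (act g : Rp -> Rp) by apply: act_monoid_morphism.
have [a1 aM] := aMM.
have dl := @rep_bracket_derl _ _ _ d _ brP; have dr := @rep_bracket_derr _ _ _ d _ brP.
move: f; apply: (derivation_along_ext aL aMM) => [||[[a i] j]].
- split=> [c x y|x y]; first by rewrite aL (dl _).1.
  by rewrite aM (dl _).2.
- split=> [c x y|x y]; first by rewrite (dl _).1 aL.
  by rewrite (dl _).2 (linD aL) !aM.
rewrite -coordE.
move: h; apply: (derivation_along_ext aL aMM) => [||[[b u] v]].
- split=> [c x y|x y]; first by rewrite aL (dr _).1.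
  by rewrite aM (dr _).2.
- split=> [c x y|x y]; first by rewrite (dr _).1 aL.
  by rewrite (dr _).2 (linD aL) !aM.
rewrite -coordE (rep_bracket_coord brP) !(act_coord _ _ _ gG).
set g' := invmx g.
have -> : P (\sum_l \sum_m (g i l * g' m j) *: X a l m)
            (\sum_l \sum_m (g u l * g' m v) *: X b l m) =
  \sum_l \sum_m \sum_x \sum_y (g i l * g' m j) *: ((g u x * g' y v) *:
     E2 x m l y (br a b)).
  rewrite (lin_sum (dl _).1); apply: eq_bigr => l _.
  rewrite (lin_sum (dl _).1); apply: eq_bigr => m _.
  rewrite (linZ (dl _).1) (lin_sum (dr _).1) scaler_sumr; apply: eq_bigr => x _.
  rewrite (lin_sum (dr _).1) scaler_sumr; apply: eq_bigr => y _.
  by rewrite (linZ (dr _).1) (rep_bracket_coord brP).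
move: (br a b); apply: tens_ext => [||p q].
- do 4!apply: linear_bigsum => ?; do 2!apply: linear_scale; exact: linear_entry2.
- exact/(linear_comp aL)/linear_entry2.
rewrite /entry2 tlift_tens ?aM; last exact: bilinear_entry2.
rewrite !(act_coord _ _ _ gG) -/g' big_distrl /=.
under [RHS]eq_bigr => x _ do rewrite big_distrl /=.
under [RHS]eq_bigr => x _ do under eq_bigr => m _ do rewrite big_distrr /=.
under [RHS]eq_bigr => x _ do rewrite exchange_big /=.
rewrite [RHS]exchange_big /=; apply: eq_bigr => l _.
rewrite [RHS]exchange_big /=; apply: eq_bigr => m _.
apply: eq_bigr => x _; rewrite big_distrr /=; apply: eq_bigr => y _.
rewrite tlift_tens; last exact: bilinear_entry2.
rewrite -pscalerAl -pscalerAr !scalerA; congr (_ *: _).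
rewrite !mulrA; congr (_ * _); rewrite mulrAC (mulrC (g i l)) -!mulrA.
by congr (_ * _); rewrite mulrC.
Qed.

Definition entry3 r1 c1 r2 c2 r3 c3 (t : tensor A (tensor A A)) : Rp :=
  tlift (fun x s => X x r1 c1 * E2 r2 c2 r3 c3 s) t.

Lemma bilinear_entry3 r1 c1 r2 c2 r3 c3 :
  bilinear_map (fun x s => X x r1 c1 * E2 r2 c2 r3 c3 s).
Proof.
split=> s; [apply: linear_palgr | apply: linear_palgl].
- exact: linear_entry2.
- exact: linear_coord.
Qed.

Lemma linear_entry3 r1 c1 r2 c2 r3 c3 : linear (entry3 r1 c1 r2 c2 r3 c3).
Proof. exact/tlift_linear/bilinear_entry3. Qed.

Lemma entry3_tens r1 c1 r2 c2 r3 c3 x y z :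
  entry3 r1 c1 r2 c2 r3 c3 (x ⊗ (y ⊗ z)) = X x r1 c1 * (X y r2 c2 * X z r3 c3).
Proof.
rewrite [LHS]tlift_tens; last exact: bilinear_entry3.
by rewrite /entry2 tlift_tens //; apply: bilinear_entry2.
Qed.

Lemma entry3_rot r1 c1 r2 c2 r3 c3 t :
  entry3 r1 c1 r2 c2 r3 c3 (rot t) = entry3 r2 c2 r3 c3 r1 c1 t.
Proof.
move: t; apply: tens3_ext => [||x y z].
- apply: (linear_comp (linear_entry3 _ _ _ _ _ _)); apply: linear_rot; exact: linear_id.
- exact: linear_entry3.
by rewrite rot_tens !entry3_tens [LHS]RC -mulrA.
Qed.

(** This is the operation {{a, t}}_L of which triple_bracket is the sum over the
    cyclic permutations of the arguments. *)
Definition left_bracket a t : tensor A (tensor A A) :=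
  tlift (fun p1 p2 => tlift (fun q1 q2 => q1 ⊗ (q2 ⊗ p2)) (br a p1)) t.

Lemma triple_left_bracket a b c : triple_bracket br a b c =
  left_bracket a (br b c) + rot (left_bracket b (br c a))
  + rot (rot (left_bracket c (br a b))).
Proof.
have rotL := linear_rot (@linear_id k (tensor A (tensor A A))).
have r1 x t : rot (left_bracket x t) =
    tlift (fun p1 p2 => tlift (fun q1 q2 => p2 ⊗ (q1 ⊗ q2)) (br x p1)) t.
  rewrite (lin_tlift _ _ rotL); apply: eq_tlift => p1 p2.
  by rewrite (lin_tlift _ _ rotL); apply: eq_tlift => q1 q2; rewrite rot_tens.
rewrite tripleE !r1 (lin_tlift _ _ rotL); congr (_ + _); apply: eq_tlift => p1 p2.
by rewrite (lin_tlift _ _ rotL); apply: eq_tlift => q1 q2; rewrite rot_tens.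
Qed.

(** By the Leibniz rule the bracket with a_ij hits either factor of
    {{b, c}}'_wv {{b, c}}''_uz. Antisymmetry of the double bracket writes the
    second contribution as one with {{c, b}}. *)
Lemma rep_bracket3 a i j b u v c w z : P (X a i j) (P (X b u v) (X c w z)) =
  entry3 w j i v u z (left_bracket a (br b c))
  - entry3 u j i z w v (left_bracket a (br c b)).
Proof.
have [dL dM] := @rep_bracket_derr _ _ _ d _ brP (X a i j).
have e3L := linear_entry3.
have e2L := @linear_entry2 _ _ e d.
have brL := (dbr_bilinear brP).1 a.
rewrite (rep_bracket_coord brP) [LHS](lin_tlift _ _ dL).
have l3 r1 c1 r2 c2 r3 c3 t : entry3 r1 c1 r2 c2 r3 c3 (left_bracket a t) =
    tlift (fun p q => E2 r1 c1 r2 c2 (br a p) * X q r3 c3) t.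
  rewrite (lin_tlift _ _ (e3L _ _ _ _ _ _)); apply: eq_tlift => p q.
  rewrite (lin_tlift _ _ (e3L _ _ _ _ _ _)) /entry2 [RHS]mulr_suml.
  by apply: eq_bigr => s _; rewrite entry3_tens mulrA.
have bl r1 c1 r2 c2 r3 c3 :
    bilinear_map (fun p q => E2 r1 c1 r2 c2 (br a p) * X q r3 c3).
  split=> p; [apply: linear_palgr; exact: linear_coord | apply: linear_palgl].
  exact/(linear_comp (e2L _ _ _ _)).
rewrite !l3 (dbr_antisym brP c) (linN (tlift_linear (bl _ _ _ _ _ _))) opprK.
rewrite (tlift_flip _ (bl _ _ _ _ _ _)) tlift_add; apply: eq_tlift => p q.
by rewrite dM !(rep_bracket_coord brP) [X in _ = _ + X]RC.
Qed.

Definition jacobiator f h l : Rp := P f (P h l) + P h (P l f) + P l (P f h).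

Lemma jacobiator_rot f h l : jacobiator f h l = jacobiator h l f.
Proof. by rewrite /jacobiator -addrA addrC. Qed.

(** In the expansion of the Jacobiator on a product the terms in which both
    factors are bracketed cancel, because P is antisymmetric. *)
Lemma jacobiator_der f h : der (jacobiator f h).
Proof.
have dl := @rep_bracket_derl _ _ _ d _ brP; have dr := @rep_bracket_derr _ _ _ d _ brP.
split=> [c x y|x y]; rewrite /jacobiator.
  rewrite !(dr h).1 !(dl f).1 !(dr f).1 !(dr h).1 (dl _).1.
  by rewrite !scalerDr (AC (2*2*2)%AC ((1*3*5)*(2*4*6))%AC).
rewrite (dr h).2 (dl f).2 (linD (dr f).1) (linD (dr h).1) !(dr f).2 !(dr h).2 (dl _).2.
have b2 : P x f * P h y = - (P f x * P h y).
  by rewrite (rep_bracket_antisym brP x f) mulNr.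
have b3 : P h x * P y f = - (P h x * P f y).
  by rewrite (rep_bracket_antisym brP y f) mulrN.
rewrite b2 b3 [LHS](AC (((2*2)*(2*2))*2)%AC (((1*5*9)*(4*8*10))*((2*7)*(3*6)))%AC).
by rewrite /= !subrr !addr0 !mulrDl !mulrDr.
Qed.

(** The first terms of rep_bracket3 make up the triple bracket of a, b, c, the
    second ones that of a, c, b. *)
Lemma jacobiator_coord a i j b u v c w z :
  jacobiator (X a i j) (X b u v) (X c w z) =
  entry3 w j i v u z (triple_bracket br a b c)
  - entry3 u j i z w v (triple_bracket br a c b).
Proof.
have e3L := linear_entry3.
rewrite /jacobiator !rep_bracket3 !triple_left_bracket !(linD (e3L _ _ _ _ _ _)).
rewrite !entry3_rot !opprD.
by rewrite [LHS](AC (2*2*2)%AC (1*3*5*(2*6*4))%AC).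
Qed.

End RepJacobi.

(** * The Cartan trivector *)

Section DeltaMatrices.
Variables (C : comPzRingType) (n : nat).
Implicit Types (P Q R M : 'M[C]_n) (i j u v w z : 'I_n).

Lemma delta_mulmxE j i P x y : (delta_mx j i *m P) x y = (x == j)%:R * P i y.
Proof.
rewrite mxE (bigD1 i) //= big1 => [|l /negPf li]; last by rewrite mxE li andbF mul0r.
by rewrite mxE eqxx andbT addr0.
Qed.

Lemma mulmx_deltaE P j i x y : (P *m delta_mx j i) x y = P x j * (y == i)%:R.
Proof.
rewrite mxE (bigD1 j) //= big1 => [|l /negPf lj]; last by rewrite mxE lj mulr0.
by rewrite mxE eqxx addr0.
Qed.

Lemma trace_delta_mulmx j i P : \tr (delta_mx j i *m P) = P i j.
Proof.
rewrite /mxtrace (bigD1 j) //= delta_mulmxE eqxx mul1r big1 ?addr0 // => l /negPf lj.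
by rewrite delta_mulmxE lj mul0r.
Qed.

Lemma trace_mulmxC P Q : \tr (P *m Q) = \tr (Q *m P).
Proof.
rewrite /mxtrace; under eq_bigr => i _ do rewrite mxE.
rewrite exchange_big; apply: eq_bigr => i _; rewrite mxE.
by apply: eq_bigr => j _; rewrite mulrC.
Qed.

Lemma trace_expand3 (U1 U0 V1 V0 W1 W0 : 'M[C]_n) :
  \tr ((U1 - U0) *m (V1 - V0) *m (W1 - W0)) =
    \tr (U0 *m V0 *m W1) - \tr (U0 *m V1 *m W1) - \tr (U1 *m V0 *m W1)
  + \tr (U1 *m V1 *m W1) - \tr (U0 *m V0 *m W0) + \tr (U0 *m V1 *m W0)
  + \tr (U1 *m V0 *m W0) - \tr (U1 *m V1 *m W0).
Proof.
have trB U V : \tr (U - V) = \tr U - \tr V by rewrite raddfB.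
by rewrite !(mulmxBl, mulmxBr) !trB; ring.
Qed.

Lemma trace_mulmx_sum3 I (r : seq I) (Q : pred I) (a b c : I -> C) (D : I -> 'M[C]_n) :
  \tr ((\sum_(p <- r | Q p) a p *: D p) *m (\sum_(p <- r | Q p) b p *: D p)
       *m (\sum_(p <- r | Q p) c p *: D p)) =
  \sum_(p <- r | Q p) \sum_(q <- r | Q q) \sum_(s <- r | Q s)
    a p * (b q * c s) * \tr (D p *m D q *m D s).
Proof.
rewrite -mulmxA mulmx_suml raddf_sum; apply: eq_bigr => p _.
rewrite mulmx_suml mulmx_sumr raddf_sum; apply: eq_bigr => q _.
rewrite !mulmx_sumr raddf_sum; apply: eq_bigr => s _.
by rewrite /= -!(scalemxAl, scalemxAr) !mxtraceZ !mulrA -!mulmxA.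
Qed.

Lemma trace_delta3 j i P v u Q z w R :
  \tr (delta_mx j i *m P *m (delta_mx v u *m Q) *m (delta_mx z w *m R)) =
  P i v * (Q u z * R w j).
Proof.
rewrite -!mulmxA trace_delta_mulmx mxE (bigD1 v) //= big1 => [|l /negPf lv]; last first.
  by rewrite delta_mulmxE lv mul0r mulr0.
rewrite delta_mulmxE eqxx mul1r addr0; congr (_ * _).
rewrite mxE (bigD1 z) //= big1 => [|l /negPf lz]; last first.
  by rewrite delta_mulmxE lz mul0r mulr0.
by rewrite delta_mulmxE eqxx mul1r addr0.
Qed.

(** Each commutator has two terms, and the trace of a product that contains
    three delta matrices factors into three entries. The eight products are
    listed in the order of the quasi-Poisson condition. *)
Lemma trace_commutator3 B M M1 M2 j i v u z w (D := delta_mx j i)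
    (D1 := delta_mx v u) (D2 := delta_mx z w) :
  \tr ((D *m M - M *m D) *m B *m ((D1 *m M1 - M1 *m D1) *m B)
        *m ((D2 *m M2 - M2 *m D2) *m B)) =
    (M2 *m B *m M) w j * ((B *m M1) i v * B u z)
  - (M2 *m B *m M) w j * (B i v * (M1 *m B) u z)
  - (M2 *m B) w j * ((M *m B *m M1) i v * B u z)
  + (M2 *m B) w j * ((M *m B) i v * (M1 *m B) u z)
  - (B *m M) w j * ((B *m M1) i v * (B *m M2) u z)
  + (B *m M) w j * (B i v * (M1 *m B *m M2) u z)
  + B w j * ((M *m B *m M1) i v * (B *m M2) u z)
  - B w j * ((M *m B) i v * (M1 *m B *m M2) u z).
Proof.
have trE P Q R : \tr (D *m P *m (D1 *m Q) *m (D2 *m R)) = R w j * (P i v * Q u z).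
  by rewrite /D /D1 /D2 trace_delta3 mulrA mulrC.
have trC P Q R : \tr (M *m D *m P *m (D1 *m Q) *m (D2 *m R)) =
    (R *m M) w j * (P i v * Q u z).
  by rewrite -trE -!mulmxA trace_mulmxC !mulmxA.
have commE (D' B' M' : 'M[C]_n) : (D' *m M' - M' *m D') *m B' =
    D' *m (M' *m B') - M' *m D' *m B'.
  by rewrite mulmxBl !mulmxA.
rewrite !commE trace_expand3 -!trC -!trE.
by rewrite !mulmxA.
Qed.

(** The counterpart of trace_commutator3 for the moment map: the four terms are
    those of moment_rhs. *)
Lemma commutator_entry F B M v u i j (D := delta_mx v u) :
  (F *m (B *m (D *m M - M *m D) *m B) + B *m (D *m M - M *m D) *m B *m F) i j =
    (M *m B) u j * (F *m B) i v - B u j * (F *m B *m M) i v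
  + (M *m (B *m F)) u j * B i v - (B *m F) u j * (B *m M) i v.
Proof.
have dE P Q : (P *m D *m Q) i j = Q u j * P i v.
  rewrite -mulmxA mxE (bigD1 v) //= big1 => [|l /negPf lv]; last first.
    by rewrite delta_mulmxE lv mul0r mulr0.
  by rewrite delta_mulmxE eqxx mul1r addr0 mulrC.
have subE (P Q : 'M[C]_n) : (P - Q) i j = P i j - Q i j by rewrite !mxE.
have -> : F *m (B *m (D *m M - M *m D) *m B) =
    (F *m B) *m D *m (M *m B) - (F *m B *m M) *m D *m B.
  by rewrite !(mulmxBl, mulmxBr) !mulmxA.
have -> : B *m (D *m M - M *m D) *m B *m F =
    B *m D *m (M *m (B *m F)) - (B *m M) *m D *m (B *m F).
  by rewrite !(mulmxBl, mulmxBr) !mulmxA.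
by rewrite mxE !subE !dE addrA.
Qed.

End DeltaMatrices.

Section CartanTrivector.
Variables (k : fieldType) (A : algType k) (e : 'I_3 -> A) (d : 'I_3 -> nat).
Local Notation N := (tdim d).
Local Notation Rp := (repalg e d).
Local Notation X := (coordmx e d).
Local Notation RC := (@repalg_mulC k A e d).
Local Notation sc := (scmx (rep_rel e (d := d))).
Local Notation idx := ('I_N * 'I_N)%type.
Implicit Types (p q r : idx) (f h l : Rp).

Lemma wedge3E (u v w : Rp -> Rp) f h l : wedge3 u v w f h l =
  (u f * (v h * w l) + u h * (v l * w f) + u l * (v f * w h))
  - (u h * (v f * w l) + u f * (v l * w h) + u l * (v h * w f)).
Proof. rewrite /wedge3; ring. Qed.

Lemma wedge3N (u v w : Rp -> Rp) f h l : wedge3 v u w f h l = - wedge3 u v w f h l.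
Proof. rewrite /wedge3; ring. Qed.

Let inf p : Rp -> Rp := infact (gl_basis k p).
Let T p q r : k := \tr (gl_dual k p *m gl_dual k q *m gl_dual k r).

Definition trace_sum (F : idx -> idx -> idx -> Rp) : Rp :=
  \sum_(p | gl_index p) \sum_(q | gl_index q) \sum_(r | gl_index r) T p q r *: F p q r.

Lemma eq_trace_sum F F' : (forall p q r, F p q r = F' p q r) ->
  trace_sum F = trace_sum F'.
Proof.
by move=> E; apply: eq_bigr => p _; apply: eq_bigr => q _; apply: eq_bigr => r _; rewrite E.
Qed.

Lemma trace_sumD F F' :
  trace_sum (fun p q r => F p q r + F' p q r) = trace_sum F + trace_sum F'.
Proof.
rewrite /trace_sum -big_split; apply: eq_bigr => p _ /=; rewrite -big_split.
apply: eq_bigr => q _ /=; rewrite -big_split; apply: eq_bigr => r _ /=.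
by rewrite scalerDr.
Qed.

Lemma trace_sumN F : trace_sum (fun p q r => - F p q r) = - trace_sum F.
Proof.
rewrite /trace_sum -sumrN; apply: eq_bigr => p _; rewrite -sumrN.
by apply: eq_bigr => q _; rewrite -sumrN; apply: eq_bigr => r _; rewrite scalerN.
Qed.

Lemma trace_sum_rot F : trace_sum (fun p q r => F r p q) = trace_sum F.
Proof.
rewrite /trace_sum; under eq_bigr => p _ do rewrite exchange_big.
rewrite exchange_big; apply: eq_bigr => r _; apply: eq_bigr => p _; apply: eq_bigr => q _.
by rewrite /T mxtrace_mulC mulmxA.
Qed.

(** The image under the infinitesimal action of the element of the third tensor
    power of gl_d that corresponds to the trilinear form tr (x y z). *)
Definition trace_form f h l : Rp :=
  trace_sum (fun p q r => inf p f * (inf q h * inf r l)).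

Lemma trace_form_rot f h l : trace_form f h l = trace_form h l f.
Proof.
rewrite /trace_form -trace_sum_rot; apply: eq_trace_sum => p q r.
by rewrite [LHS]RC -mulrA.
Qed.

(** The wedge product has six terms, which by cyclic invariance of the trace
    are three times each of the two trace forms. The Lie bracket doubles this,
    as the wedge product is antisymmetric, and 1/12 times 6 is 1/2. *)
Lemma cartan_trivectorE f h l : 2%:R != 0 :> k -> 3%:R != 0 :> k ->
  cartan_trivector f h l = 2%:R^-1 *: (trace_form f h l - trace_form h f l).
Proof.
move=> k2 k3.
pose W p q r := wedge3 (inf p) (inf q) (inf r) f h l.
have WE : trace_sum W = 3%:R *: (trace_form f h l - trace_form h f l).
  rewrite (eq_trace_sum (fun p q r => wedge3E (inf p) (inf q) (inf r) f h l)).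
  rewrite trace_sumD trace_sumN !trace_sumD -!/(trace_form _ _ _).
  rewrite -(trace_form_rot f h l) (trace_form_rot l f h).
  rewrite (trace_form_rot f l h) (trace_form_rot l h f).
  by rewrite scalerBr !scaler_nat !mulrS !mulr0n !addr0 !addrA.
have W'E p q r : W q p r = - W p q r by exact: wedge3N.
have -> : cartan_trivector f h l = 12%:R^-1 *:
    (trace_sum W - trace_sum (fun p q r => W q p r)).
  congr (_ *: _); rewrite /trace_sum [X in _ - X]exchange_big -sumrB.
  apply: eq_bigr => p _; rewrite -sumrB; apply: eq_bigr => q _.
  rewrite -sumrB; apply: eq_bigr => r _.
  by rewrite /lie mulmxBl raddfB scalerBl.
rewrite [X in _ - X](_ : _ = - trace_sum W); last first.
  by rewrite -trace_sumN; apply: eq_trace_sum.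
rewrite opprK WE -mulr2n -scaler_nat !scalerA.
congr (_ *: _); have k12 : 12%:R != 0 :> k.
  by rewrite (natrM k 4 3) (natrM k 2 2) !mulf_neq0.
by field; rewrite k2 k12.
Qed.

(** The differential of f along the infinitesimal action, as an element of gl_d
    by means of the trace pairing. *)
Definition trace_mx f : 'M[Rp]_N :=
  \matrix_(z, x) (if blk z == blk x then inf (x, z) f else 0).

Lemma trace_formE f h l : trace_form f h l = \tr (trace_mx f *m trace_mx h *m trace_mx l).
Proof.
pose G f' := \sum_(p | gl_index p) inf p f' *: sc (gl_dual k p).
have GE f' : trace_mx f' = G f'.
  apply/matrixP=> z x; rewrite mxE summxE big_mkcond (bigD1 (x, z)) //= big1.
    rewrite addr0 /gl_index /= eq_sym; case: eqP => // _.
    by rewrite !mxE !eqxx scale1r mulr1.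
  move=> [p1 p2] ne; case: ifP => // _; rewrite !mxE /=.
  case: eqP => [zp|_]; case: eqP => [xp|_]; rewrite /= ?scale0r ?mulr0 //.
  by rewrite zp xp eqxx in ne.
have trT p q r : \tr (sc (gl_dual k p) *m sc (gl_dual k q) *m sc (gl_dual k r)) =
    T p q r *: (1 : Rp).
  rewrite -!scmxM /mxtrace scaler_suml; apply: eq_bigr => i _.
  by rewrite mxE.
rewrite !GE /G trace_mulmx_sum3.
apply: eq_bigr => p _; apply: eq_bigr => q _; apply: eq_bigr => r _.
by rewrite trT -pscalerAr mulr1.
Qed.

Lemma scmx_blk_idemE s (M : 'M[Rp]_N) z x :
  (sc (blk_idem d k s) *m M) z x = (blk z == s)%:R * M z x.
Proof.
rewrite mxE (bigD1 z) //= big1 => [|l /negPf lz]; last first.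
  by rewrite !mxE eq_sym lz scale0r mul0r.
by rewrite !mxE eqxx addr0; case: eqP; rewrite ?scale1r ?scale0r.
Qed.

Lemma mulmx_scmx_blk_idemE s (M : 'M[Rp]_N) z x :
  (M *m sc (blk_idem d k s)) z x = M z x * (blk x == s)%:R.
Proof.
rewrite mxE (bigD1 x) //= big1 => [|l /negPf lz]; last first.
  by rewrite !mxE lz scale0r mulr0.
by rewrite !mxE eqxx addr0; case: eqP; rewrite ?scale1r ?scale0r.
Qed.

Lemma scmx_blk_idemM s t :
  sc (blk_idem d k s) *m sc (blk_idem d k t) =
  if s == t then sc (blk_idem d k s) else 0.
Proof.
apply/matrixP=> z x; rewrite scmx_blk_idemE !mxE.
have [->|zx] := eqVneq z x; last first.
  by rewrite scale0r mulr0; case: eqP => _; rewrite !mxE ?(negPf zx) ?scale0r.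
case: (eqVneq s t) => [->|st]; rewrite !mxE ?eqxx /=.
  by case: eqP; rewrite ?scale1r ?scale0r ?mul1r ?mul0r.
have [xs|_] := eqVneq (blk x) s; last by rewrite mul0r.
by rewrite xs (negPf st) scale0r mulr0.
Qed.

(** Here the infinitesimal action turns from a commutator in the index of the
    function into a commutator in the index of the direction. *)
Lemma infact_delta x z a i j : blk x = blk z ->
  inf (x, z) (X a i j) = (delta_mx j i *m X a - X a *m delta_mx j i) z x.
Proof.
move=> xz; have xi_gl : block_diag (gl_basis k (x, z)).
  by apply: gl_basis_block_diag; rewrite /gl_index /= xz.
have /matrixP/(_ i j) := infact_coordmx e xi_gl a; rewrite mxE /inf => ->.
rewrite [RHS]mxE [X in _ = _ + X]mxE delta_mulmxE mulmx_deltaE.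
have -> : sc (gl_basis k (x, z)) = delta_mx x z.
  by apply/matrixP=> p q; rewrite !mxE; case: (_ && _); rewrite ?scale1r ?scale0r.
rewrite /lie [LHS]mxE [X in - X]mxE [X in _ + X]mxE delta_mulmxE mulmx_deltaE opprB.
by rewrite [j == z]eq_sym [i == x]eq_sym RC; congr (_ - _); rewrite RC.
Qed.

Lemma trace_mx_coord a i j : trace_mx (X a i j) =
  \sum_s sc (blk_idem d k s) *m (delta_mx j i *m X a - X a *m delta_mx j i)
    *m sc (blk_idem d k s).
Proof.
apply/matrixP=> z x; rewrite mxE summxE.
under eq_bigr => s _ do rewrite mulmx_scmx_blk_idemE scmx_blk_idemE.
rewrite (bigD1 (blk z)) //= eqxx mul1r big1 => [|s /negPf sz]; last first.
  by rewrite eq_sym sz !mul0r.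
rewrite addr0 eq_sym; case: eqP => [xz|_]; last by rewrite mulr0.
by rewrite mulr1 infact_delta.
Qed.

Local Notation B s := (sc (blk_idem d k s) : 'M[Rp]_N).

(** Blocks with different indices annihilate each other, so that traces of
    products of matrices as in trace_mx_coord are sums over a single block. *)
Lemma block_sum_mul (U V : 'I_3 -> 'M[Rp]_N) :
  (\sum_s B s *m U s *m B s) *m (\sum_s B s *m V s *m B s) =
  \sum_s B s *m (U s *m B s *m V s) *m B s.
Proof.
rewrite mulmx_suml; apply: eq_bigr => s _; rewrite mulmx_sumr (bigD1 s) //= big1.
  rewrite addr0 !mulmxA -(mulmxA (B s *m U s)) scmx_blk_idemM eqxx.
  by rewrite -!mulmxA.
move=> t /negPf ts; rewrite !mulmxA -(mulmxA (B s *m U s)) scmx_blk_idemM eq_sym ts.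
by rewrite mulmx0 !mul0mx.
Qed.

Lemma trace_form_coord a i j b u v c w z :
  trace_form (X a i j) (X b u v) (X c w z) = entry3 e w j i v u z (qp_rhs e a b c).
Proof.
have e3L := @linear_entry3 _ _ e d.
rewrite trace_formE !trace_mx_coord !block_sum_mul raddf_sum.
rewrite /qp_rhs [RHS](lin_sum (e3L _ _ _ _ _ _)).
apply: eq_bigr => s _.
rewrite !(linD (e3L _ _ _ _ _ _)) !(linN (e3L _ _ _ _ _ _)) !entry3_tens.
rewrite !coordmxM !coordmx_idem.
have trB (Y : 'M[Rp]_N) : \tr (B s *m Y *m B s) = \tr (Y *m B s).
  by rewrite -mulmxA trace_mulmxC -mulmxA scmx_blk_idemM eqxx.
apply: etrans (trB _) _.
apply: etrans (trace_commutator3 (B s) (X a) (X b) (X c) j i v u z w).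
by rewrite !mulmxA.
Qed.

End CartanTrivector.

(** * The quasi-Poisson structure and the group-valued moment map *)

Section RepQuasiPoisson.
Variables (k : fieldType) (A : algType k) (e : 'I_3 -> A) (d : 'I_3 -> nat).
Hypotheses (k2 : 2%:R != 0 :> k) (k3 : 3%:R != 0 :> k).
Variable br : double_bracket_type A.
Hypotheses (brP : is_double_bracket e br) (brQ : is_quasi_poisson_double e br).
Local Notation N := (tdim d).
Local Notation Rp := (repalg e d).
Local Notation X := (coordmx e d).
Local Notation RC := (@repalg_mulC k A e d).
Local Notation P := (rep_bracket (e := e) (d := d) br).
Local Notation der :=
  (derivation_along (R := rep_rel e (d := d)) (R' := rep_rel e (d := d)) id).

Lemma infact_der p : gl_index p -> der (infact (gl_basis k p)).
Proof.
move=> /(gl_basis_block_diag k) xi; split; first exact: infact_linear.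
by move=> x y; rewrite infactM.
Qed.

Lemma cartan_trivector_der (f h : Rp) : der (cartan_trivector f h).
Proof.
have tf (f' h' : Rp) : der (trace_form f' h').
  apply: derivation_along_sum => p _; apply: derivation_along_sum => q _.
  apply: derivation_along_sum => r /infact_der dr; apply: derivation_along_scale.
  by do 2!apply: (derivation_along_mull RC).
have [DL DM] := derivation_along_scale (2%:R^-1)
  (derivation_along_add (tf f h) (derivation_along_opp (tf h f))).
split=> [c x y|x y]; rewrite !cartan_trivectorE //; exact: DL.
Qed.

Lemma cartan_trivector_rot (f h l : Rp) :
  cartan_trivector f h l = cartan_trivector h l f.
Proof.
rewrite !cartan_trivectorE // (trace_form_rot f h l) (trace_form_rot h f l).
by rewrite (trace_form_rot f l h).
Qed.

Lemma schouten_square_der (f h : Rp) : der (schouten_square P f h).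
Proof. exact/derivation_along_scale/jacobiator_der. Qed.

Lemma schouten_square_rot (f h l : Rp) :
  schouten_square P f h l = schouten_square P h l f.
Proof. by congr (_ *: _); apply: jacobiator_rot. Qed.

(** The Schouten square is twice the Jacobiator and the quasi-Poisson condition
    has the factor 1/4; their product is the factor 1/2 of cartan_trivectorE. *)
Lemma schouten_coord a i j b u v c w z :
  schouten_square P (X a i j) (X b u v) (X c w z) =
  cartan_trivector (X a i j) (X b u v) (X c w z).
Proof.
rewrite cartan_trivectorE // (trace_form_rot (X b u v)) !trace_form_coord.
rewrite -[LHS]/(2%:R *: jacobiator br _ _ _) jacobiator_coord //.
have e3L := @linear_entry3 _ _ e d.
have Q x y t : triple_bracket br x y t = 4%:R^-1 *: qp_rhs e x y t by exact: brQ.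
rewrite !Q !(linZ (e3L _ _ _ _ _ _)) -scalerBr scalerA.
have k4 : 4%:R != 0 :> k by rewrite (natrM k 2 2) mulf_neq0.
by congr (_ *: _); field; rewrite k2 k4.
Qed.

Lemma rep_quasi_poisson : is_quasi_poisson P.
Proof.
split.
- by split=> f; [exact: (rep_bracket_derr brP f).1 | exact: (rep_bracket_derl brP f).1].
- exact: rep_bracket_antisym.
- by move=> f h l; rewrite (rep_bracket_derr brP f).2.
- exact: rep_bracket_invariant.
have step (f h : Rp) :
    (forall c w z, schouten_square P f h (X c w z) = cartan_trivector f h (X c w z)) ->
    forall l, schouten_square P f h l = cartan_trivector f h l.
  by apply: rep_ext; [exact: schouten_square_der | exact: cartan_trivector_der].
have rotE (f h l : Rp) : schouten_square P h l f = cartan_trivector h l f ->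
    schouten_square P f h l = cartan_trivector f h l.
  by move=> E; rewrite (schouten_square_rot f) (cartan_trivector_rot f).
have s1 a i j b u v l := step _ _ (schouten_coord a i j b u v) l.
have s2 a i j h l : schouten_square P (X a i j) h l = cartan_trivector (X a i j) h l.
  by apply: step => c w z; do 2!apply: (rotE); exact: s1.
by move=> f h l; apply: step => c w z; do 2!apply: (rotE); exact: s2.
Qed.

End RepQuasiPoisson.

Section RepMomentMap.
Variables (k : fieldType) (A : algType k) (e : 'I_3 -> A) (d : 'I_3 -> nat).
Variable br : double_bracket_type A.
Hypothesis brP : is_double_bracket e br.
Hypothesis e_idem : forall i j, e i * e j = if i == j then e i else 0.
Hypothesis e_one : \sum_s e s = 1.
Local Notation N := (tdim d).
Local Notation Rp := (repalg e d).
Local Notation GL := (glalg k d).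
Local Notation X := (coordmx e d).
Local Notation RC := (@repalg_mulC k A e d).
Local Notation P := (rep_bracket (e := e) (d := d) br).
Local Notation sc := (scmx (rep_rel e (d := d))).
Local Notation der :=
  (derivation_along (R := rep_rel e (d := d)) (R' := rep_rel e (d := d)) id).
Let B s : 'M[Rp]_N := sc (blk_idem d k s).
Local Notation cst := (fun c : k => c *: (1 : Rp)).

Lemma coordmx1 : X 1 = 1%:M.
Proof.
have X0 : X 0 = 0.
  by apply/matrixP=> i j; rewrite (lin0 (linear_coord e i j)) mxE.
rewrite -e_one (big_morph X (@coordmxD _ _ e d) X0); apply/matrixP=> i j.
rewrite summxE (bigD1 (blk i)) //= coordmx_idem big1 => [|s /negPf si].
  by rewrite addr0 !mxE eqxx andbT; case: eqP; rewrite ?scale1r ?scale0r.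
by rewrite coordmx_idem !mxE [blk i == s]eq_sym si andbF scale0r.
Qed.

Variables (Phi Psi : A).
Hypotheses (PhiPsi : Phi * Psi = 1) (PsiPhi : Psi * Phi = 1).
Hypothesis Phi_diag : Phi = \sum_s e s * Phi * e s.

Lemma moment_idemC s : e s * Phi = Phi * e s.
Proof.
have l : e s * Phi = e s * Phi * e s.
  rewrite {1}Phi_diag mulr_sumr (bigD1 s) //= !mulrA e_idem eqxx big1 ?addr0 // => t ts.
  by rewrite !mulrA e_idem eq_sym (negPf ts) !mul0r.
rewrite l; rewrite [in RHS]Phi_diag mulr_suml (bigD1 s) //= -!mulrA e_idem eqxx.
rewrite big1 ?addr0 ?mulrA // => t ts.
by rewrite -!mulrA e_idem (negPf ts) !mulr0.
Qed.

Lemma moment_inv_idemC s : e s * Psi = Psi * e s.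
Proof.
rewrite -[LHS]mul1r -PsiPhi -!mulrA; congr (_ * _).
by rewrite mulrA -moment_idemC -mulrA PhiPsi mulr1.
Qed.

(** An element that commutes with the e_s has no entries outside of the blocks,
    since the matrix of e_s is the identity of the block s. *)
Lemma coordmx_block_diag a : (forall s, e s * a = a * e s) -> block_diag (X a).
Proof.
move=> aC i j ij.
have /(congr1 (fun M : 'M[Rp]_N => M i j)) : B (blk i) *m X a = X a *m B (blk i).
  by rewrite /B -coordmx_idem -!coordmxM aC.
rewrite scmx_blk_idemE mulmx_scmx_blk_idemE eqxx mul1r => ->.
by rewrite eq_sym (negPf ij) mulr0.
Qed.

Definition moment_gen (y : gl_gen N) : Rp :=
  match y with GlX i j => X Phi i j | GlY i j => X Psi i j end.

Definition rep_moment : GL -> Rp := plift cst moment_gen.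

Lemma moment_gen_rel s t : gl_rel s t -> eval cst moment_gen s = eval cst moment_gen t.
Proof.
have one i j : (1%:M : 'M[Rp]_N) i j =
    eval cst moment_gen (if i == j then 1 else 0)%pres.
  by rewrite mxE; case: eqP; rewrite /= ?scale1r ?scale0r.
case=> /=.
- by move=> i j; rewrite -one -coordmx1 -PhiPsi coordmxM mxE eval_sum.
- by move=> i j; rewrite -one -coordmx1 -PsiPhi coordmxM mxE eval_sum.
- move=> i j ij; rewrite scale0r; apply: coordmx_block_diag ij; exact: moment_idemC.
- move=> i j ij; rewrite scale0r; apply: coordmx_block_diag ij; exact: moment_inv_idemC.
- by move=> u v; apply: RC.
Qed.

Lemma rep_moment_linear : linear rep_moment.
Proof. exact: plift_alg_linear (@moment_gen_rel). Qed.

Lemma rep_moment_morphism : monoid_morphism rep_moment.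
Proof. exact: plift_alg_morphism (@moment_gen_rel). Qed.

Lemma rep_moment_X i j : rep_moment (glX k d i j) = X Phi i j.
Proof. by rewrite mxE; exact: (plift_alg_pclass (@moment_gen_rel)). Qed.

Lemma rep_moment_Y i j : rep_moment (glY k d i j) = X Psi i j.
Proof. by rewrite mxE; exact: (plift_alg_pclass (@moment_gen_rel)). Qed.

Local Notation mu := rep_moment.
Local Notation scG := (scmx (@gl_rel k d)).

Lemma rep_moment_mulmx (M M' : 'M[GL]_N) i j :
  mu ((M *m M') i j) = (map_mx mu M *m map_mx mu M') i j.
Proof.
rewrite !mxE (lin_sum rep_moment_linear); apply: eq_bigr => l _.
by rewrite rep_moment_morphism.2 !mxE.
Qed.

Lemma map_rep_moment_X : map_mx mu (glX k d) = X Phi.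
Proof. by apply/matrixP=> i j; rewrite [LHS]mxE rep_moment_X. Qed.

Lemma map_rep_moment_Y : map_mx mu (glY k d) = X Psi.
Proof. by apply/matrixP=> i j; rewrite [LHS]mxE rep_moment_Y. Qed.

Lemma map_rep_moment_sc g : map_mx mu (scG g) = sc g :> 'M[Rp]_N.
Proof.
apply/matrixP=> i j; rewrite !mxE (linZ rep_moment_linear).
by rewrite rep_moment_morphism.1.
Qed.

Lemma map_rep_moment_mulmx (M M' : 'M[GL]_N) :
  map_mx mu (M *m M') = map_mx mu M *m map_mx mu M'.
Proof. by apply/matrixP=> i j; rewrite [LHS]mxE rep_moment_mulmx. Qed.

Lemma rep_moment_equivariant g f : in_GL g -> mu (gl_conj g f) = act g (mu f).
Proof.
move=> gG; move: f.
have aL : linear (act g : Rp -> Rp) by apply: act_linear.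
have aM : monoid_morphism (act g : Rp -> Rp) by apply: act_monoid_morphism.
have cL : linear (gl_conj g : GL -> GL) by exact: plift_alg_linear (gl_conj_val_rel gG).
have cM : monoid_morphism (gl_conj g : GL -> GL).
  exact: plift_alg_morphism (gl_conj_val_rel gG).
have [mL mM] := (rep_moment_linear, rep_moment_morphism).
have conjE a i j : act g (X a i j) = (sc g *m X a *m sc (invmx g)) i j.
  by rewrite -(act_coordmx e gG) [RHS]mxE.
apply: morphism_ext.
- exact: linear_comp mL cL.
- by split=> [|x y]; rewrite ?cM.1 ?mM.1 // cM.2 mM.2.
- exact: linear_comp aL mL.
- by split=> [|x y]; rewrite ?mM.1 ?aM.1 // mM.2 aM.2.
case=> i j; rewrite [gl_conj _ _](gl_conj_pclass gG) /= !rep_moment_mulmx.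
- rewrite map_rep_moment_mulmx map_rep_moment_X !map_rep_moment_sc -conjE.
  by rewrite -rep_moment_X mxE.
- rewrite map_rep_moment_mulmx map_rep_moment_Y !map_rep_moment_sc -conjE.
  by rewrite -rep_moment_Y mxE.
Qed.

Local Notation der_mu :=
  (derivation_along (R := @gl_rel k d) (R' := rep_rel e (d := d)) mu).

(** Differentiating the product of the universal matrix and its inverse
    determines the derivation on the entries of the inverse. *)
Lemma gl_derivation0 D : der_mu D -> (forall i j, D (glX k d i j) = 0) ->
  forall f, D f = 0.
Proof.
move=> dD DX; have [DL DM] := dD.
have DY i j : D (glY k d i j) = 0.
  have XD : X Phi *m map_mx D (glY k d) = 0.
    apply/matrixP=> l m; rewrite [LHS]mxE [RHS]mxE.
    have : D ((glX k d *m glY k d) l m) = 0.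
      rewrite glXY mxE; case: eqP => _; last exact: lin0.
      by have := derivation_along1 rep_moment_linear rep_moment_morphism dD.
    rewrite mxE (lin_sum DL) => E; rewrite -[RHS]E; apply: eq_bigr => p _.
    by rewrite DM DX mul0r add0r rep_moment_X [map_mx _ _ _ _]mxE.
  have /matrixP/(_ i j) : map_mx D (glY k d) = 0.
    by rewrite -[LHS]mul1mx -coordmx1 -PsiPhi coordmxM -mulmxA XD mulmx0.
  by rewrite [LHS]mxE [RHS]mxE.
apply: (derivation_along_ext rep_moment_linear rep_moment_morphism dD) => //.
  exact: derivation_along0.
by case=> i j; [rewrite -(DX i j) | rewrite -(DY i j)]; rewrite mxE.
Qed.

Lemma gl_derivation_ext D D' : der_mu D -> der_mu D' ->
  (forall i j, D (glX k d i j) = D' (glX k d i j)) -> forall f, D f = D' f.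
Proof.
move=> dD dD' DX f; apply/eqP; rewrite -subr_eq0; apply/eqP; move: f.
apply: gl_derivation0; first exact/(derivation_along_add dD)/derivation_along_opp.
by move=> i j; rewrite DX subrr.
Qed.

Hypothesis Phi_bracket : forall s a, let Phis := e s * Phi * e s in
  br Phis a = (2%:R : k)^-1 *:
      ((a * e s) ⊗ Phis - e s ⊗ (Phis * a) + (a * Phis) ⊗ e s - Phis ⊗ (e s * a)).

Lemma rep_moment_bracket_coord i j a u v :
  P (X Phi i j) (X a u v) = (2%:R : k)^-1 *:
    (X Phi *m trace_mx (X a u v) + trace_mx (X a u v) *m X Phi) i j.
Proof.
rewrite (rep_bracket_coord brP) {1}Phi_diag.
rewrite (lin_sum ((dbr_bilinear brP).2 a)) (lin_sum (linear_entry2 e _ _ _ _)).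
rewrite trace_mx_coord mulmx_sumr mulmx_suml -big_split summxE scaler_sumr.
apply: eq_bigr => s _; rewrite Phi_bracket (linZ (linear_entry2 e _ _ _ _)).
congr (_ *: _).
have eL := @linear_entry2 _ _ e d u j i v.
have eT x y : entry2 e u j i v (x ⊗ y) = X x u j * X y i v.
  by rewrite /entry2 tlift_tens //; apply: bilinear_entry2.
have sE : e s * Phi * e s = Phi * e s by rewrite moment_idemC -mulrA e_idem eqxx.
rewrite sE (linB eL) (linD eL) (linB eL) !eT -{3 4}moment_idemC !coordmxM !coordmx_idem.
exact/esym/commutator_entry.
Qed.

Lemma gl_left_der xi : block_diag xi ->
  derivation_along (R := @gl_rel k d) (R' := @gl_rel k d) id (gl_left xi).
Proof.
move=> xid; split; first exact: pder_linear (gl_left_val_rel xid).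
exact: pderM (gl_left_val_rel xid).
Qed.

Lemma gl_right_der xi : block_diag xi ->
  derivation_along (R := @gl_rel k d) (R' := @gl_rel k d) id (gl_right xi).
Proof.
move=> xid; split; first exact: pder_linear (gl_right_val_rel xid).
exact: pderM (gl_right_val_rel xid).
Qed.

(** Both sides are derivations in f and in h. On coordinates, the sum over the
    dual bases contracts to an entry of F G + G F, where F is the matrix of Phi
    and G = trace_mx h. *)
Lemma rep_moment_bracket f h :
  P (mu f) h = (2%:R : k)^-1 *: \sum_(p | gl_index p)
      (mu (gl_left (gl_basis k p) f + gl_right (gl_basis k p) f)
       * infact (gl_dual k p) h : Rp).
Proof.
have [mL mM] := (rep_moment_linear, rep_moment_morphism).
move: f; apply: gl_derivation_ext => [||i j].
- have [PL PM] := rep_bracket_derl brP h.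
  by split=> [c x y|x y]; rewrite ?mL ?PL // mM.2 PM.
- apply: derivation_along_scale; apply: derivation_along_sum => p pI.
  apply: (derivation_along_mulr RC).
  have [lL lM] := gl_left_der (gl_basis_block_diag k pI).
  have [rL rM] := gl_right_der (gl_basis_block_diag k pI).
  split=> [c x y|x y]; first by rewrite lL rL -mL scalerDr addrACA.
  rewrite lM rM addrACA (linD mL) -mulrDl -mulrDr !mM.2 //.
have infD p : gl_index p -> der (infact (gl_dual k p)).
  by move=> pI; apply: (@infact_der _ _ e d (p.2, p.1)); rewrite /gl_index eq_sym.
move: h; apply: rep_ext => [||a u v].
- exact: rep_bracket_derr.
- apply: derivation_along_scale; apply: derivation_along_sum => p pI.
  by apply: (derivation_along_mull RC); apply: infD.
rewrite [mu (glX k d i j)]rep_moment_X rep_moment_bracket_coord; congr (_ *: _).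
set C := trace_mx (X a u v).
pose K x z := (X Phi i x * (j == z)%:R + (i == x)%:R * X Phi z j) * C x z.
have lrE p : gl_index p ->
    mu (gl_left (gl_basis k p) (glX k d i j) + gl_right (gl_basis k p) (glX k d i j)) =
    X Phi i p.1 * (j == p.2)%:R + (i == p.1)%:R * X Phi p.2 j.
  move=> /(gl_basis_block_diag k) pI.
  have /matrixP/(_ i j) := gl_left_glX pI; rewrite mxE => ->.
  have /matrixP/(_ i j) := gl_right_glX pI; rewrite mxE => ->.
  rewrite (linD mL) !rep_moment_mulmx map_rep_moment_X !map_rep_moment_sc.
  have -> : sc (gl_basis k p) = delta_mx p.1 p.2 :> 'M[Rp]_N.
    by apply/matrixP=> x y; rewrite !mxE; case: (_ && _); rewrite ?scale1r ?scale0r.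
  by rewrite mulmx_deltaE delta_mulmxE.
have CE p : gl_index p -> infact (gl_dual k p) (X a u v) = C p.1 p.2.
  by rewrite /C [RHS]mxE /gl_index => ->.
rewrite (eq_bigr (fun p => K p.1 p.2)); last by move=> p pI; rewrite lrE // CE.
rewrite big_mkcond.
rewrite (eq_bigr (fun p => K p.1 p.2)); last first.
  move=> p _; case: ifP => // /negbT; rewrite /gl_index => /negPf pN.
  by rewrite /K /C [trace_mx _ _ _]mxE pN mulr0.
rewrite -(pair_bigA _ K) /= {}/K.
under eq_bigr => x _ do under eq_bigr => z _ do rewrite mulrDl.
under eq_bigr => x _ do rewrite big_split /=.
rewrite big_split /= mxE; congr (_ + _).
  rewrite mxE; apply: eq_bigr => x _.
  rewrite (bigD1 j) //= eqxx mulr1 big1 ?addr0 // => z zj.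
  by rewrite eq_sym (negPf zj) mulr0 mul0r.
rewrite mxE exchange_big; apply: eq_bigr => z _ /=.
rewrite (bigD1 i) //= eqxx mul1r big1 ?addr0 => [|x xi]; first exact: RC.
by rewrite eq_sym (negPf xi) !mul0r.
Qed.

End RepMomentMap.

(** The theorem of Van den Bergh: the bracket is rep_bracket, and the morphism to
    the group is given by the matrices of Phi and of its inverse. *)
Theorem hamiltonian_double_induces (k : fieldType) (A : algType k)
    (e : 'I_3 -> A) (d : 'I_3 -> nat) (br : double_bracket_type A) (Phi : A) :
  2%:R != 0 :> k -> 3%:R != 0 :> k ->
  (forall i j, e i * e j = if i == j then e i else 0) -> \sum_s e s = 1 ->
  is_hamiltonian_double e br Phi -> induces_hamiltonian_quasi_poisson e d br Phi.
Proof.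
move=> k2 k3 eE e1 [brP brQ [[Psi [PhiPsi PsiPhi]] Phi_diag Phi_br]].
exists (rep_bracket (e := e) (d := d) br), (rep_moment e (d := d) Phi Psi); split.
- by move=> a b i j u v; apply: rep_bracket_coord.
- exact: map_rep_moment_X.
split; first exact: rep_quasi_poisson.
split.
- exact: rep_moment_linear.
- exact: rep_moment_morphism.
- by move=> g f; apply: rep_moment_equivariant.
- by move=> f h; apply: rep_moment_bracket.
Qed.

Theorem corollary4p7 (k : closedFieldType) (k_char0 : [pchar k] =i pred0)
    (d : 'I_3 -> nat) :
  (exists! br : double_bracket_type (boalch k), is_triangle_bracket br) /\
  (forall br : double_bracket_type (boalch k), is_triangle_bracket br ->
     is_hamiltonian_double (be k) br (boalch_moment k) /\
     induces_hamiltonian_quasi_poisson (be k) d br (boalch_moment k)).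
Proof.
have k2 : 2%:R != 0 :> k by rewrite (pcharf0P k).1.
have k3 : 3%:R != 0 :> k by rewrite (pcharf0P k).1.
split=> [|br brT]; first exact: triangle_bracket_unique.
have ham := boalch_hamiltonian k2 brT; split=> //.
apply: hamiltonian_double_induces ham => //; first exact: be_idem.
by rewrite sum_ord3 be_one.
Qed.
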